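(* Let $m_X,m_Y,\Omega_X,\Omega_Y,\bar\gamma>0$, let $p,q$ be coprime positive integers and $\alpha=2p/q$, and let $\gamma$ be the instantaneous SNR of the $\alpha$-Beaulieu–Xie shadowed channel with average SNR $\bar\gamma$. Then the ergodic capacity $\overline{C}:=\mathbb{E}[\log_2(1+\gamma)]$ equals $$\overline{C}=\frac{q^{m_X-\frac12}(1-\bar\beta)^{m_Y}}{(2\pi)^{\frac{q-3}{2}+p}\ln 2}\sum_{k=0}^\infty\frac{(m_Y)_k}{\Gamma(m_X+k)}\frac{(q\bar\beta)^k}{k!}\,G^{\,q+p+1,\,p}_{p+1,\,q+p+1}\!\left(\Big(\frac{1}{q\,\mathrm{C}_\alpha\bar\gamma^{\alpha/2}}\Big)^q\,\middle|\,\begin{matrix}\Delta(p,0),\,1\\ \Delta(p,0),\,\Delta(q,m_X+k),\,0\end{matrix}\right).$$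
   Context: Fix parameters $m_X,m_Y,\Omega_X,\Omega_Y>0$. The Beaulieu–Xie shadowed envelope is a random variable $\bar R>0$ with density $$f_{\bar R}(r)=\frac{2r^{2m_X-1}}{\Gamma(m_X)}\left(\frac{m_Y\Omega_X}{m_Y\Omega_X+m_X\Omega_Y}\right)^{m_Y}\left(\frac{m_X}{\Omega_X}\right)^{m_X}{}_1F_1\!\left(m_Y;m_X;\frac{m_X^2\Omega_Y r^2}{\Omega_X(m_Y\Omega_X+m_X\Omega_Y)}\right)e^{-\frac{m_X}{\Omega_X}r^2},\quad r>0.$$ Set $\bar\beta=\frac{m_X\Omega_Y}{m_Y\Omega_X+m_X\Omega_Y}$. For $\alpha>0$ put $$\mathrm{C}_\alpha=\left[\frac{\Gamma(m_X)}{\Gamma(m_X+\frac{2}{\alpha})\,{}_2F_1\!\left(m_Y,-\frac{2}{\alpha};m_X;-\frac{m_X\Omega_Y}{m_Y\Omega_X}\right)}\right]^{\alpha/2}.$$ For $\bar\gamma>0$, the instantaneous SNR of the $\alpha$-Beaulieu–Xie shadowed channel with average SNR $\bar\gamma$ is the random variable $\gamma=\bar\gamma\,\big(\mathrm{C}_\alpha m_X\bar R^2/\Omega_X\big)^{2/\alpha}$. Here ${}_1F_1(a;b;z)=\sum_{n\ge0}\frac{(a)_n}{(b)_n}\frac{z^n}{n!}$, ${}_2F_1$ is the Gauss hypergeometric function, $(a)_n$ the Pochhammer symbol. $\Delta(a,b)$ denotes the list $\frac{b}{a},\frac{b+1}{a},\dots,\frac{b+a-1}{a}$. $G^{m,n}_{P,Q}$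 is the Meijer G-function, $G^{m,n}_{P,Q}\!\left(z\middle|\begin{matrix}a_1,\dots,a_P\\ b_1,\dots,b_Q\end{matrix}\right)=\frac{1}{2\pi i}\int_L\frac{\prod_{j=1}^m\Gamma(b_j-s)\prod_{j=1}^n\Gamma(1-a_j+s)}{\prod_{j=m+1}^Q\Gamma(1-b_j+s)\prod_{j=n+1}^P\Gamma(a_j-s)}z^s\,ds$ with the standard contour $L$. *)

(* Defs.v *)
From Stdlib Require Import Reals List Arith Factorial.
From Coquelicot Require Import Coquelicot.
Open Scope R_scope.

Definition int0inf (f : R -> R) : R :=
  RInt_gen f (at_right 0) (Rbar_locally p_infty).
Definition Cint_line (f : R -> C) : C :=
  @RInt_gen C_R_CompleteNormedModule f (Rbar_locally m_infty) (Rbar_locally p_infty).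
Definition Cint0inf (f : R -> C) : C :=
  @RInt_gen C_R_CompleteNormedModule f (at_right 0) (Rbar_locally p_infty).

Definition Gamma (x : R) : R :=
  int0inf (fun t => Rpower t (x - 1) * exp (- t)).

Definition Cpowr (x : R) (s : C) : C :=
  (Rpower x (Re s) * cos (Im s * ln x), Rpower x (Re s) * sin (Im s * ln x)).

Definition CGamma (z : C) : C :=
  Cint0inf (fun t => Cmult (RtoC (exp (- t) / t)) (Cpowr t z)).

Fixpoint poch (a : R) (n : nat) : R :=
  match n with O => 1 | S n => poch a n * (a + INR n) end.

Definition hyp1F1 (a b z : R) : R :=
  Series (fun n => poch a n / poch b n * z ^ n / INR (fact n)).

Definition hyp2F1_series (a b c z : R) : R :=
  Series (fun n => poch a n * poch b n / poch c n * z ^ n / INR (fact n)).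

(* Gauss 2F1 on the real half line z < 1/2 (principal branch), via the Pfaff
   transformation 2F1(a,b;c;z) = (1-z)^(-a) 2F1(a,c-b;c;z/(z-1)); for z < 1/2 we
   have |z/(z-1)| < 1, so the series converges. *)
Definition hyp2F1 (a b c z : R) : R :=
  Rpower (1 - z) (- a) * hyp2F1_series a (c - b) c (z / (z - 1)).

Definition DeltaL (a : nat) (b : R) : list R :=
  map (fun i => (b + INR i) / INR a) (seq 0 a).

Definition Cprod (l : list C) : C := fold_right Cmult (RtoC 1) l.

(* Meijer G-function G^{m,n}_{P,Q}(z | a ; b) for real z > 0 and real
   parameters, defined by the Mellin-Barnes integral over the vertical contour
   L = { c + i t : t in R } (oriented upwards), so that
   (1/(2 pi i)) \int_L F(s) ds = (1/(2 pi)) \int_R F(c + i t) dt. *)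
Definition meijerG (m n : nat) (a b : list R) (c z : R) : C :=
  Cmult (RtoC (/ (2 * PI))) (Cint_line (fun t =>
    let s : C := (c, t) in
    Cmult
      (Cdiv
        (Cmult (Cprod (map (fun bj => CGamma (Cminus (RtoC bj) s)) (firstn m b)))
               (Cprod (map (fun aj => CGamma (Cplus (RtoC (1 - aj)) s)) (firstn n a))))
        (Cmult (Cprod (map (fun bj => CGamma (Cplus (RtoC (1 - bj)) s)) (skipn m b)))
               (Cprod (map (fun aj => CGamma (Cminus (RtoC aj) s)) (skipn n a)))))
      (Cpowr z s))).

Definition BX_density (mX mY OX OY r : R) : R :=
  2 * Rpower r (2 * mX - 1) / Gamma mX
  * Rpower (mY * OX / (mY * OX + mX * OY)) mY
  * Rpower (mX / OX) mX
  * hyp1F1 mY mX (mX ^ 2 * OY * r ^ 2 / (OX * (mY * OX + mX * OY)))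
  * exp (- (mX / OX) * r ^ 2).

Definition betabar (mX mY OX OY : R) : R := mX * OY / (mY * OX + mX * OY).

Definition C_alpha (mX mY OX OY alpha : R) : R :=
  Rpower (Gamma mX /
          (Gamma (mX + 2 / alpha) * hyp2F1 mY (- (2 / alpha)) mX (- (mX * OY / (mY * OX)))))
         (alpha / 2).

Definition snr (mX mY OX OY alpha gbar r : R) : R :=
  gbar * Rpower (C_alpha mX mY OX OY alpha * mX * r ^ 2 / OX) (2 / alpha).

Definition ergodic_capacity (mX mY OX OY alpha gbar : R) : R :=
  int0inf (fun r => BX_density mX mY OX OY r
                    * (ln (1 + snr mX mY OX OY alpha gbar r) / ln 2)).

(* Main.v *)
(* The substitution [x = e^xi] turns every improper integral into the integral over R of a
   continuous function that decays exponentially at both ends, a class in which Fubini and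
   termwise integration of series need only elementary estimates.

   With [x = m_X r^2 / Omega_X] the capacity becomes a series of integrals
   [int x^(a-1) e^(-x) ln(1 + A x^(q/p)) dx], [a = m_X + k].  Inserting the inverse Mellin
   transform [ln(1 + u) = 1/(2 pi i) int pi / (s sin(pi s)) u^(-s) ds] on [-1 < Re s < 0] and
   exchanging the integrals gives a Mellin-Barnes integral with integrand
   [pi / (s sin(pi p s)) Gamma(a - q s) A^(-p s)]; the reflection formula and Gauss's
   multiplication formula rewrite it as the product of Gamma factors defining the G-function.

   Both the reflection formula and the inverse Mellin transform are instances of
   [int exp(z x) / (1 + exp(x + i t)) dx = exp(- i z t) pi / sin(pi z)], [0 < Re z < 1],
   [|t| < pi]: the dependence on [t] follows by shifting the line of integration, and the
   value at [t = 0] from the two lines [t = pi/2], [t = - pi/2], which show that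
   [sin(pi z) int exp(z x) / (1 + exp x) dx] is invariant under [z -> z/2]. *)
Require Import Defs.
From Stdlib Require Import Reals List Arith Lra Lia FunctionalExtensionality.
From Coquelicot Require Import Coquelicot.
Open Scope R_scope.

(** * Integrals over R of exponentially decaying functions *)

(** No analytic continuation and no decay estimate for Gamma on vertical lines is used. All decay in
    the Mellin variable comes from [1 / sin (pi p s)]; the integrand of [Gamma (a - q s)] has a
    modulus depending only on [Re s], which is what gives Fubini its product bound. The condition
    [-1/p < c < 0] says exactly that [sin (pi p s)] on the contour is a logistic denominator
    [1 + exp (x + i t)] with [|t| < pi]. The invariance under [z -> z/2] becomes a value by letting
    [z] tend to [0] along [z / 2^n]. Gauss's formula comes from the functional equation:
    [Gamma (q z + q n)] and the product of the [Gamma (z + i/q + n)] carry the same rising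
    factorial, and [Gamma (n + w) ~ Gamma n * n^w] for complex [w] settles their ratio. That
    relation is a law of large numbers: for a Gamma(n)-distributed [X] the mean of [(X/n)^w] tends
    to 1, as controlled by integer moments. The constant first appears in terms of the unknown limit
    in Stirling's formula; the multiplication formula itself, at [q = 2], [z = 1/2], together with
    reflection, then determines that limit. *)

Lemma exp_le_exp a b : a <= b -> exp a <= exp b.
Proof. intros [H|H]; [left; apply exp_increasing; trivial|subst; lra]. Qed.

Lemma exp_decay_le_1 d x : 0 < d -> exp (- d * Rabs x) <= 1.
Proof. intros Hd. rewrite <- exp_0. apply exp_le_exp. assert (H := Rabs_pos x). nra. Qed.

Ltac der_cont :=
  lazymatch goal with
  | |- continuous ?f ?x => apply (ex_derive_continuous f x)
  | |- filterlim ?f (locally ?x) _ => apply (ex_derive_continuous f x)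
  end; auto_derive; trivial.

(** The constants are arguments rather than existential: termwise integration sums the bounds [M k]
    at a common rate [d], and parameter integrals need one bound valid for all parameters. *)
Definition expdec (M d : R) (f : R -> R) : Prop :=
  0 < d /\ (forall x, continuous f x) /\
  forall x, Rabs (f x) <= M * exp (- d * Rabs x).

Definition Iline (f : R -> R) : R :=
  RInt_gen f (Rbar_locally m_infty) (Rbar_locally p_infty).

Ltac Rring := apply Rminus_diag_uniq; ring.

Lemma ex_RInt_cont (f : R -> R) a b : (forall x, continuous f x) -> ex_RInt f a b.
Proof. intros H; apply (@ex_RInt_continuous R_CompleteNormedModule); auto. Qed.

Lemma expdec_cst_nonneg M d f : expdec M d f -> 0 <= M.
Proof.
  intros [_ [_ H]]. specialize (H 0).
  rewrite Rabs_R0, Rmult_0_r, exp_0, Rmult_1_r in H.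
  apply Rle_trans with (2 := H), Rabs_pos.
Qed.

Lemma continuous_eps (f : R -> R) x :
  (forall e, 0 < e -> exists dl, 0 < dl /\ forall y, Rabs (y - x) < dl -> Rabs (f y - f x) < e) ->
  continuous f x.
Proof.
  intros H P [e He].
  destruct (H e (cond_pos e)) as [dl [Hdl Hy]].
  exists (mkposreal dl Hdl). intros y By. apply He. apply Hy, By.
Qed.

Lemma RInt_exp_decay (M d u v : R) : 0 < d ->
  RInt (fun x => M * exp (- d * x)) u v = M / d * exp (- d * u) - M / d * exp (- d * v).
Proof.
  intros Hd. apply is_RInt_unique.
  replace (M / d * exp (- d * u) - M / d * exp (- d * v))
    with (minus (- (M / d) * exp (- d * v)) (- (M / d) * exp (- d * u)))
    by (unfold minus, plus, opp; simpl; ring).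
  apply (is_RInt_derive (fun x => - (M / d) * exp (- d * x))).
  - intros x _. auto_derive; trivial. field; lra.
  - intros x _. der_cont.
Qed.

Lemma RInt_tail_r M d f u v : expdec M d f -> 0 <= u <= v ->
  Rabs (RInt f u v) <= M / d * exp (- d * u).
Proof.
  intros Hf [Hu Huv]. destruct (Hf) as [Hd [Hc Hb]].
  apply Rle_trans with (RInt (fun x => M * exp (- d * x)) u v).
  - apply Rle_trans with (1 := abs_RInt_le f u v Huv (ex_RInt_cont f u v Hc)).
    apply RInt_le; trivial.
    + apply ex_RInt_cont. intros x. apply (continuous_comp f Rabs); trivial.
      apply continuous_Rabs.
    + apply ex_RInt_cont. intros x.
      der_cont.
    + intros x Hx. generalize (Hb x). rewrite (Rabs_pos_eq x) by lra. trivial.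
  - rewrite RInt_exp_decay by trivial.
    assert (0 <= M / d * exp (- d * v)).
    { apply Rmult_le_pos; [|left; apply exp_pos].
      apply Rmult_le_pos; [apply (expdec_cst_nonneg _ _ _ Hf)|left; apply Rinv_0_lt_compat; trivial]. }
    lra.
Qed.

Lemma expdec_opp_arg M d f : expdec M d f -> expdec M d (fun x => f (- x)).
Proof.
  intros [Hd [Hc Hb]]. split; [trivial|split].
  - intros x. apply (continuous_comp (fun x => - x) f); trivial.
    apply (continuous_opp (fun x : R => x)), continuous_id.
  - intros x. rewrite <- (Rabs_Ropp x). apply Hb.
Qed.

Lemma RInt_affine (f : R -> R) b d u v : (forall x, continuous f x) ->
  b * RInt (fun x => f (b * x + d)) u v = RInt f (b * u + d) (b * v + d).
Proof.
  intros Hc.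
  rewrite <- (RInt_comp_lin f b d u v) by (apply ex_RInt_cont; trivial).
  rewrite (RInt_scal (fun y => f (b * y + d)) u v b); [reflexivity|].
  apply ex_RInt_cont. intros x.
  apply (continuous_comp (fun x => b * x + d) f); trivial.
  der_cont.
Qed.

Lemma RInt_opp_arg (f : R -> R) u v : (forall x, continuous f x) ->
  RInt (fun x => f (- x)) u v = - RInt f (- u) (- v).
Proof.
  intros Hc. generalize (RInt_affine f (-1) 0 u v Hc).
  replace (-1 * u + 0) with (- u) by ring. replace (-1 * v + 0) with (- v) by ring.
  intros E. rewrite <- E.
  replace (RInt (fun y => f (-1 * y + 0)) u v) with (RInt (fun x => f (- x)) u v); [Rring|].
  apply RInt_ext. intros x _. f_equal. ring.
Qed.

Lemma RInt_swap (f : R -> R) a b : (forall x, continuous f x) ->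
  RInt f a b = - RInt f b a.
Proof.
  intros Hc. rewrite <- (opp_RInt_swap f b a); [reflexivity|]. apply ex_RInt_cont; trivial.
Qed.

Lemma RInt_split (f : R -> R) a b c : (forall x, continuous f x) ->
  RInt f a b + RInt f b c = RInt f a c.
Proof. intros Hc. apply (RInt_Chasles f); apply ex_RInt_cont; trivial. Qed.

Lemma tail_coef_pos M d f B : expdec M d f -> 0 <= M / d * exp (- d * B).
Proof.
  intros Hf. apply Rmult_le_pos; [|left; apply exp_pos].
  apply Rmult_le_pos; [apply (expdec_cst_nonneg _ _ _ Hf)|left; apply Rinv_0_lt_compat; apply Hf].
Qed.

Lemma tail_coef_mono M d f B u : expdec M d f -> B <= u ->
  M / d * exp (- d * u) <= M / d * exp (- d * B).
Proof.
  intros Hf HB. apply Rmult_le_compat_l.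
  - apply Rmult_le_pos; [apply (expdec_cst_nonneg _ _ _ Hf)|left; apply Rinv_0_lt_compat; apply Hf].
  - apply exp_le_exp. destruct Hf as [Hd _]. nra.
Qed.

Lemma RInt_tail_right M d f B u v : expdec M d f -> 0 <= B -> B <= u -> B <= v ->
  Rabs (RInt f u v) <= M / d * exp (- d * B).
Proof.
  intros Hf HB Hu Hv. destruct (Rle_dec u v) as [H|H].
  - apply Rle_trans with (1 := RInt_tail_r M d f u v Hf (conj (Rle_trans _ _ _ HB Hu) H)).
    apply (tail_coef_mono _ _ f); trivial.
  - rewrite RInt_swap by apply Hf. rewrite Rabs_Ropp.
    apply Rle_trans with (M / d * exp (- d * v)).
    + apply RInt_tail_r; trivial. lra.
    + apply (tail_coef_mono _ _ f); trivial.
Qed.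

Lemma RInt_tail_left M d f B u v : expdec M d f -> 0 <= B -> u <= - B -> v <= - B ->
  Rabs (RInt f u v) <= M / d * exp (- d * B).
Proof.
  intros Hf HB Hu Hv.
  generalize (RInt_opp_arg f (- u) (- v) (proj1 (proj2 Hf))). rewrite !Ropp_involutive.
  intros E. rewrite <- (Rabs_Ropp (RInt f u v)), <- E.
  apply RInt_tail_right; try lra. apply expdec_opp_arg; trivial.
Qed.

(** The two intervals differ by one piece in each tail, each contributing [M / d * exp (- d * B)].
    This gives both the Cauchy criterion for the improper integral and its truncation error. *)
Lemma RInt_tail_diff M d f B u v u' v' : expdec M d f -> 0 <= B ->
  u <= - B -> B <= v -> u' <= - B -> B <= v' ->
  Rabs (RInt f u v - RInt f u' v') <= 2 * M / d * exp (- d * B).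
Proof.
  intros Hf HB Hu Hv Hu' Hv'.
  assert (Hc := proj1 (proj2 Hf)).
  rewrite <- (RInt_split f u u' v), <- (RInt_split f u' v v') by trivial.
  replace (RInt f u u' + RInt f u' v - (RInt f u' v + RInt f v v'))
    with (RInt f u u' - RInt f v v') by ring.
  unfold Rminus. apply Rle_trans with (1 := Rabs_triang _ _). rewrite Rabs_Ropp.
  generalize (RInt_tail_left M d f B u u' Hf HB Hu Hu').
  generalize (RInt_tail_right M d f B v v' Hf HB Hv Hv').
  unfold Rdiv. lra.
Qed.

Lemma exp_decay_small K d e : 0 <= K -> 0 < d -> 0 < e ->
  exists B, 0 <= B /\ K * exp (- d * B) < e.
Proof.
  (* With this [B] the value is [K * exp (- (K / e))], and [exp y >= 1 + y] bounds it by
     [e * K / (e + K) < e]. *)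
  intros HK Hd He. exists (K / (e * d)).
  assert (0 < e * d) by nra.
  assert (0 <= K / (e * d)) by (apply Rmult_le_pos; [trivial|left; apply Rinv_0_lt_compat; trivial]).
  split; trivial.
  replace (- d * (K / (e * d))) with (- (K / e)) by (field; lra).
  rewrite exp_Ropp.
  assert (Hp := exp_ineq1_le (K / e)). assert (Hep := exp_pos (K / e)).
  apply Rmult_lt_reg_r with (exp (K / e)); trivial.
  replace (K * / exp (K / e) * exp (K / e)) with K by (field; lra).
  assert (e * (1 + K / e) = e + K) by (field; lra).
  nra.
Qed.

(** Identities between improper integrals are proved through this principle, with [a] the distance
    between the two sides and the bound its truncation error at [B]. *)
Lemma le_0_exp_decay a K d : 0 <= K -> 0 < d ->
  (forall B, 0 <= B -> a <= K * exp (- d * B)) -> a <= 0.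
Proof.
  intros HK Hd H. apply Rnot_lt_le. intros Ha.
  destruct (exp_decay_small K d a HK Hd Ha) as [B [HB HB']].
  specialize (H B HB). lra.
Qed.

Lemma prod_infty_ge B :
  filter_prod (Rbar_locally m_infty) (Rbar_locally p_infty)
    (fun ab => fst ab <= - B /\ B <= snd ab).
Proof.
  exists (fun x => x <= - B) (fun x => B <= x).
  - exists (- B). intros x Hx. lra.
  - exists B. intros x Hx. lra.
  - intros x y Hx Hy. split; trivial.
Qed.

Lemma expdec_ex_RInt_gen M d f : expdec M d f ->
  exists l, is_RInt_gen f (Rbar_locally m_infty) (Rbar_locally p_infty) l.
Proof.
  intros Hf.
  destruct (proj1 (filterlim_locally_cauchy (U := R_CompleteSpace)
     (F := filter_prod (Rbar_locally m_infty) (Rbar_locally p_infty))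
     (fun ab : R * R => RInt f (fst ab) (snd ab)))) as [l Hl].
  - intros e.
    assert (HM : 0 <= 2 * M / d).
    { generalize (tail_coef_pos M d f 0 Hf). rewrite Rmult_0_r, exp_0. unfold Rdiv. lra. }
    destruct (exp_decay_small (2 * M / d) d e HM (proj1 Hf) (cond_pos e)) as [B [HB HB']].
    exists (fun ab => fst ab <= - B /\ B <= snd ab). split.
    + apply prod_infty_ge.
    + intros u v [Hu1 Hu2] [Hv1 Hv2].
      apply Rle_lt_trans with (2 := HB').
      apply (RInt_tail_diff M d f B (fst v) (snd v) (fst u) (snd u)); trivial.
  - exists l. apply (filterlimi_lim_ext (fun ab : R * R => RInt f (fst ab) (snd ab))); trivial.
    intros x. apply (RInt_correct f). apply ex_RInt_cont. apply Hf.
Qed.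

Lemma Iline_unique f l :
  is_RInt_gen f (Rbar_locally m_infty) (Rbar_locally p_infty) l -> Iline f = l.
Proof. apply (is_RInt_gen_unique (V := R_CompleteNormedModule)). Qed.

Lemma Iline_correct M d f : expdec M d f ->
  is_RInt_gen f (Rbar_locally m_infty) (Rbar_locally p_infty) (Iline f).
Proof.
  intros Hf. destruct (expdec_ex_RInt_gen M d f Hf) as [l Hl].
  rewrite (Iline_unique f l Hl). trivial.
Qed.

Lemma Iline_approx M d f B u v : expdec M d f -> 0 <= B -> u <= - B -> B <= v ->
  Rabs (Iline f - RInt f u v) <= 2 * M / d * exp (- d * B).
Proof.
  intros Hf HB Hu Hv. apply Rnot_lt_le. intros H.
  (* If the bound failed by [e], a truncation beyond [B] that is within [e] of the limit would
     contradict [RInt_tail_diff]. *)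
  set (e := Rabs (Iline f - RInt f u v) - 2 * M / d * exp (- d * B)).
  assert (He : 0 < e) by (unfold e; lra).
  assert (L := proj1 (filterlimi_locally _ _) (Iline_correct M d f Hf) (mkposreal e He)).
  assert (L2 := filter_and _ _ L (prod_infty_ge B)).
  destruct (filter_ex _ L2) as [[u' v'] [[z [Hz1 Hz2]] [Hu' Hv']]]. simpl in *.
  apply (is_RInt_unique (V := R_CompleteNormedModule) f u' v' z) in Hz1. subst z.
  generalize (RInt_tail_diff M d f B u v u' v' Hf HB Hu Hv Hu' Hv').
  change (Rabs (RInt f u' v' - Iline f) < e) in Hz2.
  intros H1.
  assert (Rabs (Iline f - RInt f u v) <= Rabs (RInt f u' v' - Iline f) + Rabs (RInt f u v - RInt f u' v')).
  { rewrite <- (Rabs_Ropp (Iline f - _)).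
    replace (- (Iline f - RInt f u v)) with ((RInt f u' v' - Iline f) + (RInt f u v - RInt f u' v')) by ring.
    apply Rabs_triang. }
  unfold e in Hz2. lra.
Qed.

Lemma Iline_bound M d f : expdec M d f -> Rabs (Iline f) <= 2 * M / d.
Proof.
  intros Hf. generalize (Iline_approx M d f 0 0 0 Hf (Rle_refl _)).
  rewrite RInt_point. unfold zero; simpl. rewrite Rminus_0_r, Rmult_0_r, exp_0, Rmult_1_r.
  intros H; apply H; lra.
Qed.

Lemma Iline_bound_nonneg M d f : expdec M d f -> 0 <= 2 * M / d.
Proof. intros Hf. apply Rle_trans with (2 := Iline_bound _ _ _ Hf), Rabs_pos. Qed.

Lemma Iline_ext f g : (forall x, f x = g x) -> Iline f = Iline g.
Proof. intros H. f_equal. apply functional_extensionality, H. Qed.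

Lemma Iline_scal M d f k : expdec M d f -> Iline (fun x => k * f x) = k * Iline f.
Proof.
  intros Hf. apply Iline_unique. apply (is_RInt_gen_scal f k (Iline f)). apply (Iline_correct M d f Hf).
Qed.

Lemma Iline_plus M d M' d' f g : expdec M d f -> expdec M' d' g ->
  Iline (fun x => f x + g x) = Iline f + Iline g.
Proof.
  intros Hf Hg. apply Iline_unique. apply (is_RInt_gen_plus f g (Iline f) (Iline g)).
  apply (Iline_correct M d f Hf). apply (Iline_correct M' d' g Hg).
Qed.

Lemma Iline_minus M d M' d' f g : expdec M d f -> expdec M' d' g ->
  Iline (fun x => f x - g x) = Iline f - Iline g.
Proof.
  intros Hf Hg. apply Iline_unique. apply (is_RInt_gen_minus f g (Iline f) (Iline g)).
  apply (Iline_correct M d f Hf). apply (Iline_correct M' d' g Hg).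
Qed.

Lemma expdec_scal M d f k : expdec M d f -> expdec (Rabs k * M) d (fun x => k * f x).
Proof.
  intros [Hd [Hc Hb]]. split; [trivial|split].
  - intros x. apply (continuous_scal_r k f x). apply Hc.
  - intros x. rewrite Rabs_mult, Rmult_assoc. apply Rmult_le_compat_l; [apply Rabs_pos|apply Hb].
Qed.

Lemma expdec_weaken M d M' d' f : expdec M d f -> M <= M' -> 0 < d' <= d -> expdec M' d' f.
Proof.
  intros Hf HM [Hd' Hdd]. assert (HM0 := expdec_cst_nonneg _ _ _ Hf).
  destruct Hf as [Hd [Hc Hb]]. split; [trivial|split; trivial].
  intros x. apply Rle_trans with (1 := Hb x). assert (H := Rabs_pos x).
  apply Rmult_le_compat; trivial; [left; apply exp_pos|]. apply exp_le_exp. nra.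
Qed.

Lemma expdec_plus M d M' d' f g : expdec M d f -> expdec M' d' g ->
  expdec (M + M') (Rmin d d') (fun x => f x + g x).
Proof.
  intros Hf Hg.
  assert (Hm : 0 < Rmin d d') by (apply Rmin_glb_lt; [apply Hf|apply Hg]).
  destruct (expdec_weaken M d M _ f Hf (Rle_refl _) (conj Hm (Rmin_l _ _))) as [_ [Cf Bf]].
  destruct (expdec_weaken M' d' M' _ g Hg (Rle_refl _) (conj Hm (Rmin_r _ _))) as [_ [Cg Bg]].
  split; [trivial|split].
  - intros x. apply (continuous_plus f g x); trivial.
  - intros x. apply Rle_trans with (1 := Rabs_triang _ _).
    rewrite Rmult_plus_distr_r. apply Rplus_le_compat; trivial.
Qed.

Lemma Iline_le M d M' d' f g : expdec M d f -> expdec M' d' g ->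
  (forall x, f x <= g x) -> Iline f <= Iline g.
Proof.
  intros Hf Hg H. apply Rnot_lt_le. intros Hlt.
  set (e := Iline f - Iline g). assert (He : 0 < e / 2) by (unfold e; lra).
  destruct (exp_decay_small _ d _ (Iline_bound_nonneg _ _ _ Hf) (proj1 Hf) He) as [B1 [HB1 E1]].
  destruct (exp_decay_small _ d' _ (Iline_bound_nonneg _ _ _ Hg) (proj1 Hg) He) as [B2 [HB2 E2]].
  set (B := B1 + B2).
  assert (A1 := Iline_approx M d f B1 (- B) B Hf HB1 ltac:(unfold B; lra) ltac:(unfold B; lra)).
  assert (A2 := Iline_approx M' d' g B2 (- B) B Hg HB2 ltac:(unfold B; lra) ltac:(unfold B; lra)).
  assert (RInt f (- B) B <= RInt g (- B) B).
  { apply RInt_le; [unfold B; lra|apply ex_RInt_cont, Hf|apply ex_RInt_cont, Hg|].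
    intros; apply H. }
  apply Rabs_le_between in A1. apply Rabs_le_between in A2. unfold e in *. lra.
Qed.

Lemma Iline_abs_le M d M' d' f g : expdec M d f -> expdec M' d' g ->
  (forall x, Rabs (f x) <= g x) -> Rabs (Iline f) <= Iline g.
Proof.
  intros Hf Hg H. apply Rabs_le. split.
  - assert (E : Iline (fun x => (-1) * g x) = - Iline g) by (rewrite (Iline_scal _ _ _ _ Hg); ring).
    rewrite <- E. apply (Iline_le _ _ _ _ _ _ (expdec_scal _ _ _ (-1) Hg) Hf).
    intros x. specialize (H x). apply Rabs_le_between in H. lra.
  - apply (Iline_le _ _ _ _ _ _ Hf Hg).
    intros x. specialize (H x). apply Rabs_le_between in H. lra.
Qed.

Lemma Rabs_le_0 x : Rabs x <= 0 -> x = 0.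
Proof.
  intros H. destruct (Req_dec x 0) as [E|E]; trivial. apply Rabs_pos_lt in E. lra.
Qed.

(** The interval is only asked to contain [[-B, B]], so that a substitution may enlarge it by
    whatever margin its translation requires. *)
Lemma Iline_eq_lim M d f l K d' : expdec M d f -> 0 <= K -> 0 < d' ->
  (forall B, 0 <= B -> exists u v, u <= - B /\ B <= v /\
     Rabs (l - RInt f u v) <= K * exp (- d' * B)) -> Iline f = l.
Proof.
  intros Hf HK Hd' H.
  assert (Rabs (Iline f - l) <= 0).
  { set (dm := Rmin d d').
    assert (Hdm : 0 < dm /\ dm <= d /\ dm <= d').
    { unfold dm. split; [apply Rmin_glb_lt; [apply Hf|trivial]|].
      split; [apply Rmin_l|apply Rmin_r]. }
    assert (HM := Iline_bound_nonneg _ _ _ Hf).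
    apply (le_0_exp_decay _ (2 * M / d + K) dm); [lra|lra|].
    intros B HB. destruct (H B HB) as [u [v [Hu [Hv H1]]]].
    assert (H2 := Iline_approx M d f B u v Hf HB Hu Hv).
    replace (Iline f - l) with ((Iline f - RInt f u v) - (l - RInt f u v)) by ring.
    unfold Rminus at 1. apply Rle_trans with (1 := Rabs_triang _ _). rewrite Rabs_Ropp.
    assert (E1 : exp (- d * B) <= exp (- dm * B)) by (apply exp_le_exp; nra).
    assert (E2 : exp (- d' * B) <= exp (- dm * B)) by (apply exp_le_exp; nra).
    nra. }
  apply Rminus_diag_uniq, Rabs_le_0. trivial.
Qed.

Lemma exp_decay_affine d b c x : 0 < d ->
  exp (- d * Rabs (b * x + c)) <= exp (d * Rabs c) * exp (- (d * Rabs b) * Rabs x).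
Proof.
  intros Hd. rewrite <- exp_plus. apply exp_le_exp.
  assert (Rabs b * Rabs x <= Rabs (b * x + c) + Rabs c); [|nra].
  rewrite <- Rabs_mult. replace (b * x) with ((b * x + c) + - c) at 1 by ring.
  rewrite <- (Rabs_Ropp c). apply Rabs_triang.
Qed.

Lemma continuous_affine b c x : continuous (fun x => b * x + c) x.
Proof. der_cont. Qed.

Lemma expdec_affine M d f b c : b <> 0 -> expdec M d f ->
  expdec (M * exp (d * Rabs c)) (d * Rabs b) (fun x => f (b * x + c)).
Proof.
  intros Hb Hf. assert (HM0 := expdec_cst_nonneg _ _ _ Hf). destruct Hf as [Hd [Hc Hbd]].
  split; [apply Rmult_lt_0_compat; [trivial|apply Rabs_pos_lt; trivial]|split].
  - intros x. apply (continuous_comp (fun x => b * x + c) f); [apply continuous_affine|apply Hc].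
  - intros x. apply Rle_trans with (1 := Hbd _). rewrite Rmult_assoc.
    apply Rmult_le_compat_l; [trivial|apply exp_decay_affine; trivial].
Qed.

Lemma Iline_opp_arg M d f : expdec M d f -> Iline (fun x => f (- x)) = Iline f.
Proof.
  intros Hf. apply (Iline_eq_lim M d _ _ (2 * M / d) d).
  - apply expdec_opp_arg; trivial.
  - apply (Iline_bound_nonneg _ _ _ Hf).
  - apply Hf.
  - intros B HB. exists (- B), B. repeat split; try lra.
    rewrite RInt_opp_arg by apply Hf. rewrite Ropp_involutive.
    rewrite <- RInt_swap by apply Hf. apply Iline_approx; trivial; lra.
Qed.

Lemma Iline_affine M d f b c : 0 < b -> expdec M d f -> Iline (fun x => f (b * x + c)) = Iline f / b.
Proof.
  intros Hb Hf. assert (HM0 := Iline_bound_nonneg _ _ _ Hf).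
  assert (Hfa := expdec_affine M d f b c ltac:(lra) Hf).
  apply (Iline_eq_lim _ _ _ _ (2 * M / d / b) (d * b) Hfa).
  - apply Rmult_le_pos; [trivial|left; apply Rinv_0_lt_compat; trivial].
  - apply Rmult_lt_0_compat; [apply Hf|trivial].
  (* The margin [Rabs c / b] makes the image of the interval under [b x + c] contain
     [[- b B, b B]]. *)
  - intros B HB. exists (- B - Rabs c / b), (B + Rabs c / b).
    assert (0 <= Rabs c / b).
    { apply Rmult_le_pos; [apply Rabs_pos|left; apply Rinv_0_lt_compat; trivial]. }
    repeat split; try lra.
    generalize (RInt_affine f b c (- B - Rabs c / b) (B + Rabs c / b) (proj1 (proj2 Hf))).
    replace (b * (- B - Rabs c / b) + c) with (- (b * B) + (c - Rabs c)) by (field; lra).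
    replace (b * (B + Rabs c / b) + c) with (b * B + (c + Rabs c)) by (field; lra).
    intros E.
    assert (A := Iline_approx M d f (b * B) (- (b * B) + (c - Rabs c)) (b * B + (c + Rabs c)) Hf).
    assert (c <= Rabs c) by apply Rle_abs.
    assert (- c <= Rabs c) by (rewrite <- Rabs_Ropp; apply Rle_abs).
    specialize (A ltac:(nra) ltac:(lra) ltac:(lra)). rewrite <- E in A.
    replace (Iline f / b - RInt (fun x => f (b * x + c)) (- B - Rabs c / b) (B + Rabs c / b))
      with (/ b * (Iline f - b * RInt (fun x => f (b * x + c)) (- B - Rabs c / b) (B + Rabs c / b)))
      by (field; lra).
    rewrite Rabs_mult, (Rabs_pos_eq (/ b)) by (left; apply Rinv_0_lt_compat; trivial).
    apply Rmult_le_compat_l with (r := / b) in A; [|left; apply Rinv_0_lt_compat; trivial].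
    apply Rle_trans with (1 := A). right.
    replace (- d * (b * B)) with (- (d * b) * B) by ring. assert (0 < d) by apply Hf. field; lra.
Qed.

Lemma Iline_derive M d f F : expdec M d f -> (forall x, is_derive F x (f x)) ->
  forall la lb, filterlim F (Rbar_locally m_infty) (locally la) ->
  filterlim F (Rbar_locally p_infty) (locally lb) -> Iline f = lb - la.
Proof.
  intros Hf HF la lb Ha Hb. apply Iline_unique.
  replace f with (Derive F) by (extensionality y; apply is_derive_unique, HF).
  apply (is_RInt_gen_Derive F la lb); trivial.
  - apply filter_forall. intros ab x _. exists (f x). apply HF.
  - apply filter_forall. intros ab x _.
    replace (Derive F) with f by (extensionality y; symmetry; apply is_derive_unique, HF).
    apply Hf.
Qed.

(** Integration by parts enters in this form: the difference of the two integrands to be compared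
    has a decaying antiderivative. *)
Lemma Iline_derive_0 M d f F : expdec M d f -> (forall x, is_derive F x (f x)) ->
  (exists M' d', 0 < d' /\ forall x, Rabs (F x) <= M' * exp (- d' * Rabs x)) -> Iline f = 0.
Proof.
  intros Hf HF [M' [d' [Hd' Hb]]].
  assert (HM' : 0 <= M').
  { specialize (Hb 0). rewrite Rabs_R0, Rmult_0_r, exp_0 in Hb. assert (X := Rabs_pos (F 0)). lra. }
  apply (Iline_eq_lim M d f 0 (2 * M') d'); trivial; [lra|].
  intros B HB. exists (- B), B. repeat split; try lra.
  rewrite (is_RInt_unique f (- B) B (minus (F B) (F (- B)))).
  - unfold minus, plus, opp; simpl.
    replace (0 - (F B + - F (- B))) with (F (- B) + - F B) by ring.
    apply Rle_trans with (1 := Rabs_triang _ _). rewrite Rabs_Ropp.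
    assert (H1 := Hb B). assert (H2 := Hb (- B)).
    rewrite Rabs_Ropp in H2. rewrite (Rabs_pos_eq B HB) in *. lra.
  - apply (is_RInt_derive F); intros x _; [apply HF|apply Hf].
Qed.

(** * Integrals depending on a parameter and Fubini's theorem *)

Definition cont2 (h : R -> R -> R) := forall x y, continuity_2d_pt h x y.

Lemma cont2_1 h x : cont2 h -> forall y, continuous (h x) y.
Proof.
  intros H y. apply continuous_eps. intros e He.
  destruct (H x y (mkposreal e He)) as [dl Hdl].
  exists dl. split; [apply cond_pos|]. intros z Hz. apply Hdl; trivial.
  rewrite Rminus_diag, Rabs_R0. apply cond_pos.
Qed.

Lemma cont2_swap h : cont2 h -> cont2 (fun x y => h y x).
Proof.
  intros H x y e. destruct (H y x e) as [dl Hdl]. exists dl. intros u v Hu Hv. apply Hdl; trivial.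
Qed.

Lemma cont2_2 h y : cont2 h -> forall x, continuous (fun x => h x y) x.
Proof. intros H. apply (cont2_1 (fun x y => h y x)). apply cont2_swap; trivial. Qed.

Lemma RInt_abs_bound (f : R -> R) a b K : a <= b -> (forall x, continuous f x) ->
  (forall x, a <= x <= b -> Rabs (f x) <= K) -> Rabs (RInt f a b) <= (b - a) * K.
Proof.
  intros Hab Hc HK.
  apply (norm_RInt_le_const f a b (RInt f a b) K Hab HK).
  apply (RInt_correct f). apply ex_RInt_cont; trivial.
Qed.

Lemma RInt_sub (f g : R -> R) a b : (forall x, continuous f x) -> (forall x, continuous g x) ->
  RInt f a b - RInt g a b = RInt (fun x => f x - g x) a b.
Proof.
  intros Hf Hg. symmetry. apply (RInt_minus f g); apply ex_RInt_cont; trivial.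
Qed.

Lemma continuous_sub (f g : R -> R) : (forall x, continuous f x) -> (forall x, continuous g x) ->
  forall x, continuous (fun x => f x - g x) x.
Proof. intros Hf Hg x. apply (continuous_minus f g x); trivial. Qed.

Lemma RInt_param_continuous h a b : cont2 h ->
  forall x, continuous (fun x => RInt (h x) a b) x.
Proof.
  intros Hh.
  assert (K : forall a b, a <= b -> forall x, continuous (fun x => RInt (h x) a b) x).
  { clear a b; intros a b Hab x. apply continuous_eps. intros e He.
    (* The [+ 1] keeps the denominator positive when [a = b]; the factor 2 leaves room for a strict
       inequality. *)
    set (e' := e / (2 * (b - a + 1))).
    assert (He' : 0 < e') by (apply Rdiv_lt_0_compat; lra).
    destruct (uniform_continuity_2d h (x - 1) (x + 1) a b (fun u v _ _ => Hh u v) (mkposreal e' He'))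
      as [dl Hdl].
    exists (Rmin dl 1). split.
    { apply Rmin_glb_lt; [apply cond_pos|lra]. }
    intros y Hy.
    assert (Hy1 := Rlt_le_trans _ _ _ Hy (Rmin_l _ _)).
    assert (Hy2 := Rlt_le_trans _ _ _ Hy (Rmin_r _ _)).
    apply Rabs_lt_between in Hy2.
    rewrite RInt_sub by (intros; apply cont2_1; trivial).
    apply Rle_lt_trans with ((b - a) * e').
    - apply RInt_abs_bound; trivial.
      + apply continuous_sub; intros; apply cont2_1; trivial.
      + intros z Hz. left. apply Hdl; try lra. rewrite Rminus_diag, Rabs_R0. apply cond_pos.
    - apply Rle_lt_trans with ((b - a + 1) * e'); [nra|].
      replace ((b - a + 1) * e') with (e / 2) by (unfold e'; field; lra). lra. }
  destruct (Rle_dec a b) as [H|H]; [apply K; trivial|].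
  intros x.
  apply (continuous_ext (fun x => opp (RInt (h x) b a))).
  - intros y. symmetry. apply RInt_swap. apply cont2_1; trivial.
  - apply (continuous_opp (fun x => RInt (h x) b a)). apply K; lra.
Qed.

(** As functions of the upper limit of the [y]-integral, both sides have the derivative
    [RInt (fun x => h x Y) a b] and vanish at [Y = c]. *)
Lemma fubini_finite h a b c d : cont2 h ->
  RInt (fun x => RInt (h x) c d) a b = RInt (fun y => RInt (fun x => h x y) a b) c d.
Proof.
  intros Hh.
  assert (D : forall Y, is_derive (fun Y => RInt (fun x => RInt (h x) c Y) a b) Y
                          (RInt (fun x => h x Y) a b)).
  { intros Y.
    assert (DD : forall x Y, Derive (fun z => RInt (h x) c z) Y = h x Y).
    { intros x Z. apply Derive_RInt; [|apply cont2_1; trivial].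
      apply filter_forall. intros z. apply ex_RInt_cont. apply cont2_1; trivial. }
    replace (RInt (fun x => h x Y) a b)
      with (RInt (fun t => Derive (fun u => (fun Y x => RInt (h x) c Y) u t) Y) a b)
      by (apply RInt_ext; intros; apply DD).
    apply (is_derive_RInt_param (fun Y x => RInt (h x) c Y)).
    - apply filter_forall. intros z t _. exists (h t z).
      apply (is_derive_RInt (h t) _ c).
      + apply filter_forall. intros w. apply (RInt_correct (h t)). apply ex_RInt_cont. apply cont2_1; trivial.
      + apply cont2_1; trivial.
    - intros t _. replace (fun u v => Derive (fun z => RInt (h v) c z) u) with (fun u v => h v u).
      + apply cont2_swap; trivial.
      + extensionality u; extensionality v.
        symmetry; apply DD.
    - apply filter_forall. intros z. apply ex_RInt_cont. apply RInt_param_continuous; trivial. }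
  assert (E : is_RInt (fun y => RInt (fun x => h x y) a b) c d
     (minus (RInt (fun x => RInt (h x) c d) a b) (RInt (fun x => RInt (h x) c c) a b))).
  { apply (is_RInt_derive (fun Y => RInt (fun x => RInt (h x) c Y) a b)).
    - intros; apply D.
    - intros y _. apply (RInt_param_continuous (fun y x => h x y)). apply cont2_swap; trivial. }
  apply is_RInt_unique in E. rewrite E.
  replace (RInt (fun x => RInt (h x) c c) a b) with 0.
  - unfold minus, plus, opp; simpl. Rring.
  - symmetry. rewrite (RInt_ext _ (fun _ => 0)).
    + rewrite RInt_const. unfold scal; simpl; unfold mult; simpl. Rring.
    + intros x _. apply (RInt_point c (h x)).
Qed.

Lemma Iline_param_continuous M d h : cont2 h -> (forall x, expdec M d (h x)) ->
  forall x, continuous (fun x => Iline (h x)) x.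
Proof.
  intros Hh Hb x. apply continuous_eps. intros e He.
  assert (K := Iline_bound_nonneg _ _ _ (Hb 0)).
  destruct (exp_decay_small (2 * M / d) d (e / 3) K (proj1 (Hb 0)) ltac:(lra)) as [B [HB HB']].
  assert (C := RInt_param_continuous h (- B) B Hh x).
  destruct (proj1 (filterlim_locally _ _) C (mkposreal (e / 3) ltac:(lra))) as [dl Hdl].
  exists dl. split; [apply cond_pos|].
  intros y Hy. specialize (Hdl y Hy). change (Rabs (RInt (h y) (- B) B - RInt (h x) (- B) B) < e / 3) in Hdl.
  assert (A1 := Iline_approx M d (h y) B (- B) B (Hb y) HB (Rle_refl _) (Rle_refl _)).
  assert (A2 := Iline_approx M d (h x) B (- B) B (Hb x) HB (Rle_refl _) (Rle_refl _)).
  apply Rabs_lt_between in Hdl. apply Rabs_le_between in A1. apply Rabs_le_between in A2.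
  apply Rabs_lt_between. lra.
Qed.

Lemma expdec_Iline_param M d h : cont2 h ->
  (forall x y, Rabs (h x y) <= M * exp (- d * Rabs x) * exp (- d * Rabs y)) -> 0 < d ->
  expdec (2 * M / d) d (fun x => Iline (h x)).
Proof.
  intros Hh Hb Hd.
  assert (HM : 0 <= M).
  { specialize (Hb 0 0). rewrite !Rabs_R0, !Rmult_0_r, !exp_0 in Hb. assert (X := Rabs_pos (h 0 0)). lra. }
  assert (X : forall x, expdec (M * exp (- d * Rabs x)) d (h x)).
  { intros x. split; [trivial|split; [apply cont2_1; trivial|apply Hb]]. }
  split; [trivial|split].
  - apply (Iline_param_continuous M d); trivial. intros x.
    apply (expdec_weaken _ d _ d _ (X x)); [|lra]. assert (E := exp_decay_le_1 d x Hd). nra.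
  - intros x. apply Rle_trans with (1 := Iline_bound _ _ _ (X x)). right. field. lra.
Qed.

Lemma RInt_expdec_bound M d f B : expdec M d f -> 0 <= B -> Rabs (RInt f (- B) B) <= 2 * M / d.
Proof.
  intros Hf HB. rewrite <- (RInt_split f (- B) 0 B) by apply Hf.
  apply Rle_trans with (1 := Rabs_triang _ _).
  assert (T1 := RInt_tail_left _ _ _ 0 (- B) 0 Hf (Rle_refl _) ltac:(lra) ltac:(lra)).
  assert (T2 := RInt_tail_right _ _ _ 0 0 B Hf (Rle_refl _) ltac:(lra) ltac:(lra)).
  rewrite Rmult_0_r, exp_0, Rmult_1_r in *. unfold Rdiv in *. lra.
Qed.

(** Truncating the outer integral costs a tail, truncating the inner one costs the integral of its
    error; each amounts to [4 M / d^2 * exp (- d B)]. *)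
Lemma Iline_Iline_approx M d h B : cont2 h ->
  (forall x y, Rabs (h x y) <= M * exp (- d * Rabs x) * exp (- d * Rabs y)) -> 0 < d -> 0 <= B ->
  Rabs (Iline (fun x => Iline (h x)) - RInt (fun x => RInt (h x) (- B) B) (- B) B)
    <= 8 * M / (d * d) * exp (- d * B).
Proof.
  intros Hh Hb Hd HB.
  assert (X := expdec_Iline_param M d h Hh Hb Hd).
  assert (A1 := Iline_approx _ _ _ B (- B) B X HB (Rle_refl _) (Rle_refl _)).
  assert (Ci : forall x, continuous (fun x => RInt (h x) (- B) B) x) by (apply RInt_param_continuous; trivial).
  (* The inner truncation error inherits the decay in [x] from the product bound, so its integral
     over [[-B, B]] is bounded independently of the length of the interval. *)
  assert (V : expdec (2 * M / d * exp (- d * B)) d (fun x => Iline (h x) - RInt (h x) (- B) B)).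
  { split; [trivial|split].
    - apply continuous_sub; [apply X|trivial].
    - intros x.
      assert (Hx : expdec (M * exp (- d * Rabs x)) d (h x))
        by (split; [trivial|split; [apply cont2_1; trivial|apply Hb]]).
      apply Rle_trans with (1 := Iline_approx _ _ _ B (- B) B Hx HB (Rle_refl _) (Rle_refl _)).
      right. field. lra. }
  assert (A2 := RInt_expdec_bound _ _ _ B V HB).
  rewrite <- RInt_sub in A2 by (trivial; apply X).
  replace (8 * M / (d * d) * exp (- d * B))
    with (2 * (2 * M / d) / d * exp (- d * B) + 2 * (2 * M / d * exp (- d * B)) / d) by (field; lra).
  apply Rabs_le_between in A1. apply Rabs_le_between in A2. apply Rabs_le. lra.
Qed.

(** Both iterated integrals are within [O(exp (- d B))] of the same double integral over a square,
    for every [B]. *)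
Lemma fubini M d h : cont2 h ->
  (forall x y, Rabs (h x y) <= M * exp (- d * Rabs x) * exp (- d * Rabs y)) -> 0 < d ->
  Iline (fun x => Iline (h x)) = Iline (fun y => Iline (fun x => h x y)).
Proof.
  intros Hh Hb Hd.
  assert (Hb' : forall x y, Rabs (h y x) <= M * exp (- d * Rabs x) * exp (- d * Rabs y)).
  { intros x y. rewrite Rmult_assoc, (Rmult_comm (exp _)), <- Rmult_assoc. apply Hb. }
  assert (HM : 0 <= 8 * M / (d * d)).
  { assert (A := Iline_Iline_approx M d h 0 Hh Hb Hd (Rle_refl _)).
    rewrite Rmult_0_r, exp_0, Rmult_1_r in A. apply Rle_trans with (2 := A), Rabs_pos. }
  apply Rminus_diag_uniq.
  assert (Z : Rabs (Iline (fun x => Iline (h x)) - Iline (fun y => Iline (fun x => h x y))) <= 0).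
  { apply (le_0_exp_decay _ (2 * (8 * M / (d * d))) d); [lra|trivial|]. intros B HB.
    assert (A1 := Iline_Iline_approx M d h B Hh Hb Hd HB).
    assert (A2 := Iline_Iline_approx M d (fun y x => h x y) B (cont2_swap _ Hh) Hb' Hd HB).
    rewrite <- (fubini_finite h) in A2 by trivial.
    apply Rabs_le_between in A1. apply Rabs_le_between in A2. apply Rabs_le. lra. }
  apply Rabs_le_0; trivial.
Qed.

(** * Termwise integration of series *)

Lemma expdec_sum_n (f : nat -> R -> R) M d n : (forall k, expdec (M k) d (f k)) ->
  expdec (sum_n M n) d (fun x => sum_n (fun k => f k x) n) /\
  Iline (fun x => sum_n (fun k => f k x) n) = sum_n (fun k => Iline (f k)) n.
Proof.
  intros Hf. induction n as [|n [IH1 IH2]].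
  - rewrite !sum_O. split.
    + replace (fun x => sum_n (fun k => f k x) 0) with (f 0%nat); [apply Hf|].
      extensionality x; rewrite sum_O; reflexivity.
    + apply Iline_ext. intros x. apply sum_O.
  - rewrite !sum_Sn.
    replace (fun x => sum_n (fun k => f k x) (S n)) with (fun x => sum_n (fun k => f k x) n + f (S n) x)
      by (extensionality x; rewrite sum_Sn; reflexivity).
    split.
    + rewrite <- (Rmin_left d d) by lra. apply expdec_plus; trivial.
    + rewrite (Iline_plus _ _ _ _ _ _ IH1 (Hf (S n))), IH2. reflexivity.
Qed.

Lemma is_lim_seq_sum_n (a : nat -> R) l : is_series a l -> is_lim_seq (sum_n a) l.
Proof. intros H; apply H. Qed.

Lemma series_tail_bound (a M : nat -> R) l K n : (forall k, Rabs (a k) <= M k * K) ->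
  ex_series M -> 0 <= K -> is_series a l -> Rabs (l - sum_n a n) <= (Series M - sum_n M n) * K.
Proof.
  intros Hb HM HK Ha.
  assert (S : forall m, (n <= m)%nat -> Rabs (sum_n a m - sum_n a n) <= (sum_n M m - sum_n M n) * K).
  { intros m Hm. induction Hm as [|m Hm IH].
    - rewrite !Rminus_diag, Rabs_R0, Rmult_0_l. lra.
    - rewrite !sum_Sn. unfold plus; simpl.
      replace (sum_n a m + a (S m) - sum_n a n) with ((sum_n a m - sum_n a n) + a (S m)) by ring.
      apply Rle_trans with (1 := Rabs_triang _ _). specialize (Hb (S m)). lra. }
  refine (is_lim_seq_le_loc (fun m => Rabs (sum_n a m - sum_n a n))
    (fun m => (sum_n M m - sum_n M n) * K) (Finite (Rabs (l - sum_n a n))) (Finite ((Series M - sum_n M n) * K)) _ _ _).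
  - exists n. intros m Hm. apply S, Hm.
  - apply (is_lim_seq_abs _ (l - sum_n a n)).
    apply is_lim_seq_minus'; [apply is_lim_seq_sum_n; trivial|apply is_lim_seq_const].
  - apply (is_lim_seq_mult' _ (fun _ => K)); [|apply is_lim_seq_const].
    apply is_lim_seq_minus'; [|apply is_lim_seq_const].
    apply is_lim_seq_sum_n, Series_correct, HM.
Qed.

(** The remainder after [n] terms decays at rate [d] with constant [Series M - sum_n M n], which
    tends to 0. This gives continuity of the sum, as a uniform limit, and convergence of the
    integrals, through [Iline_bound]. *)
Lemma Iline_series (f : nat -> R -> R) (M : nat -> R) d g : 0 < d ->
  (forall k, expdec (M k) d (f k)) -> ex_series M ->
  (forall x, is_series (fun k => f k x) (g x)) ->
  expdec (Series M) d g /\ is_series (fun k => Iline (f k)) (Iline g).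
Proof.
  intros Hd Hf HM Hg.
  assert (T : forall n x, Rabs (g x - sum_n (fun k => f k x) n)
                 <= (Series M - sum_n M n) * exp (- d * Rabs x)).
  { intros n x. apply series_tail_bound; trivial; [|left; apply exp_pos].
    intros k. apply Hf. }
  assert (L0 : is_lim_seq (fun n => Series M - sum_n M n) 0).
  { replace 0 with (Series M - Series M) by ring.
    apply is_lim_seq_minus'; [apply is_lim_seq_const|].
    apply is_lim_seq_sum_n, Series_correct, HM. }
  assert (Hle1 := fun x => exp_decay_le_1 d x Hd).
  assert (Hpos : forall n, 0 <= Series M - sum_n M n).
  { intros n. specialize (T n 0). rewrite Rabs_R0, Rmult_0_r, exp_0, Rmult_1_r in T.
    apply Rle_trans with (2 := T), Rabs_pos. }
  assert (Cg : forall x, continuous g x).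
  { intros x. apply continuous_eps. intros e He.
    apply is_lim_seq_spec in L0. destruct (L0 (mkposreal (e / 3) ltac:(lra))) as [n Hn].
    specialize (Hn n (Nat.le_refl n)). simpl in Hn. rewrite Rminus_0_r in Hn.
    rewrite Rabs_pos_eq in Hn by trivial.
    destruct (expdec_sum_n f M d n Hf) as [[_ [C _]] _].
    destruct (proj1 (filterlim_locally _ _) (C x) (mkposreal (e / 3) ltac:(lra))) as [dl Hdl].
    exists dl. split; [apply cond_pos|]. intros y Hy.
    specialize (Hdl y Hy).
    change (Rabs (sum_n (fun k => f k y) n - sum_n (fun k => f k x) n) < e / 3) in Hdl.
    assert (T1 := T n x). assert (T2 := T n y).
    assert (T1' : Rabs (g x - sum_n (fun k => f k x) n) < e / 3)
      by (specialize (Hle1 x); specialize (Hpos n); nra).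
    assert (T2' : Rabs (g y - sum_n (fun k => f k y) n) < e / 3)
      by (specialize (Hle1 y); specialize (Hpos n); nra).
    apply Rabs_lt_between in Hdl. apply Rabs_lt_between in T1'. apply Rabs_lt_between in T2'.
    apply Rabs_lt_between. lra. }
  assert (R : forall n, expdec (Series M - sum_n M n) d (fun x => g x - sum_n (fun k => f k x) n)).
  { intros n. split; [trivial|split; [|apply T]].
    apply continuous_sub; trivial. apply (expdec_sum_n f M d n Hf). }
  assert (Eg : expdec (Series M) d g).
  { replace g with (fun x => (g x - sum_n (fun k => f k x) 0) + sum_n (fun k => f k x) 0)
      by (extensionality y; ring).
    replace (Series M) with ((Series M - sum_n M 0) + sum_n M 0) by ring.
    rewrite <- (Rmin_left d d) by lra. apply expdec_plus; [apply R|apply (expdec_sum_n f M d 0 Hf)]. }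
  split; trivial.
  apply (is_lim_seq_spec (sum_n (fun k => Iline (f k))) (Iline g)).
  intros e.
  apply is_lim_seq_spec in L0.
  destruct (L0 (mkposreal (e * d / 2) ltac:(assert (0 < e) by apply cond_pos; nra))) as [N HN].
  exists N. intros n Hn. specialize (HN n Hn). simpl in HN.
  rewrite Rminus_0_r, Rabs_pos_eq in HN by trivial.
  destruct (expdec_sum_n f M d n Hf) as [S1 S2]. rewrite <- S2.
  rewrite <- Rabs_Ropp, Ropp_minus_distr, <- (Iline_minus _ _ _ _ _ _ Eg S1).
  apply Rle_lt_trans with (1 := Iline_bound _ _ _ (R n)).
  apply Rmult_lt_reg_r with d; trivial.
  replace (2 * (Series M - sum_n M n) / d * d) with (2 * (Series M - sum_n M n)) by (field; lra).
  lra.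
Qed.

(** * Complex-valued functions of real variables *)

Definition cexp (z : C) : C := (exp (Re z) * cos (Im z), exp (Re z) * sin (Im z)).

Lemma C_ext (a b : C) : Re a = Re b -> Im a = Im b -> a = b.
Proof. destruct a, b; simpl; intros; subst; trivial. Qed.

Lemma cexp_plus a b : cexp (a + b)%C = (cexp a * cexp b)%C.
Proof.
  apply C_ext; unfold cexp; simpl; unfold Re, Im; simpl;
    rewrite exp_plus, ?cos_plus, ?sin_plus; ring.
Qed.

Lemma cexp_RtoC x : cexp (RtoC x) = RtoC (exp x).
Proof. apply C_ext; unfold cexp; simpl; [rewrite cos_0|rewrite sin_0]; ring. Qed.

Lemma cexp_0 : cexp 0 = 1%C.
Proof. rewrite (cexp_RtoC 0), exp_0. reflexivity. Qed.

Lemma Cmod_cexp z : Cmod (cexp z) = exp (Re z).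
Proof.
  unfold Cmod, cexp; simpl.
  replace (exp (Re z) * cos (Im z) * (exp (Re z) * cos (Im z) * 1) +
           exp (Re z) * sin (Im z) * (exp (Re z) * sin (Im z) * 1))
    with ((exp (Re z))² * ((sin (Im z))² + (cos (Im z))²)) by (unfold Rsqr; ring).
  rewrite sin2_cos2, Rmult_1_r. apply sqrt_Rsqr. left; apply exp_pos.
Qed.

Lemma cexp_neq_0 z : cexp z <> 0.
Proof.
  apply Cmod_gt_0. rewrite Cmod_cexp. apply exp_pos.
Qed.

Lemma cexp_opp z : cexp (- z)%C = (/ cexp z)%C.
Proof.
  assert (H := cexp_plus z (- z)%C). rewrite Cplus_opp_r, cexp_0 in H.
  rewrite <- (Cmult_1_r (/ cexp z)%C), H. field. apply cexp_neq_0.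
Qed.

Lemma cexp_minus a b : cexp (a - b)%C = (cexp a / cexp b)%C.
Proof. unfold Cminus. rewrite cexp_plus, cexp_opp. reflexivity. Qed.

Lemma Re_le_Cmod z : Rabs (Re z) <= Cmod z.
Proof. apply Rle_trans with (2 := Rmax_Cmod z). apply Rmax_l. Qed.

Lemma Im_le_Cmod z : Rabs (Im z) <= Cmod z.
Proof. apply Rle_trans with (2 := Rmax_Cmod z). apply Rmax_r. Qed.

Lemma Cmod_le_sum z : Cmod z <= Rabs (Re z) + Rabs (Im z).
Proof.
  replace z with (RtoC (Re z) + Ci * RtoC (Im z))%C at 1 by (apply C_ext; simpl; ring).
  apply Rle_trans with (1 := Cmod_triangle _ _).
  rewrite Cmod_mult, !Cmod_R.
  replace (Cmod Ci) with 1; [lra|].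
  unfold Cmod; simpl. replace (_ + _) with 1 by ring. rewrite sqrt_1; trivial.
Qed.

(** Continuity by components hands over directly to the real lemmas; the general domain [U] lets one
    set of rules serve functions on [R] and on [R * R]. *)
Definition Ccont {U : UniformSpace} (f : U -> C) (x : U) :=
  continuous (fun u => Re (f u)) x /\ continuous (fun u => Im (f u)) x.

Lemma continuous_Rplus {U : UniformSpace} (f g : U -> R) x : continuous f x -> continuous g x ->
  continuous (fun y => f y + g y) x.
Proof. apply (continuous_plus f g x). Qed.

Lemma continuous_Rminus {U : UniformSpace} (f g : U -> R) x : continuous f x -> continuous g x ->
  continuous (fun y => f y - g y) x.
Proof. apply (continuous_minus f g x). Qed.

Lemma continuous_Rmult {U : UniformSpace} (f g : U -> R) x : continuous f x -> continuous g x ->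
  continuous (fun y => f y * g y) x.
Proof. apply (continuous_mult f g x). Qed.

Lemma continuous_Rexp {U : UniformSpace} (f : U -> R) x : continuous f x -> continuous (fun y => exp (f y)) x.
Proof. intros H. apply (continuous_comp f exp); [trivial|apply continuous_exp]. Qed.

Lemma Ccont_const {U : UniformSpace} c x : Ccont (fun _ : U => c) x.
Proof. split; apply continuous_const. Qed.

Lemma Ccont_RtoC {U : UniformSpace} (f : U -> R) x : continuous f x -> Ccont (fun y => RtoC (f y)) x.
Proof. split; [apply H|apply continuous_const]. Qed.

Lemma Ccont_plus {U : UniformSpace} (f g : U -> C) x : Ccont f x -> Ccont g x -> Ccont (fun y => f y + g y)%C x.
Proof. intros [H1 H2] [H3 H4]; split; apply continuous_Rplus; trivial. Qed.

Lemma Ccont_opp {U : UniformSpace} (f : U -> C) x : Ccont f x -> Ccont (fun y => - f y)%C x.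
Proof. intros [H1 H2]; split; [apply (continuous_opp _ _ H1)|apply (continuous_opp _ _ H2)]. Qed.

Lemma Ccont_minus {U : UniformSpace} (f g : U -> C) x : Ccont f x -> Ccont g x -> Ccont (fun y => f y - g y)%C x.
Proof. intros H1 H2. apply Ccont_plus; [trivial|apply Ccont_opp; trivial]. Qed.

Lemma Ccont_mult {U : UniformSpace} (f g : U -> C) x : Ccont f x -> Ccont g x -> Ccont (fun y => f y * g y)%C x.
Proof.
  intros [H1 H2] [H3 H4]; split.
  - apply continuous_Rminus; apply continuous_Rmult; trivial.
  - apply continuous_Rplus; apply continuous_Rmult; trivial.
Qed.

Lemma continuous_Rinv_fun {U : UniformSpace} (f : U -> R) x : continuous f x -> f x <> 0 -> continuous (fun y => / f y) x.
Proof. intros H H0. apply (continuous_comp f Rinv); [trivial|apply continuous_Rinv; trivial]. Qed.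

Lemma Ccont_inv {U : UniformSpace} (f : U -> C) x : Ccont f x -> f x <> 0 -> Ccont (fun y => / f y)%C x.
Proof.
  intros [H1 H2] H0.
  assert (N : Re (f x) ^ 2 + Im (f x) ^ 2 <> 0).
  { intros E. apply H0. apply C_ext; simpl; nra. }
  assert (P : continuous (fun y => / (Re (f y) ^ 2 + Im (f y) ^ 2)) x).
  { apply continuous_Rinv_fun; trivial.
    apply (continuous_Rplus (fun y => Re (f y) * (Re (f y) * 1)) (fun y => Im (f y) * (Im (f y) * 1))).
    - apply (continuous_Rmult (fun y => Re (f y)) (fun y => Re (f y) * 1)); trivial.
      apply (continuous_Rmult (fun y => Re (f y)) (fun y => 1)); trivial. apply continuous_const.
    - apply (continuous_Rmult (fun y => Im (f y)) (fun y => Im (f y) * 1)); trivial.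
      apply (continuous_Rmult (fun y => Im (f y)) (fun y => 1)); trivial. apply continuous_const. }
  split.
  - apply (continuous_Rmult (fun y => Re (f y))); trivial.
  - apply (continuous_Rmult (fun y => - Im (f y))); trivial. apply (continuous_opp _ _ H2).
Qed.

Lemma Ccont_div {U : UniformSpace} (f g : U -> C) x : Ccont f x -> Ccont g x -> g x <> 0 -> Ccont (fun y => f y / g y)%C x.
Proof. intros H1 H2 H3. apply Ccont_mult; [trivial|apply Ccont_inv; trivial]. Qed.

Lemma Ccont_cexp {U : UniformSpace} (f : U -> C) x : Ccont f x -> Ccont (fun y => cexp (f y)) x.
Proof.
  intros [H1 H2]; split; apply continuous_Rmult.
  - apply continuous_Rexp; trivial.
  - apply (continuous_comp (fun y => Im (f y)) cos); [trivial|apply continuous_cos].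
  - apply continuous_Rexp; trivial.
  - apply (continuous_comp (fun y => Im (f y)) sin); [trivial|apply continuous_sin].
Qed.
Lemma Ccont2_fst (p : R * R) : continuous (fun p : R * R => fst p) p.
Proof. apply (continuous_fst (U := R_UniformSpace) (V := R_UniformSpace)). Qed.

Lemma Ccont2_snd (p : R * R) : continuous (fun p : R * R => snd p) p.
Proof. apply (continuous_snd (U := R_UniformSpace) (V := R_UniformSpace)). Qed.

Ltac Rcont_auto :=
  try assumption;
  lazymatch goal with
  | |- continuous (fun p => fst p) _ => apply Ccont2_fst
  | |- continuous (fun p => snd p) _ => apply Ccont2_snd
  | |- continuous (fun _ => ?c) _ => apply continuous_const
  | |- continuous (fun x => x) _ => apply continuous_id
  | |- continuous (fun x => - x) _ => apply (continuous_opp (fun x : R => x)), continuous_id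
  | |- continuous (fun x => exp (@?f x)) _ => apply (continuous_Rexp f); Rcont_auto
  | |- continuous (fun x => Rplus (@?f x) (@?g x)) _ => apply (continuous_Rplus f g); Rcont_auto
  | |- continuous (fun x => Rminus (@?f x) (@?g x)) _ => apply (continuous_Rminus f g); Rcont_auto
  | |- continuous (fun x => Rmult (@?f x) (@?g x)) _ => apply (continuous_Rmult f g); Rcont_auto
  | _ => idtac
  end.

Ltac Ccont_auto :=
  try assumption;
  lazymatch goal with
  | |- Ccont (fun _ => ?c) _ => apply Ccont_const
  | |- Ccont (fun x => RtoC (@?f x)) _ => apply (Ccont_RtoC f); Rcont_auto
  | |- Ccont (fun x => Cplus (@?f x) (@?g x)) _ => apply (Ccont_plus f g); Ccont_auto
  | |- Ccont (fun x => Cminus (@?f x) (@?g x)) _ => apply (Ccont_minus f g); Ccont_auto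
  | |- Ccont (fun x => Cmult (@?f x) (@?g x)) _ => apply (Ccont_mult f g); Ccont_auto
  | |- Ccont (fun x => Cdiv (@?f x) (@?g x)) _ => apply (Ccont_div f g); Ccont_auto
  | |- Ccont (fun x => Copp (@?f x)) _ => apply (Ccont_opp f); Ccont_auto
  | |- Ccont (fun x => cexp (@?f x)) _ => apply (Ccont_cexp f); Ccont_auto
  | _ => idtac
  end.

Definition is_Cder (f : R -> C) (x : R) (l : C) :=
  is_derive (fun u => Re (f u)) x (Re l) /\ is_derive (fun u => Im (f u)) x (Im l).

Lemma is_Cder_eq f x l l' : is_Cder f x l -> l = l' -> is_Cder f x l'.
Proof. intros; subst; trivial. Qed.

Lemma is_Cder_Ccont f x l : is_Cder f x l -> Ccont f x.
Proof. intros [H1 H2]; split; [apply (ex_derive_continuous (fun u => Re (f u))); exists (Re l)|apply (ex_derive_continuous (fun u => Im (f u))); exists (Im l)]; trivial. Qed.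

Lemma is_Cder_const c x : is_Cder (fun _ => c) x 0%C.
Proof. split; apply (is_derive_const (V := R_NormedModule)). Qed.

Lemma is_Cder_plus f g x l m : is_Cder f x l -> is_Cder g x m ->
  is_Cder (fun u => f u + g u)%C x (l + m)%C.
Proof. intros [H1 H2] [H3 H4]; split; apply (is_derive_plus (V := R_NormedModule)); trivial. Qed.

Lemma is_derive_Rmult (f g : R -> R) x l m : is_derive f x l -> is_derive g x m ->
  is_derive (fun u => f u * g u) x (l * g x + f x * m).
Proof. intros H1 H2. apply (is_derive_mult f g x l m H1 H2). intros; apply Rmult_comm. Qed.

Lemma is_derive_Rplus (f g : R -> R) x l m : is_derive f x l -> is_derive g x m ->
  is_derive (fun u => f u + g u) x (l + m).
Proof. apply (is_derive_plus f g). Qed.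

Lemma is_derive_Rminus (f g : R -> R) x l m : is_derive f x l -> is_derive g x m ->
  is_derive (fun u => f u - g u) x (l - m).
Proof. apply (is_derive_minus f g). Qed.

Lemma is_derive_eq (f : R -> R) x l l' : is_derive f x l -> l = l' -> is_derive f x l'.
Proof. intros; subst; trivial. Qed.

Lemma is_Cder_mult f g x l m : is_Cder f x l -> is_Cder g x m ->
  is_Cder (fun u => f u * g u)%C x (l * g x + f x * m)%C.
Proof.
  intros [H1 H2] [H3 H4]; split.
  - apply (is_derive_eq (fun u => Re (f u) * Re (g u) - Im (f u) * Im (g u))) with
      ((Re l * Re (g x) + Re (f x) * Re m) - (Im l * Im (g x) + Im (f x) * Im m)).
    + apply is_derive_Rminus; apply is_derive_Rmult; trivial.
    + simpl; unfold Re, Im; ring.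
  - apply (is_derive_eq (fun u => Re (f u) * Im (g u) + Im (f u) * Re (g u))) with
      ((Re l * Im (g x) + Re (f x) * Im m) + (Im l * Re (g x) + Im (f x) * Re m)).
    + apply is_derive_Rplus; apply is_derive_Rmult; trivial.
    + simpl; unfold Re, Im; ring.
Qed.

Lemma is_Cder_inv f x l : is_Cder f x l -> f x <> 0 ->
  is_Cder (fun u => / f u)%C x (- l / (f x * f x))%C.
Proof.
  intros [H1 H2] H0. set (a := fun u => Re (f u)) in *. set (b := fun u => Im (f u)) in *.
  assert (N : a x ^ 2 + b x ^ 2 <> 0).
  { intros E. apply H0. apply C_ext; simpl; unfold a, b in E; nra. }
  assert (N2 : (a x * a x - b x * b x) * ((a x * a x - b x * b x) * 1)
    + (a x * b x + b x * a x) * ((a x * b x + b x * a x) * 1) <> 0).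
  { replace (_ + _) with ((a x ^ 2 + b x ^ 2) ^ 2) by ring. apply pow_nonzero; trivial. }
  assert (Ea : Derive a x = Re l) by (apply is_derive_unique; exact H1).
  assert (Eb : Derive b x = Im l) by (apply is_derive_unique; exact H2).
  assert (Xa : ex_derive a x) by (eexists; exact H1). assert (Xb : ex_derive b x) by (eexists; exact H2).
  split.
  - apply (is_derive_ext (fun u => a u / (a u ^ 2 + b u ^ 2))); [reflexivity|].
    auto_derive; [repeat split; trivial|]. change (fun x => a x) with a. change (fun x => b x) with b. rewrite Ea, Eb. simpl.
    unfold a, b, Re, Im in *. field. split; [intros E; apply N; nra|lra].
  - apply (is_derive_ext (fun u => - b u / (a u ^ 2 + b u ^ 2))); [reflexivity|].
    auto_derive; [repeat split; trivial|]. change (fun x => a x) with a. change (fun x => b x) with b. rewrite Ea, Eb. simpl.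
    unfold a, b, Re, Im in *. field. split; [intros E; apply N; nra|lra].
Qed.

Lemma is_Cder_cexp f x l : is_Cder f x l -> is_Cder (fun u => cexp (f u)) x (l * cexp (f x))%C.
Proof.
  intros [H1 H2].
  assert (E : is_derive (fun u => exp (Re (f u))) x (Re l * exp (Re (f x)))).
  { apply (is_derive_comp exp (fun u => Re (f u))); trivial. apply is_derive_exp. }
  assert (Cc : is_derive (fun u => cos (Im (f u))) x (Im l * - sin (Im (f x)))).
  { apply (is_derive_comp cos (fun u => Im (f u))); trivial. apply is_derive_cos. }
  assert (Ss : is_derive (fun u => sin (Im (f u))) x (Im l * cos (Im (f x)))).
  { apply (is_derive_comp sin (fun u => Im (f u))); trivial. apply is_derive_sin. }
  split.
  - apply (is_derive_eq _ _ _ _ (is_derive_Rmult _ _ _ _ _ E Cc)). simpl; unfold Re, Im; simpl; ring.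
  - apply (is_derive_eq _ _ _ _ (is_derive_Rmult _ _ _ _ _ E Ss)). simpl; unfold Re, Im; simpl; ring.
Qed.

(** * Integrals of complex-valued functions over R and over the half line *)

Definition Cexpdec (M d : R) (f : R -> C) : Prop :=
  0 < d /\ (forall x, Ccont f x) /\ forall x, Cmod (f x) <= M * exp (- d * Rabs x).

Definition CIline (f : R -> C) : C :=
  (Iline (fun x => Re (f x)), Iline (fun x => Im (f x))).

Lemma Cexpdec_Re M d f : Cexpdec M d f -> expdec M d (fun x => Re (f x)).
Proof.
  intros [Hd [Hc Hb]]. split; [trivial|split].
  - intros x; destruct (Hc x) as [Hr Hi]; exact Hr.
  - intros x. apply Rle_trans with (2 := Hb x). apply Re_le_Cmod.
Qed.

Lemma Cexpdec_Im M d f : Cexpdec M d f -> expdec M d (fun x => Im (f x)).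
Proof.
  intros [Hd [Hc Hb]]. split; [trivial|split].
  - intros x; destruct (Hc x) as [Hr Hi]; exact Hi.
  - intros x. apply Rle_trans with (2 := Hb x). apply Im_le_Cmod.
Qed.

Lemma Cexpdec_cst_nonneg M d f : Cexpdec M d f -> 0 <= M.
Proof. intros H. apply (expdec_cst_nonneg _ _ _ (Cexpdec_Re _ _ _ H)). Qed.

Lemma is_RInt_gen_pair (f : R -> C) (Fa Fb : (R -> Prop) -> Prop) {FFa : Filter Fa} {FFb : Filter Fb}
  (l1 l2 : R) :
  is_RInt_gen (fun x => Re (f x)) Fa Fb l1 -> is_RInt_gen (fun x => Im (f x)) Fa Fb l2 ->
  is_RInt_gen (V := C_R_NormedModule) f Fa Fb (l1, l2).
Proof.
  intros H1 H2. apply filterlimi_locally. intros e.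
  assert (K1 := proj1 (filterlimi_locally _ _) H1 e).
  assert (K2 := proj1 (filterlimi_locally _ _) H2 e).
  generalize (filter_and _ _ K1 K2). apply filter_imp.
  intros ab [[z1 [I1 B1]] [z2 [I2 B2]]]. exists (z1, z2). split.
  - apply (is_RInt_fct_extend_pair (U := R_NormedModule) (V := R_NormedModule) f); trivial.
  - split; trivial.
Qed.

Lemma Cint_line_CIline M d f : Cexpdec M d f -> Cint_line f = CIline f.
Proof.
  intros Hf.
  apply (@is_RInt_gen_unique C_R_CompleteNormedModule (Rbar_locally m_infty) (Rbar_locally p_infty) _ _ f (CIline f)).
  apply (is_RInt_gen_pair f _ _).
  - apply (Iline_correct M d _ (Cexpdec_Re _ _ _ Hf)).
  - apply (Iline_correct M d _ (Cexpdec_Im _ _ _ Hf)).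
Qed.

(** Under [exp] the filters at minus infinity and at [0+] correspond, so every truncation of one
    integral is exactly a truncation of the other, and the limit carries over without any
    estimate. *)
Lemma is_RInt_gen_exp (f : R -> R) l : (forall t, 0 < t -> continuous f t) ->
  is_RInt_gen (fun xi => exp xi * f (exp xi)) (Rbar_locally m_infty) (Rbar_locally p_infty) l ->
  is_RInt_gen f (at_right 0) (Rbar_locally p_infty) l.
Proof.
  intros Hc H. apply filterlimi_locally. intros e.
  assert (K := proj1 (filterlimi_locally _ _) H e).
  destruct K as [P Q [A HA] [B HB] HPQ].
  exists (fun a => 0 < a < exp A) (fun b => exp B < b).
  - exists (mkposreal (exp A) (exp_pos A)). intros y By Hy. split; trivial.
    unfold ball in By; simpl in By; unfold AbsRing_ball, abs, minus, plus, opp in By; simpl in By.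
    apply Rabs_lt_between in By. lra.
  - exists (exp B). trivial.
  - intros a b [Ha0 Ha] Hb. simpl.
    assert (Hb0 : 0 < b) by (apply Rlt_trans with (2 := Hb); apply exp_pos).
    destruct (HPQ (ln a) (ln b)) as [z [I Bz]].
    + apply HA. apply exp_lt_inv. rewrite exp_ln; trivial.
    + apply HB. apply exp_lt_inv. rewrite exp_ln; trivial.
    + exists z. split; trivial. simpl in I.
      assert (I2 : is_RInt (fun y => scal (exp y) (f (exp y))) (ln a) (ln b) (RInt f (exp (ln a)) (exp (ln b)))).
      { apply (is_RInt_comp (V := R_CompleteNormedModule) f exp exp).
        - intros x _. apply Hc, exp_pos.
        - intros x _. split; [apply is_derive_exp|apply continuous_exp]. }
      rewrite !exp_ln in I2 by trivial.
      assert (E : z = RInt f a b).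
      { transitivity (RInt (fun y => scal (exp y) (f (exp y))) (ln a) (ln b)).
        - symmetry. apply (is_RInt_unique (V := R_CompleteNormedModule)). exact I.
        - apply (is_RInt_unique (V := R_CompleteNormedModule)). exact I2. }
      rewrite E. apply (RInt_correct f). apply (ex_RInt_continuous (V := R_CompleteNormedModule)).
      intros t Ht. apply Hc. apply Rlt_le_trans with (2 := proj1 Ht). apply Rmin_glb_lt; trivial.
Qed.

Lemma int0inf_Iline M d (f g : R -> R) : (forall t, 0 < t -> continuous f t) ->
  (forall xi, exp xi * f (exp xi) = g xi) -> expdec M d g -> int0inf f = Iline g.
Proof.
  intros Hc E Hg.
  apply (@is_RInt_gen_unique R_CompleteNormedModule (at_right 0) (Rbar_locally p_infty) _ _ f (Iline g)).
  apply is_RInt_gen_exp; trivial.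
  replace (fun xi => exp xi * f (exp xi)) with g
    by (extensionality y; symmetry; apply E).
  apply (Iline_correct M d); trivial.
Qed.

Lemma Cint0inf_CIline M d (f g : R -> C) : (forall t, 0 < t -> Ccont f t) ->
  (forall xi, (RtoC (exp xi) * f (exp xi))%C = g xi) -> Cexpdec M d g -> Cint0inf f = CIline g.
Proof.
  intros Hc E Hg.
  apply (@is_RInt_gen_unique C_R_CompleteNormedModule (at_right 0) (Rbar_locally p_infty) _ _ f (CIline g)).
  apply (is_RInt_gen_pair f _ _).
  - apply is_RInt_gen_exp; [intros t Ht; apply (Hc t Ht)|].
    replace (fun xi => exp xi * Re (f (exp xi))) with (fun x => Re (g x))
      by (extensionality y; rewrite <- E; simpl; unfold Re, Im; ring).
    apply (Iline_correct M d _ (Cexpdec_Re _ _ _ Hg)).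
  - apply is_RInt_gen_exp; [intros t Ht; apply (Hc t Ht)|].
    replace (fun xi => exp xi * Im (f (exp xi))) with (fun x => Im (g x))
      by (extensionality y; rewrite <- E; simpl; unfold Re, Im; ring).
    apply (Iline_correct M d _ (Cexpdec_Im _ _ _ Hg)).
Qed.

Lemma CIline_ext f g : (forall x, f x = g x) -> CIline f = CIline g.
Proof. intros H. f_equal. apply functional_extensionality, H. Qed.

Lemma CIline_scal M d f k : Cexpdec M d f -> CIline (fun x => k * f x)%C = (k * CIline f)%C.
Proof.
  intros Hf. assert (H1 := Cexpdec_Re _ _ _ Hf). assert (H2 := Cexpdec_Im _ _ _ Hf).
  apply C_ext.
  - apply (eq_trans (Iline_minus _ _ _ _ _ _ (expdec_scal _ _ _ (fst k) H1) (expdec_scal _ _ _ (snd k) H2))).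
    rewrite (Iline_scal _ _ _ (fst k) H1), (Iline_scal _ _ _ (snd k) H2). reflexivity.
  - apply (eq_trans (Iline_plus _ _ _ _ _ _ (expdec_scal _ _ _ (fst k) H2) (expdec_scal _ _ _ (snd k) H1))).
    rewrite (Iline_scal _ _ _ (fst k) H2), (Iline_scal _ _ _ (snd k) H1). reflexivity.
Qed.

Lemma CIline_minus M d M' d' f g : Cexpdec M d f -> Cexpdec M' d' g ->
  CIline (fun x => f x - g x)%C = (CIline f - CIline g)%C.
Proof.
  intros Hf Hg. apply C_ext.
  - apply (Iline_minus _ _ _ _ _ _ (Cexpdec_Re _ _ _ Hf) (Cexpdec_Re _ _ _ Hg)).
  - apply (Iline_minus _ _ _ _ _ _ (Cexpdec_Im _ _ _ Hf) (Cexpdec_Im _ _ _ Hg)).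
Qed.

Lemma Cexpdec_weaken M d d' f : Cexpdec M d f -> 0 < d' <= d -> Cexpdec M d' f.
Proof.
  intros Hf [Hd' Hdd]. assert (HM := Cexpdec_cst_nonneg _ _ _ Hf). destruct Hf as [_ [Hc Hb]].
  split; [trivial|split; trivial]. intros x. apply Rle_trans with (1 := Hb x).
  apply Rmult_le_compat_l; trivial. apply exp_le_exp. assert (H := Rabs_pos x). nra.
Qed.

Lemma Cexpdec_minus M d M' d' f g : Cexpdec M d f -> Cexpdec M' d' g ->
  Cexpdec (M + M') (Rmin d d') (fun x => f x - g x)%C.
Proof.
  intros Hf Hg.
  assert (Hm : 0 < Rmin d d') by (apply Rmin_glb_lt; [apply Hf|apply Hg]).
  destruct (Cexpdec_weaken _ _ _ _ Hf (conj Hm (Rmin_l _ _))) as [_ [Cf Bf]].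
  destruct (Cexpdec_weaken _ _ _ _ Hg (conj Hm (Rmin_r _ _))) as [_ [Cg Bg]].
  split; [trivial|split].
  - intros x. apply Ccont_minus; trivial.
  - intros x. apply Rle_trans with (1 := Cmod_triangle _ _). rewrite Cmod_opp, Rmult_plus_distr_r.
    apply Rplus_le_compat; trivial.
Qed.

Lemma Cexpdec_scal M d f k : Cexpdec M d f -> Cexpdec (Cmod k * M) d (fun x => k * f x)%C.
Proof.
  intros [Hd [Hc Hb]]. split; [trivial|split].
  - intros x. apply Ccont_mult; [apply Ccont_const|apply Hc].
  - intros x. rewrite Cmod_mult, Rmult_assoc. apply Rmult_le_compat_l; [apply Cmod_ge_0|apply Hb].
Qed.

Lemma CIline_RtoC f : CIline (fun x => RtoC (f x)) = RtoC (Iline f).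
Proof.
  apply C_ext; [reflexivity|]. simpl.
  assert (H : expdec 0 1 (fun _ => 0)).
  { split; [lra|split; [intros; apply continuous_const|]]. intros x. rewrite Rabs_R0; lra. }
  assert (B := Iline_bound _ _ _ H). apply Rabs_le_between in B. unfold Rdiv in B.
  rewrite Rmult_0_r, Rmult_0_l in B. change (Iline (fun _ => 0) = 0). lra.
Qed.

(** The factor 2 comes from estimating real and imaginary parts separately; the lemma serves in a
    limit, where constants are harmless. *)
Lemma CIline_Cmod_le M d M' d' f g : Cexpdec M d f -> expdec M' d' g ->
  (forall x, Cmod (f x) <= g x) -> Cmod (CIline f) <= 2 * Iline g.
Proof.
  intros Hf Hg H. apply Rle_trans with (1 := Cmod_le_sum _).
  assert (Rabs (Re (CIline f)) <= Iline g).
  { apply (Iline_abs_le _ _ _ _ _ _ (Cexpdec_Re _ _ _ Hf) Hg).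
    intros x. apply Rle_trans with (2 := H x). apply Re_le_Cmod. }
  assert (Rabs (Im (CIline f)) <= Iline g).
  { apply (Iline_abs_le _ _ _ _ _ _ (Cexpdec_Im _ _ _ Hf) Hg).
    intros x. apply Rle_trans with (2 := H x). apply Im_le_Cmod. }
  lra.
Qed.

Lemma CIline_bound M d f : Cexpdec M d f -> Cmod (CIline f) <= 4 * M / d.
Proof.
  intros Hf. apply Rle_trans with (1 := Cmod_le_sum _).
  assert (H1 := Iline_bound _ _ _ (Cexpdec_Re _ _ _ Hf)).
  assert (H2 := Iline_bound _ _ _ (Cexpdec_Im _ _ _ Hf)).
  unfold CIline; simpl. unfold Rdiv in *. lra.
Qed.

Lemma Ccont_ext {U : UniformSpace} (f g : U -> C) x : (forall y, f y = g y) -> Ccont f x -> Ccont g x.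
Proof. intros H. replace g with f; trivial. apply functional_extensionality, H. Qed.

Lemma CIline_opp_arg M d f : Cexpdec M d f -> CIline (fun x => f (- x)) = CIline f.
Proof.
  intros Hf. apply C_ext.
  - apply (Iline_opp_arg _ _ _ (Cexpdec_Re _ _ _ Hf)).
  - apply (Iline_opp_arg _ _ _ (Cexpdec_Im _ _ _ Hf)).
Qed.

Lemma CIline_affine M d f b c : 0 < b -> Cexpdec M d f ->
  CIline (fun x => f (b * x + c)) = (CIline f / b)%C.
Proof.
  intros Hb Hf.
  assert (E : (CIline f / b)%C = (Re (CIline f) / b, Im (CIline f) / b)).
  { unfold Cdiv. rewrite <- RtoC_inv by lra. apply C_ext; simpl; unfold Rdiv; unfold Re, Im; ring. }
  rewrite E. apply C_ext.
  - apply (Iline_affine _ _ _ b c Hb (Cexpdec_Re _ _ _ Hf)).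
  - apply (Iline_affine _ _ _ b c Hb (Cexpdec_Im _ _ _ Hf)).
Qed.

Lemma Cexpdec_affine M d f b c : b <> 0 -> Cexpdec M d f ->
  Cexpdec (M * exp (d * Rabs c)) (d * Rabs b) (fun x => f (b * x + c)).
Proof.
  intros Hb Hf. assert (HM0 := Cexpdec_cst_nonneg _ _ _ Hf). destruct Hf as [Hd [Hc Hf]].
  split; [apply Rmult_lt_0_compat; [trivial|apply Rabs_pos_lt; trivial]|split].
  - intros x. assert (L := continuous_affine b c x). destruct (Hc (b * x + c)) as [Hr Hi]. split.
    + apply (continuous_comp (fun x => b * x + c) (fun y => Re (f y))); [exact L|exact Hr].
    + apply (continuous_comp (fun x => b * x + c) (fun y => Im (f y))); [exact L|exact Hi].
  - intros x. apply Rle_trans with (1 := Hf _). rewrite Rmult_assoc.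
    apply Rmult_le_compat_l; [trivial|apply exp_decay_affine; trivial].
Qed.

Lemma CIline_derive_0 M d f F : Cexpdec M d f -> (forall x, is_Cder F x (f x)) ->
  (exists M' d', 0 < d' /\ forall x, Cmod (F x) <= M' * exp (- d' * Rabs x)) -> CIline f = 0.
Proof.
  intros Hf HF [M' [d' [Hd' Hb]]]. apply C_ext.
  - apply (Iline_derive_0 M d _ (fun x => Re (F x)) (Cexpdec_Re _ _ _ Hf)); [intros; apply HF|].
    exists M', d'. split; trivial. intros x. apply Rle_trans with (2 := Hb x). apply Re_le_Cmod.
  - apply (Iline_derive_0 M d _ (fun x => Im (F x)) (Cexpdec_Im _ _ _ Hf)); [intros; apply HF|].
    exists M', d'. split; trivial. intros x. apply Rle_trans with (2 := Hb x). apply Im_le_Cmod.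
Qed.

Definition Ccont2 (h : R -> R -> C) :=
  forall p : R * R, Ccont (fun p : R * R => h (fst p) (snd p)) p.

Lemma Ccont2_Re h : Ccont2 h -> cont2 (fun x y => Re (h x y)).
Proof. intros H x y. apply continuity_2d_pt_filterlim. apply (H (x, y)). Qed.

Lemma Ccont2_Im h : Ccont2 h -> cont2 (fun x y => Im (h x y)).
Proof. intros H x y. apply continuity_2d_pt_filterlim. apply (H (x, y)). Qed.

Lemma Ccont2_1 h x : Ccont2 h -> forall y, Ccont (h x) y.
Proof.
  intros H y; split.
  - apply (cont2_1 (fun x y => Re (h x y))), Ccont2_Re, H.
  - apply (cont2_1 (fun x y => Im (h x y))), Ccont2_Im, H.
Qed.

Lemma Cfubini M d h : Ccont2 h ->
  (forall x y, Cmod (h x y) <= M * exp (- d * Rabs x) * exp (- d * Rabs y)) -> 0 < d ->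
  CIline (fun x => CIline (h x)) = CIline (fun y => CIline (fun x => h x y)).
Proof.
  intros Hh Hb Hd. apply C_ext.
  - apply (fubini M d (fun x y => Re (h x y))); trivial; [apply Ccont2_Re; trivial|].
    intros x y. apply Rle_trans with (2 := Hb x y). apply Re_le_Cmod.
  - apply (fubini M d (fun x y => Im (h x y))); trivial; [apply Ccont2_Im; trivial|].
    intros x y. apply Rle_trans with (2 := Hb x y). apply Im_le_Cmod.
Qed.

(** * The Gamma function *)

(** The function [K x - exp x] is concave and maximal at [ln K]; the inequality is that of [exp]
    with its tangent there. *)
Lemma exp_dominates_linear K x : 0 < K -> K * x - exp x <= K * ln K - K.
Proof.
  intros HK. assert (H := exp_ineq1_le (x - ln K)).
  unfold Rminus in H at 2. rewrite exp_plus, exp_Ropp, exp_ln in H by trivial.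
  apply Rmult_le_compat_l with (r := K) in H; [|lra].
  replace (K * (exp x * / K)) with (exp x) in H by (field; lra). lra.
Qed.

Lemma exp_kernel_decay k l : 0 < k -> 0 < l ->
  exists M, 0 <= M /\ forall x, exp (k * x - l * exp x) <= M * exp (- k * Rabs x).
Proof.
  (* For [x <= 0] the factor [exp (k x)] decays by itself. For [x >= 0] the double exponential has
     to beat [exp (2 k x)] to leave [exp (- k x)], that is, [l exp x] has to dominate [2 k x],
     whence this [K]. *)
  intros Hk Hl. set (K := 2 * k / l).
  assert (HK : 0 < K) by (apply Rdiv_lt_0_compat; lra).
  exists (1 + exp (l * (K * ln K - K))). assert (P := exp_pos (l * (K * ln K - K))).
  split; [lra|]. intros x. assert (Px := exp_pos x).
  destruct (Rle_dec x 0) as [Hx|Hx].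
  - rewrite (Rabs_left1 x Hx). assert (exp (k * x - l * exp x) <= exp (- k * - x)) by (apply exp_le_exp; nra).
    assert (Q := exp_pos (- k * - x)). nra.
  - rewrite (Rabs_pos_eq x) by lra.
    assert (exp (k * x - l * exp x) <= exp (l * (K * ln K - K)) * exp (- k * x)).
    { rewrite <- exp_plus. apply exp_le_exp. assert (H := exp_dominates_linear K x HK).
      apply Rmult_le_compat_l with (r := l) in H; [|lra].
      replace (l * (K * x - exp x)) with (2 * k * x - l * exp x) in H by (unfold K; field; lra). lra. }
    assert (Q := exp_pos (- k * x)). nra.
Qed.

(** The integrand of Gamma after [t = exp x], Jacobian included: [t^(z-1) exp (-t) dt] becomes
    [exp (z x - exp x) dx]. *)
Definition gammaK (z : C) (x : R) : C := cexp (z * x - RtoC (exp x))%C.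

Lemma Cmod_gammaK z x : Cmod (gammaK z x) = exp (Re z * x - exp x).
Proof. unfold gammaK. rewrite Cmod_cexp. f_equal. simpl. unfold Re; ring. Qed.

Lemma gammaK_cont z x : Ccont (gammaK z) x.
Proof.
  unfold gammaK. Ccont_auto.
Qed.

Lemma gammaK_expdec z : 0 < Re z -> exists M, Cexpdec M (Re z) (gammaK z).
Proof.
  intros Hz. destruct (exp_kernel_decay (Re z) 1 Hz Rlt_0_1) as [M [HM H]].
  exists M. split; [trivial|split; [apply gammaK_cont|]].
  intros x. rewrite Cmod_gammaK. rewrite <- (Rmult_1_l (exp x)). apply H.
Qed.

Lemma Cpowr_cexp x s : Cpowr x s = cexp (s * RtoC (ln x))%C.
Proof.
  unfold Cpowr, cexp, Rpower. apply C_ext; simpl; unfold Re, Im; simpl;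
    (f_equal; [f_equal; ring|f_equal; ring]).
Qed.

Lemma CGamma_CIline z : 0 < Re z -> CGamma z = CIline (gammaK z).
Proof.
  intros Hz. destruct (gammaK_expdec z Hz) as [M HM].
  apply (Cint0inf_CIline M (Re z)); trivial.
  - intros t Ht. apply Ccont_mult.
    + apply Ccont_RtoC. der_cont. lra.
    + apply (Ccont_ext (fun t => cexp (z * RtoC (ln t))%C)); [intros; symmetry; apply Cpowr_cexp|].
      Ccont_auto. der_cont.
  - intros x. rewrite Cpowr_cexp, ln_exp. unfold gammaK. rewrite cexp_minus.
    rewrite (Cmult_assoc (RtoC (exp x))), <- RtoC_mult.
    replace (exp x * (exp (- exp x) / exp x)) with (exp (- exp x)) by (field; apply Rgt_not_eq, exp_pos).
    rewrite <- cexp_RtoC, RtoC_opp, cexp_opp. unfold Cdiv. ring.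
Qed.

Definition rgammaK (a x : R) : R := exp (a * x - exp x).

Lemma rgammaK_continuous a x : continuous (rgammaK a) x.
Proof. unfold rgammaK. der_cont. Qed.

Lemma rgammaK_expdec a : 0 < a -> exists M, expdec M a (rgammaK a).
Proof.
  intros Ha. destruct (exp_kernel_decay a 1 Ha Rlt_0_1) as [M [HM H]].
  exists M. split; [trivial|split].
  - apply rgammaK_continuous.
  - intros x. unfold rgammaK. rewrite Rabs_pos_eq by (left; apply exp_pos).
    rewrite <- (Rmult_1_l (exp x)). apply H.
Qed.

Lemma gammaK_RtoC a x : gammaK (RtoC a) x = RtoC (rgammaK a x).
Proof. unfold gammaK. rewrite <- RtoC_mult, <- RtoC_minus, cexp_RtoC. reflexivity. Qed.

Lemma Gamma_Iline a : 0 < a -> Gamma a = Iline (rgammaK a).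
Proof.
  intros Ha. destruct (rgammaK_expdec a Ha) as [M HM].
  apply (int0inf_Iline M a); trivial.
  - intros t Ht. apply (ex_derive_continuous (fun t => Rpower t (a - 1) * exp (- t))).
    unfold Rpower. auto_derive. trivial.
  - intros x. unfold Rpower. rewrite ln_exp, <- !exp_plus. unfold rgammaK. f_equal. ring.
Qed.

Lemma CGamma_RtoC a : 0 < a -> CGamma (RtoC a) = RtoC (Gamma a).
Proof.
  intros Ha. rewrite CGamma_CIline by trivial. rewrite Gamma_Iline by trivial.
  rewrite <- CIline_RtoC. apply CIline_ext. intros; apply gammaK_RtoC.
Qed.

Lemma Gamma_pos a : 0 < a -> 0 < Gamma a.
Proof.
  intros Ha. rewrite Gamma_Iline by trivial. destruct (rgammaK_expdec a Ha) as [M HM].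
  assert (I : 0 < RInt (rgammaK a) 0 1).
  { apply RInt_gt_0; [lra|intros; apply exp_pos|intros; apply HM]. }
  apply Rlt_le_trans with (1 := I). apply Rnot_lt_le. intros H.
  (* If the whole integral were smaller than its part over [[0, 1]] by [e], a truncation containing
     [[0, 1]] with error below [e] would contradict the positivity of the integrand. *)
  set (e := RInt (rgammaK a) 0 1 - Iline (rgammaK a)).
  assert (K := Iline_bound_nonneg _ _ _ HM).
  destruct (exp_decay_small (2 * M / a) a e K Ha ltac:(unfold e; lra)) as [B [HB HB']].
  assert (A := Iline_approx M a _ B (- (B + 1)) (B + 1) HM HB ltac:(lra) ltac:(lra)).
  rewrite <- (RInt_split _ (- (B + 1)) 0 (B + 1)), <- (RInt_split _ 0 1 (B + 1)) in A by apply HM.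
  assert (P : forall u v, u <= v -> 0 <= RInt (rgammaK a) u v).
  { intros u v Huv. apply RInt_ge_0; trivial; [apply ex_RInt_cont, HM|].
    intros; left; apply exp_pos. }
  assert (P1 := P (- (B + 1)) 0 ltac:(lra)). assert (P2 := P 1 (B + 1) ltac:(lra)).
  apply Rabs_le_between in A. unfold e in *. lra.
Qed.

(** Integration by parts: [z * gammaK z - gammaK (z + 1)] is the derivative of [gammaK z]. *)
Lemma CGamma_succ z : 0 < Re z -> CGamma (z + 1)%C = (z * CGamma z)%C.
Proof.
  intros Hz. assert (Hz1 : 0 < Re (z + 1)%C) by (simpl; unfold Re in *; lra).
  rewrite !CGamma_CIline by trivial.
  destruct (gammaK_expdec z Hz) as [M HM]. destruct (gammaK_expdec _ Hz1) as [M1 HM1].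
  rewrite <- (CIline_scal M (Re z)) by trivial.
  assert (HzM := Cexpdec_scal _ _ _ z HM).
  assert (E : CIline (fun x => z * gammaK z x - gammaK (z + 1) x)%C = 0).
  { assert (D : exists M d, Cexpdec M d (fun x => z * gammaK z x - gammaK (z + 1) x)%C).
    { do 2 eexists. apply (Cexpdec_minus _ _ _ _ _ _ HzM HM1). }
    destruct D as [M2 [d2 HM2]]. apply (CIline_derive_0 _ _ _ (gammaK z) HM2).
    - intros x. apply (is_Cder_eq _ _ ((z + - RtoC (exp x)) * gammaK z x)%C).
      + apply (is_Cder_cexp (fun x => z * x - RtoC (exp x))%C).
        apply (is_Cder_eq _ _ (z + - RtoC (exp x))%C); [|reflexivity].
        apply (is_Cder_plus (fun x => z * x)%C (fun x => - RtoC (exp x))%C).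
        * apply (is_Cder_eq (fun x => z * x)%C _ z); [|reflexivity].
          destruct z as [z1 z2]; split; simpl; auto_derive; trivial; ring.
        * split; simpl; auto_derive; trivial; ring.
      + unfold gammaK. replace ((z + 1) * x - RtoC (exp x))%C with (x + (z * x - RtoC (exp x)))%C by ring.
        rewrite (cexp_plus (RtoC x)), cexp_RtoC. ring.
    - exists M, (Re z). split; trivial. apply HM. }
  rewrite (CIline_minus _ _ _ _ _ _ HzM HM1) in E. symmetry. apply Ceq_minus. exact E.
Qed.

Lemma Gamma_succ a : 0 < a -> Gamma (a + 1) = a * Gamma a.
Proof.
  intros Ha. apply RtoC_inj. rewrite RtoC_mult, <- !CGamma_RtoC, RtoC_plus by lra.
  apply CGamma_succ. trivial.
Qed.

Lemma Gamma_1 : Gamma 1 = 1.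
Proof.
  rewrite Gamma_Iline by lra. destruct (rgammaK_expdec 1 Rlt_0_1) as [M HM].
  rewrite (Iline_derive M 1 _ (fun x => - exp (- exp x)) HM) with (la := -1) (lb := 0).
  - ring.
  - intros x. unfold rgammaK. auto_derive; trivial.
    replace (1 * x - exp x) with (x + - exp x) by ring. rewrite exp_plus. ring.
  - replace (-1) with (- exp (- 0)) by (rewrite Ropp_0, exp_0; ring).
    apply (filterlim_comp _ _ _ exp (fun y => - exp (- y)) _ (locally 0)).
    + apply is_lim_exp_m.
    + der_cont.
  - replace 0 with (- 0) by ring.
    apply (filterlim_comp _ _ _ (fun x => exp (- exp x)) Ropp _ (locally 0)).
    + apply (filterlim_comp _ _ _ (fun x => - exp x) exp _ (Rbar_locally m_infty)).
      * apply (filterlim_comp _ _ _ exp Ropp _ (Rbar_locally p_infty)).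
        apply is_lim_exp_p. apply (filterlim_Rbar_opp p_infty).
      * apply is_lim_exp_m.
    + apply (continuous_opp (fun x : R => x)), continuous_id.
Qed.

(** A translation by [ln l] turns this integral into [Gamma 1]. It evaluates the inner integral in
    [CGamma_mul_CIline]. *)
Lemma Iline_exp_kernel l : 0 < l ->
  (exists M, expdec M 1 (fun x => exp (x - l * exp x))) /\ Iline (fun x => exp (x - l * exp x)) = / l.
Proof.
  intros Hl. destruct (rgammaK_expdec 1 Rlt_0_1) as [M HM].
  assert (E : (fun x => exp (x - l * exp x)) = (fun x => / l * rgammaK 1 (1 * x + ln l))).
  { extensionality x. unfold rgammaK.
    replace (/ l) with (exp (- ln l)) by (rewrite exp_Ropp, exp_ln; trivial).
    rewrite !Rmult_1_l, (exp_plus x (ln l)), exp_ln, <- exp_plus by trivial. f_equal. ring. }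
  assert (HA := expdec_affine _ _ _ 1 (ln l) ltac:(lra) HM).
  rewrite Rabs_R1, Rmult_1_r in HA.
  rewrite E. split.
  - eexists. apply expdec_scal. exact HA.
  - rewrite (Iline_scal _ _ _ _ HA), (Iline_affine _ _ _ 1 (ln l) Rlt_0_1 HM).
    rewrite <- Gamma_Iline, Gamma_1 by lra. field. lra.
Qed.

(** * The product Gamma(z) Gamma(1 - z) as a single integral *)

(** The product of the integrands of [Gamma z] at [eta + v] and of [Gamma (1 - z)] at [eta]; the
    terms [z eta] cancel. *)
Definition betaK (z : C) (eta v : R) : C :=
  cexp (z * v + RtoC (eta - exp eta - exp (eta + v)))%C.

Lemma Cmod_betaK z eta v : Cmod (betaK z eta v) = exp (Re z * v + eta - exp eta - exp (eta + v)).
Proof. unfold betaK. rewrite Cmod_cexp. f_equal. simpl. unfold Re; ring. Qed.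

Lemma betaK_cont z : Ccont2 (betaK z).
Proof.
  intros p. unfold betaK. Ccont_auto.
Qed.

(* For [v >= 0] the double exponential is traded for [exp (- k (eta + v))] with
   [Re z < k < 1], which makes the kernel decay in both variables. *)
Lemma betaK_bound z : 0 < Re z < 1 -> exists M d, 0 < d /\
  forall eta v, Cmod (betaK z eta v) <= M * exp (- d * Rabs eta) * exp (- d * Rabs v).
Proof.
  intros [Hz0 Hz1]. set (s := Re z) in *. set (k := (1 + s) / 2).
  assert (Hk : s < k < 1) by (unfold k; lra).
  destruct (exp_kernel_decay (1 - k) 1 ltac:(lra) Rlt_0_1) as [M1 [HM1 B1]].
  destruct (exp_kernel_decay 1 1 Rlt_0_1 Rlt_0_1) as [M2 [HM2 B2]].
  set (c := exp (k * ln k - k)). assert (Hc : 0 < c) by apply exp_pos.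
  set (d := Rmin s (1 - k)).
  assert (Hd : 0 < d /\ d <= s /\ d <= 1 - k).
  { unfold d; split; [apply Rmin_glb_lt; lra|split; [apply Rmin_l|apply Rmin_r]]. }
  exists (c * M1 + M2), d. split; [lra|]. intros eta v. rewrite Cmod_betaK. fold s.
  assert (Ae : 0 <= Rabs eta) by apply Rabs_pos.
  assert (E1 : exp (- (1 - k) * Rabs eta) <= exp (- d * Rabs eta)) by (apply exp_le_exp; nra).
  assert (E2 : exp (- (1) * Rabs eta) <= exp (- d * Rabs eta)) by (apply exp_le_exp; nra).
  assert (Pe := exp_pos (- d * Rabs eta)). assert (Pv := exp_pos (- d * Rabs v)).
  assert (Pev : 0 < exp (- d * Rabs eta) * exp (- d * Rabs v)) by (apply Rmult_lt_0_compat; trivial).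
  destruct (Rle_dec 0 v) as [Hv|Hv].
  - apply Rle_trans with (c * (M1 * exp (- d * Rabs eta)) * exp (- d * Rabs v)).
    + apply Rle_trans with (c * exp ((1 - k) * eta - 1 * exp eta) * exp ((s - k) * v)).
      * unfold c. rewrite <- !exp_plus. apply exp_le_exp.
        assert (H := exp_dominates_linear k (eta + v) ltac:(lra)). lra.
      * apply Rmult_le_compat; [left; apply Rmult_lt_0_compat; [trivial|apply exp_pos]|left; apply exp_pos| |].
        -- apply Rmult_le_compat_l; [lra|]. apply Rle_trans with (1 := B1 eta). nra.
        -- apply exp_le_exp. rewrite Rabs_pos_eq by trivial. unfold k in *. nra.
    + nra.
  - apply Rle_trans with (M2 * exp (- d * Rabs eta) * exp (- d * Rabs v)).
    + apply Rle_trans with (exp (1 * eta - 1 * exp eta) * exp (s * v)).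
      * rewrite <- !exp_plus. apply exp_le_exp. assert (H := exp_pos (eta + v)). lra.
      * apply Rmult_le_compat; [left; apply exp_pos|left; apply exp_pos| |].
        -- apply Rle_trans with (1 := B2 eta). nra.
        -- apply exp_le_exp. rewrite Rabs_left by lra. nra.
    + assert (0 <= c * M1) by (apply Rmult_le_pos; lra). nra.
Qed.

Definition logisticK (z : C) (x : R) : C := (cexp (z * x) / RtoC (1 + exp x))%C.

(** This is Euler's Beta integral. The integration variable of [Gamma z] is translated by that of
    [Gamma (1 - z)]; after exchanging the order, the integral over [eta] of
    [exp (eta - (1 + exp v) exp eta)] is [1 / (1 + exp v)]. *)
Lemma CGamma_mul_CIline z : 0 < Re z < 1 ->
  (CGamma z * CGamma (1 - z))%C = CIline (logisticK z).
Proof.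
  intros Hz. assert (Hz' : 0 < Re (1 - z)%C) by (simpl; unfold Re in *; lra).
  destruct (gammaK_expdec z (proj1 Hz)) as [M HM]. destruct (gammaK_expdec _ Hz') as [M' HM'].
  destruct (betaK_bound z Hz) as [N [d [Hd HN]]].
  rewrite !CGamma_CIline by (trivial; apply Hz).
  rewrite <- (CIline_scal _ _ _ (CIline (gammaK z)) HM').
  transitivity (CIline (fun eta => CIline (betaK z eta))).
  - apply CIline_ext. intros eta.
    assert (E := CIline_affine _ _ _ 1 eta Rlt_0_1 HM).
    replace (CIline (gammaK z) / RtoC 1)%C with (CIline (gammaK z)) in E
      by field.
    rewrite <- E, Cmult_comm.
    assert (HA := Cexpdec_affine _ _ _ 1 eta ltac:(lra) HM).
    rewrite <- (CIline_scal _ _ _ _ HA).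
    apply CIline_ext. intros v. unfold gammaK, betaK. rewrite <- cexp_plus. f_equal.
    rewrite Rmult_1_l, (Rplus_comm v eta). rewrite !RtoC_minus, !RtoC_plus. ring.
  - rewrite (Cfubini N d (betaK z) (betaK_cont z) HN Hd).
    apply CIline_ext. intros v.
    assert (Hl : 0 < 1 + exp v) by (assert (H := exp_pos v); lra).
    destruct (Iline_exp_kernel (1 + exp v) Hl) as [[K HK] EK].
    transitivity (CIline (fun eta => cexp (z * v) * RtoC (exp (eta - (1 + exp v) * exp eta)))%C).
    + apply CIline_ext. intros eta. unfold betaK. rewrite cexp_plus, cexp_RtoC.
      do 3 f_equal. rewrite exp_plus. ring.
    + rewrite (CIline_scal K 1).
      * rewrite CIline_RtoC, EK. unfold logisticK, Cdiv. rewrite RtoC_inv by lra. reflexivity.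
      * split; [lra|split].
        -- intros x. apply Ccont_RtoC, HK.
        -- intros x. rewrite Cmod_R. apply HK.
Qed.

(** * The integral of exp(z x) / (1 + exp(x + i t)) and the reflection formula *)

(* [G_s = e = H_x] is the closedness of the form [G dx + H ds], so only the vertical sides
   of the rectangle contribute. *)
Lemma rectangle_shift (G H e : R -> R -> R) a b s0 s1 : cont2 e ->
  (forall x s, continuous (fun x => G x s) x) ->
  (forall x s, is_derive (G x) s (e x s)) ->
  (forall x s, is_derive (fun x => H x s) x (e x s)) ->
  RInt (fun x => G x s1) a b - RInt (fun x => G x s0) a b =
  RInt (fun s => H b s - H a s) s0 s1.
Proof.
  intros He HG HGs HHx.
  rewrite RInt_sub by (intros; apply HG).
  transitivity (RInt (fun x => RInt (e x) s0 s1) a b).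
  - apply RInt_ext. intros x _. symmetry. apply is_RInt_unique.
    apply (is_RInt_derive (G x)); intros s _; [apply HGs|apply cont2_1; trivial].
  - rewrite fubini_finite by trivial.
    apply RInt_ext. intros s _. apply is_RInt_unique.
    apply (is_RInt_derive (fun x => H x s)); intros x _; [apply HHx|].
    apply (cont2_2 e); trivial.
Qed.

(** [D] is the complex derivative of the integrand and [k s] the velocity at which the line moves,
    so the form [F dx + k F ds] is closed. The vertical sides of the rectangle at [x = B] and
    [x = - B] are [O(exp (- d B))], with [K] bounding the velocity. *)
Lemma CIline_shift (F D : R -> R -> C) (k : R -> C) M d K s0 s1 : s0 <= s1 -> 0 < d ->
  Ccont2 (fun x s => k s * D x s)%C ->
  (forall x s, Ccont (fun x => F x s) x) ->
  (forall s, Ccont k s) ->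
  (forall x s, is_Cder (fun x => F x s) x (D x s)) ->
  (forall x s, is_Cder (F x) s (k s * D x s)%C) ->
  (forall x s, s0 <= s <= s1 -> Cmod (F x s) <= M * exp (- d * Rabs x)) ->
  (forall s, Cmod (k s) <= K) ->
  CIline (fun x => F x s0) = CIline (fun x => F x s1).
Proof.
  intros Hs Hd Hc HF Hk HDx HDs Hb HK.
  assert (E : forall s, s0 <= s <= s1 -> Cexpdec M d (fun x => F x s)).
  { intros s Hss. split; [trivial|split; [intros; apply HF|intros; apply Hb; trivial]]. }
  assert (E0 := E s0 (conj (Rle_refl _) Hs)).
  assert (HM : 0 <= M) by apply (Cexpdec_cst_nonneg _ _ _ E0).
  assert (HK0 : 0 <= K) by (apply Rle_trans with (2 := HK 0); apply Cmod_ge_0).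
  assert (kF : forall x s, is_Cder (fun x => k s * F x s)%C x (k s * D x s)%C).
  { intros x s. apply (is_Cder_eq _ _ (0 * F x s + k s * D x s)%C); [|ring].
    apply (is_Cder_mult (fun _ => k s) (fun x => F x s) x 0%C (D x s)); [apply is_Cder_const|apply HDx]. }
  assert (kFc : forall x s, Ccont (fun s => k s * F x s)%C s).
  { intros x s. apply Ccont_mult; [apply Hk|]. apply (is_Cder_Ccont (F x) s _ (HDs x s)). }
  assert (Bd : forall B s, s0 <= s <= s1 -> Cmod (k s * F B s) <= K * M * exp (- d * Rabs B)).
  { intros B s Hss. rewrite Cmod_mult, Rmult_assoc.
    apply Rmult_le_compat; try apply Cmod_ge_0; [apply HK|apply Hb; trivial]. }
  (* The real rectangle argument is run once for a generic projection [p] and then used for [Re] and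
     [Im]. *)
  assert (Gen : forall p : C -> R, (forall z, Rabs (p z) <= Cmod z) ->
     (forall (f : R -> C) x, Ccont f x -> continuous (fun x => p (f x)) x) ->
     (forall f x l, is_Cder f x l -> is_derive (fun x => p (f x)) x (p l)) ->
     cont2 (fun x s => p (k s * D x s)%C) ->
     Iline (fun x => p (F x s0)) = Iline (fun x => p (F x s1))).
  { intros p Hp Hpc Hpd Hpe.
    assert (P : forall s, s0 <= s <= s1 -> expdec M d (fun x => p (F x s))).
    { intros s Hss. split; [trivial|split].
      - intros x; apply Hpc, HF.
      - intros x. apply Rle_trans with (1 := Hp _). apply Hb; trivial. }
    assert (P0 := P s0 (conj (Rle_refl _) Hs)). assert (P1 := P s1 (conj Hs (Rle_refl _))).
    assert (M2 : 0 <= 2 * M / d) by (apply Rle_trans with (2 := Iline_bound _ _ _ P0); apply Rabs_pos).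
    apply (Iline_eq_lim M d _ _ (2 * M / d + (s1 - s0) * (2 * (K * M))) d P0).
    - assert (0 <= K * M) by (apply Rmult_le_pos; trivial). nra.
    - trivial.
    - intros B HB. exists (- B), B. repeat split; try lra.
      assert (A1 := Iline_approx _ _ _ B (- B) B P1 HB (Rle_refl _) (Rle_refl _)).
      assert (R := rectangle_shift (fun x s => p (F x s)) (fun x s => p (k s * F x s)%C)
         (fun x s => p (k s * D x s)%C) (- B) B s0 s1 Hpe).
      cbv beta in R. rewrite <- Rabs_Ropp.
      replace (- (Iline (fun x => p (F x s1)) - RInt (fun x => p (F x s0)) (- B) B))
        with (- (Iline (fun x => p (F x s1)) - RInt (fun x => p (F x s1)) (- B) B) +
              - (RInt (fun x => p (F x s1)) (- B) B - RInt (fun x => p (F x s0)) (- B) B)) by ring.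
      apply Rle_trans with (1 := Rabs_triang _ _). rewrite !Rabs_Ropp, Rmult_plus_distr_r.
      apply Rplus_le_compat; [exact A1|]. rewrite R.
      + rewrite Rmult_assoc. apply RInt_abs_bound; trivial.
        * intros s. apply (continuous_Rminus (fun s => p (k s * F B s)%C)); apply Hpc, kFc.
        * intros s Hss. unfold Rminus. apply Rle_trans with (1 := Rabs_triang _ _).
          rewrite Rabs_Ropp.
          assert (X1 := Rle_trans _ _ _ (Hp _) (Bd B s Hss)).
          assert (X2 := Rle_trans _ _ _ (Hp _) (Bd (- B) s Hss)).
          rewrite Rabs_Ropp in X2. rewrite (Rabs_pos_eq B HB) in *. lra.
      + intros x s; apply Hpc, HF.
      + intros x s; apply (Hpd (F x)), HDs.
      + intros x s; apply (Hpd (fun x => k s * F x s)%C), kF. }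
  apply C_ext.
  - apply (Gen Re); [apply Re_le_Cmod|intros f x Hf; apply Hf|intros f x l Hf; apply Hf|].
    apply (Ccont2_Re (fun x s => k s * D x s)%C Hc).
  - apply (Gen Im); [apply Im_le_Cmod|intros f x Hf; apply Hf|intros f x l Hf; apply Hf|].
    apply (Ccont2_Im (fun x s => k s * D x s)%C Hc).
Qed.

Definition logisticA (x t : R) : C := (1 + cexp (x + Ci * t))%C.

Lemma logisticA_sqr x t : Cmod (logisticA x t) ^ 2 = 1 + 2 * exp x * cos t + exp x ^ 2.
Proof.
  unfold logisticA, cexp, Cmod. rewrite pow2_sqrt by (apply Rplus_le_le_0_compat; apply pow2_ge_0).
  simpl. unfold Re, Im; simpl.
  replace (x + (0 * t - 1 * 0)) with x by ring. replace (0 + (0 * 0 + 1 * t)) with t by ring.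
  assert (S := sin2_cos2 t). unfold Rsqr in S.
  transitivity (1 + 2 * exp x * cos t + exp x ^ 2 * (sin t * sin t + cos t * cos t)); [ring|].
  rewrite S. ring.
Qed.

Lemma logisticA_lower x t T : 0 <= T <= PI -> Rabs t <= T ->
  sqrt ((1 + cos T) / 2) * (1 + exp x) <= Cmod (logisticA x t).
Proof.
  intros HT Ht. assert (Hx := exp_pos x).
  assert (Hc : cos T <= cos t).
  { rewrite <- (Rabs_pos_eq T) by lra.
    replace (cos t) with (cos (Rabs t)) by (unfold Rabs; destruct (Rcase_abs t); rewrite ?cos_neg; trivial).
    assert (H0 := Rabs_pos t). rewrite (Rabs_pos_eq T) by lra. apply cos_decr_1; lra. }
  assert (Hb := COS_bound T).
  apply Rsqr_incr_0_var; [|apply Cmod_ge_0].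
  rewrite Rsqr_mult, Rsqr_sqrt by lra. rewrite (Rsqr_pow2 (Cmod _)), logisticA_sqr. unfold Rsqr.
  assert (0 <= (1 - exp x) ^ 2) by apply pow2_ge_0.
  assert ((1 + cos T) / 2 * ((1 + exp x) * (1 + exp x)) <= (1 + cos t) / 2 * ((1 + exp x) * (1 + exp x))).
  { apply Rmult_le_compat_r; nra. }
  nra.
Qed.

Lemma cos_gt_m1 T : 0 <= T < PI -> 0 < (1 + cos T) / 2.
Proof.
  intros HT. assert (cos PI < cos T) by (apply cos_decreasing_1; lra). rewrite cos_PI in H. lra.
Qed.

Lemma logisticA_neq_0 x t : - PI < t < PI -> logisticA x t <> 0.
Proof.
  intros Ht. apply Cmod_gt_0.
  assert (Hl := logisticA_lower x t (Rabs t)).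
  assert (Hr : Rabs t < PI) by (apply Rabs_lt_between; lra).
  assert (H0 := Rabs_pos t).
  apply Rlt_le_trans with (2 := Hl ltac:(lra) (Rle_refl _)).
  apply Rmult_lt_0_compat; [apply sqrt_lt_R0, cos_gt_m1; lra|].
  assert (Hx := exp_pos x). lra.
Qed.

Lemma logistic_decay s x : 0 < s < 1 -> exp (s * x) / (1 + exp x) <= exp (- Rmin s (1 - s) * Rabs x).
Proof.
  intros Hs. assert (Hx := exp_pos x).
  assert (H1 := Rmin_l s (1 - s)). assert (H2 := Rmin_r s (1 - s)).
  apply Rmult_le_reg_r with (1 + exp x); [lra|].
  replace (exp (s * x) / (1 + exp x) * (1 + exp x)) with (exp (s * x)) by (field; lra).
  assert (P := exp_pos (- Rmin s (1 - s) * Rabs x)).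
  destruct (Rle_dec 0 x) as [H|H].
  - rewrite Rabs_pos_eq in * by trivial.
    apply Rle_trans with (exp (- Rmin s (1 - s) * x) * exp x); [|nra].
    rewrite <- exp_plus. apply exp_le_exp. nra.
  - rewrite Rabs_left in * by lra.
    apply Rle_trans with (exp (- Rmin s (1 - s) * - x)); [|nra]. apply exp_le_exp. nra.
Qed.

Definition logisticF (z : C) (x t : R) : C :=
  (cexp (z * (x + Ci * t)) / logisticA x t)%C.

Lemma logisticF_bound z x t T : 0 < Re z < 1 -> 0 <= T < PI -> Rabs t <= T ->
  Cmod (logisticF z x t) <= exp (Rabs (Im z) * T) / sqrt ((1 + cos T) / 2)
                            * exp (- Rmin (Re z) (1 - Re z) * Rabs x).
Proof.
  intros Hz HT Ht. assert (Hx := exp_pos x).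
  assert (Hm : 0 < sqrt ((1 + cos T) / 2)) by (apply sqrt_lt_R0, cos_gt_m1; trivial).
  assert (Hl := logisticA_lower x t T ltac:(lra) Ht).
  assert (HA : 0 < Cmod (logisticA x t)) by (apply Rlt_le_trans with (2 := Hl); nra).
  unfold logisticF. rewrite Cmod_div by (apply Cmod_gt_0; trivial). rewrite Cmod_cexp.
  apply Rle_trans with (exp (Rabs (Im z) * T) / sqrt ((1 + cos T) / 2) * (exp (Re z * x) / (1 + exp x))).
  - replace (exp (Rabs (Im z) * T) / sqrt ((1 + cos T) / 2) * (exp (Re z * x) / (1 + exp x)))
      with (exp (Rabs (Im z) * T + Re z * x) * / (sqrt ((1 + cos T) / 2) * (1 + exp x)))
      by (rewrite exp_plus; field; lra).
    apply Rmult_le_compat; [left; apply exp_pos|left; apply Rinv_0_lt_compat; trivial| |].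
    + apply exp_le_exp. simpl. unfold Re, Im. destruct z as [z1 z2]; simpl.
      assert (- (z2 * t) <= Rabs z2 * T).
      { apply Rle_trans with (Rabs (- (z2 * t))); [apply Rle_abs|]. rewrite Rabs_Ropp, Rabs_mult.
        apply Rmult_le_compat_l; [apply Rabs_pos|trivial]. }
      lra.
    + apply Rinv_le_contravar; [nra|trivial].
  - apply Rmult_le_compat_l; [|apply logistic_decay; trivial].
    left. apply Rdiv_lt_0_compat; [apply exp_pos|trivial].
Qed.

(** Stated along an arbitrary path [w], because the same formula gives the derivative in [x] and the
    one in the shift parameter. *)
Lemma is_Cder_logistic z (w : R -> C) u l : is_Cder w u l -> (1 + cexp (w u))%C <> 0 ->
  is_Cder (fun u => cexp (z * w u) / (1 + cexp (w u)))%C u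
    (l * ((z * cexp (z * w u) * (1 + cexp (w u)) - cexp (z * w u) * cexp (w u))
         / ((1 + cexp (w u)) * (1 + cexp (w u)))))%C.
Proof.
  intros Hw HA.
  assert (H1 : is_Cder (fun u => cexp (z * w u))%C u ((0 * w u + z * l) * cexp (z * w u))%C).
  { apply (is_Cder_cexp (fun u => z * w u)%C). apply (is_Cder_mult (fun _ => z) w u 0%C l); trivial.
    apply is_Cder_const. }
  assert (H2 : is_Cder (fun u => 1 + cexp (w u))%C u (0 + l * cexp (w u))%C).
  { apply (is_Cder_plus (fun _ => 1%C) (fun u => cexp (w u))); [apply is_Cder_const|].
    apply is_Cder_cexp; trivial. }
  eapply is_Cder_eq.
  - exact (is_Cder_mult _ _ _ _ _ H1 (is_Cder_inv _ _ _ H2 HA)).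
  - cbv beta. field. exact HA.
Qed.

Lemma atan_range2 s : - PI < 2 * atan s < PI.
Proof. assert (H := atan_bound s). lra. Qed.

Lemma continuous_atan s : continuous atan s.
Proof. apply (ex_derive_continuous atan). auto_derive. trivial. Qed.

(** Writing the height as [2 atan s] makes every real [s] admissible: the line stays strictly
    between [- pi] and [pi], so the denominator never vanishes and the continuity and derivative
    conditions of [CIline_shift] hold for all [s]. *)
Lemma logistic_shift_atan z s0 s1 : 0 < Re z < 1 -> s0 <= s1 ->
  CIline (fun x => logisticF z x (2 * atan s0)) = CIline (fun x => logisticF z x (2 * atan s1)).
Proof.
  intros Hz Hs.
  set (w := fun x s => (RtoC x + Ci * RtoC (2 * atan s))%C).
  assert (HA : forall x s, (1 + cexp (w x s))%C <> 0) by (intros; apply logisticA_neq_0, atan_range2).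
  set (D := fun x s => ((z * cexp (z * w x s) * (1 + cexp (w x s)) - cexp (z * w x s) * cexp (w x s))
         / ((1 + cexp (w x s)) * (1 + cexp (w x s))))%C).
  (* The velocity [i d(2 atan s)/ds], of modulus at most 2. *)
  set (k := fun s : R => (Ci * RtoC (2 / (1 + s ^ 2)))%C).
  (* All lines between [s0] and [s1] lie in the closed strip of height [T = 2 atan S < pi], on which
     the decay bound is uniform. *)
  set (S := Rmax (Rabs s0) (Rabs s1)).
  set (T := 2 * atan S).
  assert (HS : 0 <= S) by (apply Rle_trans with (2 := Rmax_l _ _); apply Rabs_pos).
  assert (atan_le : forall a b, a <= b -> atan a <= atan b).
  { intros a b [H|H]; [left; apply atan_increasing; trivial|subst; lra]. }
  assert (HT : 0 <= T < PI).
  { split; [|apply atan_range2]. unfold T. rewrite <- atan_0 at 1.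
    assert (K := atan_le 0 S HS). rewrite atan_0 in *. lra. }
  assert (wc : forall p : R * R, Ccont (fun p : R * R => w (fst p) (snd p)) p).
  { intros p. unfold w. Ccont_auto.
    apply (continuous_comp (fun p : R * R => snd p) atan); [apply Ccont2_snd|apply continuous_atan]. }
  assert (kc : forall s, Ccont k s).
  { intros s. unfold k. Ccont_auto. der_cont. nra. }
  assert (Dx : forall x s, is_Cder (fun x => logisticF z x (2 * atan s)) x (D x s)).
  { intros x s. apply (is_Cder_eq _ _ (1 * D x s)%C); [|ring].
    apply (is_Cder_logistic z (fun x => w x s)); [|apply HA].
    split; simpl; auto_derive; trivial; ring. }
  apply (CIline_shift (fun x s => logisticF z x (2 * atan s)) D k
    (exp (Rabs (Im z) * T) / sqrt ((1 + cos T) / 2)) (Rmin (Re z) (1 - Re z)) 2); trivial.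
  - apply Rmin_glb_lt; lra.
  - intros p. apply Ccont_mult.
    + assert (Hk := kc (snd p)). split.
      * apply (continuous_comp (fun p : R * R => snd p) (fun s => Re (k s))); [apply Ccont2_snd|apply Hk].
      * apply (continuous_comp (fun p : R * R => snd p) (fun s => Im (k s))); [apply Ccont2_snd|apply Hk].
    + assert (Hw := wc p).
      unfold D. Ccont_auto. apply Cmult_neq_0; trivial.
  - intros x s. apply (is_Cder_Ccont _ _ _ (Dx x s)).
  - intros x s. apply (is_Cder_logistic z (w x)); [|apply HA].
    split; simpl; auto_derive; trivial; field; nra.
  - intros x s Hss. apply logisticF_bound; trivial.
    apply Rabs_le.
    assert (X1 : s <= S).
    { apply Rle_trans with s1; [lra|]. apply Rle_trans with (2 := Rmax_r _ _). apply Rle_abs. }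
    assert (X2 : - S <= s).
    { apply Rle_trans with s0; [|lra]. assert (H := Rmax_l (Rabs s0) (Rabs s1)). fold S in H.
      assert (H2 := Rle_abs (- s0)). rewrite Rabs_Ropp in H2. lra. }
    apply atan_le in X1. apply atan_le in X2. rewrite atan_opp in X2. unfold T. lra.
  - intros s. unfold k. rewrite Cmod_mult, Cmod_R.
    replace (Cmod Ci) with 1 by (unfold Cmod; simpl; replace (_ + _) with 1 by ring; rewrite sqrt_1; trivial).
    assert (0 < / (1 + s ^ 2) <= 1).
    { split; [apply Rinv_0_lt_compat; nra|]. rewrite <- Rinv_1. apply Rinv_le_contravar; nra. }
    rewrite Rmult_1_l, Rabs_pos_eq; unfold Rdiv; lra.
Qed.

Lemma logisticF_0 z x : logisticF z x 0 = logisticK z x.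
Proof.
  unfold logisticF, logisticA, logisticK. rewrite Cmult_0_r, Cplus_0_r, cexp_RtoC, RtoC_plus. reflexivity.
Qed.

Lemma logistic_shift z t : 0 < Re z < 1 -> - PI < t < PI ->
  CIline (fun x => logisticF z x t) = CIline (logisticK z).
Proof.
  intros Hz Ht.
  transitivity (CIline (fun x => logisticF z x (2 * atan 0))).
  - replace t with (2 * atan (tan (t / 2))) by (rewrite atan_tan; lra).
    destruct (Rle_dec 0 (tan (t / 2))) as [H|H].
    + symmetry. apply logistic_shift_atan; trivial.
    + apply logistic_shift_atan; trivial. lra.
  - apply CIline_ext. intros x. rewrite atan_0, Rmult_0_r. apply logisticF_0.
Qed.

Lemma logisticF_Cexpdec z t : 0 < Re z < 1 -> - PI < t < PI ->
  exists M d, Cexpdec M d (fun x => logisticF z x t).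
Proof.
  intros Hz Ht. do 2 eexists. split; [|split].
  - apply (Rmin_glb_lt (Re z) (1 - Re z) 0); lra.
  - intros x. unfold logisticF, logisticA. Ccont_auto. apply logisticA_neq_0; trivial.
  - intros x. apply (logisticF_bound z x t (Rabs t)); trivial; [|lra].
    split; [apply Rabs_pos|apply Rabs_lt_between; lra].
Qed.

(** * The value of the logistic integral: halving the parameter and letting it tend to 0 *)

Lemma RtoC_neq_0 x : x <> 0 -> RtoC x <> 0.
Proof. intros H K. apply H. apply RtoC_inj in K. trivial. Qed.

Lemma cexp_Ci x : cexp (Ci * RtoC x) = (cos x, sin x).
Proof.
  apply C_ext; unfold cexp; simpl; unfold Re, Im; simpl;
    replace (0 * x - 1 * 0) with 0 by ring; replace (0 * 0 + 1 * x) with x by ring; rewrite exp_0; ring.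
Qed.

Lemma cexp_Ci_PI2 : cexp (Ci * RtoC (PI / 2)) = Ci.
Proof. rewrite cexp_Ci, cos_PI2, sin_PI2. reflexivity. Qed.

Lemma Cinv_Ci : (/ Ci)%C = (- Ci)%C.
Proof. apply C_ext; simpl; field. Qed.

Definition csin (w : C) : C := ((cexp (Ci * w) - cexp (- (Ci * w))) / (2 * Ci))%C.

Lemma csin_RtoC t : csin (RtoC t) = RtoC (sin t).
Proof.
  unfold csin. replace (- (Ci * t))%C with (Ci * RtoC (- t))%C by (rewrite RtoC_opp; ring).
  rewrite !cexp_Ci, cos_neg, sin_neg. unfold Cdiv.
  apply C_ext; simpl; field.
Qed.

Lemma csin_cont {U : UniformSpace} (f : U -> C) t : Ccont f t -> Ccont (fun t => csin (f t)) t.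
Proof.
  intros Hf. unfold csin. Ccont_auto. apply Cmult_neq_0; [apply RtoC_neq_0; lra|apply Ci_nz].
Qed.

(** The double-angle formula, with [csin (PI / 2 - a)] standing for the cosine of [a]. *)
Lemma csin_double a : (2 * csin a * csin (RtoC (PI / 2) - a))%C = csin (2 * a)%C.
Proof.
  unfold csin.
  replace (Ci * (RtoC (PI / 2) - a))%C with (Ci * RtoC (PI / 2) + - (Ci * a))%C by ring.
  replace (Ci * (2 * a))%C with (Ci * a + Ci * a)%C by ring.
  rewrite !cexp_opp, !cexp_plus, !cexp_opp, cexp_Ci_PI2.
  assert (Hu := cexp_neq_0 (Ci * a)%C). set (u := cexp (Ci * a)%C) in *.
  transitivity (2 * ((u - / u) / (2 * Ci)) * ((Ci * / u - / Ci * u) / (2 * Ci)))%C.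
  - field. split; trivial; apply Ci_nz.
  - rewrite Cinv_Ci. field. split; trivial; apply Ci_nz.
Qed.

Lemma logisticK_Cexpdec z : 0 < Re z < 1 -> exists M d, Cexpdec M d (logisticK z).
Proof.
  intros Hz. assert (P := PI_RGT_0). destruct (logisticF_Cexpdec z 0 Hz ltac:(lra)) as [M [d H]].
  exists M, d. replace (logisticK z) with (fun x => logisticF z x 0); [trivial|].
  apply functional_extensionality. apply logisticF_0.
Qed.

(** The weights cancel the factors [exp (- i pi z / 2)] and [exp (i pi z / 2)] of the two lines.
    What remains is [exp (z x)] times the difference of [1 / (1 - i exp x)] and [1 / (1 + i exp x)]
    over [2 i], which is [exp x / (1 + exp (2 x))]. The [+ 0] matches the form of
    [CIline_affine]. *)
Lemma logistic_jump z x :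
  (/ (2 * Ci) * (cexp (Ci * (z * RtoC (PI / 2))) * logisticF z x (- (PI / 2)))
   - / (2 * Ci) * (cexp (- (Ci * (z * RtoC (PI / 2)))) * logisticF z x (PI / 2)))%C
  = logisticK ((z + 1) / 2) (2 * x + 0).
Proof.
  assert (Ppos := PI_RGT_0).
  assert (HP := logisticA_neq_0 x (PI / 2) ltac:(lra)).
  assert (HN := logisticA_neq_0 x (- (PI / 2)) ltac:(lra)).
  unfold logisticF, logisticK. unfold logisticA in *.
  replace (z * (x + Ci * RtoC (- (PI / 2))))%C with (z * x + - (Ci * (z * RtoC (PI / 2))))%C
    by (rewrite RtoC_opp; ring).
  replace (z * (x + Ci * RtoC (PI / 2)))%C with (z * x + Ci * (z * RtoC (PI / 2)))%C by ring.
  replace (Ci * RtoC (- (PI / 2)))%C with (- (Ci * RtoC (PI / 2)))%C in * by (rewrite RtoC_opp; ring).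
  replace ((z + 1) / 2 * RtoC (2 * x + 0))%C with (z * x + x)%C
    by (rewrite Rplus_0_r, RtoC_mult; field).
  rewrite !cexp_plus, !cexp_opp, cexp_Ci_PI2, Cinv_Ci, cexp_RtoC in *.
  set (E := RtoC (exp x)) in *.
  assert (EQ : RtoC (1 + exp (2 * x + 0)) = ((1 + E * Ci) * (1 + E * - Ci))%C).
  { replace (2 * x + 0) with (x + x) by ring. rewrite exp_plus. unfold E. apply C_ext; simpl; ring. }
  rewrite EQ. assert (Hw := cexp_neq_0 (Ci * (z * RtoC (PI / 2)))%C). field.
  repeat split; trivial; apply Ci_nz.
Qed.

(** Both lines carry the integral of [logisticK z], so the weights in [logistic_jump] combine to the
    sine of [z pi / 2]; the division by 2 is the Jacobian of [2 x]. *)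
Lemma logistic_halving z : 0 < Re z < 1 ->
  (csin (z * RtoC (PI / 2)) * CIline (logisticK z))%C = (CIline (logisticK ((z + 1) / 2)) / 2)%C.
Proof.
  intros Hz. assert (Ppos := PI_RGT_0).
  destruct (logisticF_Cexpdec z (PI / 2) Hz ltac:(lra)) as [M1 [d1 H1]].
  destruct (logisticF_Cexpdec z (- (PI / 2)) Hz ltac:(lra)) as [M2 [d2 H2]].
  destruct (logisticK_Cexpdec ((z + 1) / 2)) as [M3 [d3 H3]]; [simpl; unfold Re in *; lra|].
  assert (S1 := Cexpdec_scal _ _ _ (cexp (- (Ci * (z * RtoC (PI / 2)))))%C H1).
  assert (S2 := Cexpdec_scal _ _ _ (cexp (Ci * (z * RtoC (PI / 2))))%C H2).
  assert (S1' := Cexpdec_scal _ _ _ (/ (2 * Ci))%C S1). assert (S2' := Cexpdec_scal _ _ _ (/ (2 * Ci))%C S2).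
  rewrite <- (CIline_affine _ _ _ 2 0 ltac:(lra) H3).
  apply eq_sym, (eq_trans (eq_sym (CIline_ext _ _ (logistic_jump z)))).
  rewrite (CIline_minus _ _ _ _ _ _ S2' S1'), (CIline_scal _ _ _ _ S2), (CIline_scal _ _ _ _ S1).
  rewrite (CIline_scal _ _ _ _ H1), (CIline_scal _ _ _ _ H2), !logistic_shift by (trivial; lra).
  unfold csin. field. apply Ci_nz.
Qed.

Lemma logistic_symmetric z : 0 < Re z < 1 -> CIline (logisticK (1 - z)) = CIline (logisticK z).
Proof.
  intros Hz. destruct (logisticK_Cexpdec z Hz) as [M [d H]].
  rewrite <- (CIline_opp_arg _ _ _ H). apply CIline_ext. intros x. unfold logisticK.
  assert (Hx := exp_pos x).
  replace ((1 - z) * x)%C with (x + z * RtoC (- x))%C by (rewrite RtoC_opp; ring).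
  rewrite cexp_plus, cexp_RtoC, exp_Ropp, !RtoC_plus, RtoC_inv by lra.
  assert (Hc : RtoC (exp x) <> 0) by (apply RtoC_neq_0; lra).
  assert (Hc1 : (1 + RtoC (exp x))%C <> 0) by (rewrite <- RtoC_plus; apply RtoC_neq_0; lra).
  field. repeat split; trivial. rewrite Cplus_comm. trivial.
Qed.

(** With [J z] the integral, [logistic_halving] at [1 - z] and the symmetry of [J] give
    [J (z/2) = 2 cos (pi z / 2) J z]; multiplying by [sin (pi z / 2)] produces the double angle. *)
Lemma csin_logistic_halving z : 0 < Re z < 1 ->
  (csin (z / 2 * PI) * CIline (logisticK (z / 2)))%C = (csin (z * PI) * CIline (logisticK z))%C.
Proof.
  intros Hz. assert (R1 : Re (1 - z)%C = 1 - Re z) by reflexivity.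
  assert (R2 : Re (z / 2)%C = Re z / 2) by (simpl; unfold Re; field).
  assert (E := logistic_halving (1 - z)%C ltac:(lra)).
  rewrite logistic_symmetric in E by trivial.
  replace ((1 - z + 1) / 2)%C with (1 - z / 2)%C in E by field.
  rewrite logistic_symmetric in E by lra.
  assert (EJ : CIline (logisticK (z / 2)) = (2 * (csin ((1 - z) * RtoC (PI / 2)) * CIline (logisticK z)))%C)
    by (rewrite E; field).
  rewrite EJ. replace (z * PI)%C with (2 * (z / 2 * PI))%C by field.
  rewrite <- csin_double. rewrite RtoC_div by lra.
  replace ((1 - z) * (PI / RtoC 2))%C with (PI / RtoC 2 - z / 2 * PI)%C by field. ring.
Qed.

(** The density of the logistic distribution, minus the derivative of [1 / (1 + exp x)]. Unlike
    [logisticK z] at [z = 0], it is integrable over R. *)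
Definition logisticW (x : R) : R := exp x / (1 + exp x) ^ 2.

Lemma logisticW_bound x : 0 < logisticW x <= exp (- (1) * Rabs x).
Proof.
  unfold logisticW. assert (Hx := exp_pos x). split; [apply Rdiv_lt_0_compat; nra|].
  apply Rmult_le_reg_r with ((1 + exp x) ^ 2); [nra|].
  replace (exp x / (1 + exp x) ^ 2 * (1 + exp x) ^ 2) with (exp x) by (field; lra).
  replace (- (1) * Rabs x) with (- Rabs x) by ring.
  unfold Rabs; destruct (Rcase_abs x).
  - rewrite Ropp_involutive. nra.
  - rewrite exp_Ropp. apply Rmult_le_reg_l with (exp x); trivial.
    rewrite <- Rmult_assoc, Rinv_r by lra. nra.
Qed.

Lemma logisticW_continuous x : continuous logisticW x.
Proof. unfold logisticW. der_cont. assert (Hx := exp_pos x). nra. Qed.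

Lemma logisticW_expdec : expdec 1 1 logisticW.
Proof.
  split; [lra|split; [apply logisticW_continuous|]]. intros x.
  assert (H := logisticW_bound x). rewrite Rabs_pos_eq by lra. lra.
Qed.

Lemma Iline_logisticW : Iline logisticW = 1.
Proof.
  rewrite (Iline_derive _ _ _ (fun x => - / (1 + exp x)) logisticW_expdec) with (la := -1) (lb := 0).
  - ring.
  - intros x. assert (Hx := exp_pos x). unfold logisticW. auto_derive; [lra|]. field. lra.
  - replace (-1) with (- / (1 + 0)) by field.
    apply (filterlim_comp _ _ _ exp (fun y => - / (1 + y)) _ (locally 0)); [apply is_lim_exp_m|].
    der_cont. lra.
  - assert (L : is_lim (fun x => - / (1 + exp x)) p_infty 0).
    { replace (Finite 0) with (Rbar_opp 0) by (simpl; f_equal; ring). apply is_lim_opp.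
      apply (is_lim_inv (fun x => 1 + exp x) p_infty p_infty); [|discriminate].
      apply (is_lim_plus (fun _ => 1) exp p_infty 1 p_infty); [apply is_lim_const|apply is_lim_exp_p|reflexivity]. }
    exact L.
Qed.

Lemma Cexpdec_logisticW z : 0 < Re z < 1 ->
  Cexpdec 1 (1 - Re z) (fun x => cexp (z * x) * RtoC (logisticW x))%C.
Proof.
  intros Hz. split; [lra|split].
  - intros x. Ccont_auto. apply logisticW_continuous.
  - intros x. assert (H := logisticW_bound x). rewrite Cmod_mult, Cmod_cexp, Cmod_R, Rabs_pos_eq by lra.
    replace (Re (z * x)%C) with (Re z * x) by (simpl; unfold Re; ring).
    apply Rle_trans with (exp (Re z * x) * exp (- (1) * Rabs x)).
    + apply Rmult_le_compat_l; [left; apply exp_pos|lra].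
    + rewrite <- exp_plus, Rmult_1_l. apply exp_le_exp. assert (K := Rle_abs x). nra.
Qed.

(** This isolates the pole at [z = 0]: the right-hand side tends to [Iline logisticW = 1] as [z]
    shrinks to 0. *)
Lemma logistic_by_parts z : 0 < Re z < 1 ->
  (z * CIline (logisticK z))%C = CIline (fun x => cexp (z * x) * RtoC (logisticW x))%C.
Proof.
  intros Hz. destruct (logisticK_Cexpdec z Hz) as [M [d H]].
  assert (HW := Cexpdec_logisticW z Hz). assert (HS := Cexpdec_scal _ _ _ z H).
  rewrite <- (CIline_scal _ _ _ _ H). apply Ceq_minus. rewrite <- (CIline_minus _ _ _ _ _ _ HS HW).
  assert (HD : exists M d, Cexpdec M d (fun x => z * logisticK z x - cexp (z * x) * RtoC (logisticW x))%C).
  { do 2 eexists. apply (Cexpdec_minus _ _ _ _ _ _ HS HW). }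
  destruct HD as [M' [d' HD]]. apply (CIline_derive_0 _ _ _ (logisticK z) HD).
  - intros x. assert (Hx := exp_pos x). assert (HA := RtoC_neq_0 (1 + exp x) ltac:(lra)).
    assert (D1 : is_Cder (fun x => z * x)%C x z).
    { destruct z as [z1 z2]; split; simpl; auto_derive; trivial; ring. }
    assert (D2 : is_Cder (fun x => RtoC (1 + exp x)) x (RtoC (exp x))).
    { split; simpl; auto_derive; trivial; ring. }
    eapply is_Cder_eq; [exact (is_Cder_mult _ _ _ _ _ (is_Cder_cexp _ _ _ D1) (is_Cder_inv _ _ _ D2 HA))|].
    unfold logisticK, logisticW. rewrite RtoC_div, RtoC_pow by nra. cbv beta. field. trivial.
  - exists M, d. split; apply H.
Qed.

Definition Clim (u : nat -> C) (l : C) :=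
  is_lim_seq (fun n => Re (u n)) (Re l) /\ is_lim_seq (fun n => Im (u n)) (Im l).

Lemma Clim_const c : Clim (fun _ => c) c.
Proof. split; apply is_lim_seq_const. Qed.

Lemma Clim_mult u v l m : Clim u l -> Clim v m -> Clim (fun n => u n * v n)%C (l * m)%C.
Proof.
  intros [H1 H2] [H3 H4]. split.
  - apply (is_lim_seq_minus' (fun n => Re (u n) * Re (v n)) (fun n => Im (u n) * Im (v n)));
      apply is_lim_seq_mult'; trivial.
  - apply (is_lim_seq_plus' (fun n => Re (u n) * Im (v n)) (fun n => Im (u n) * Re (v n)));
      apply is_lim_seq_mult'; trivial.
Qed.

Lemma Clim_unique u l m : Clim u l -> Clim u m -> l = m.
Proof.
  intros [H1 H2] [H3 H4].
  apply C_ext.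
  - assert (E := is_lim_seq_unique _ _ H1). rewrite (is_lim_seq_unique _ _ H3) in E. congruence.
  - assert (E := is_lim_seq_unique _ _ H2). rewrite (is_lim_seq_unique _ _ H4) in E. congruence.
Qed.

Lemma Clim_ext_loc u v l : (exists N, forall n, (N <= n)%nat -> u n = v n) -> Clim u l -> Clim v l.
Proof.
  intros [N HN] [H1 H2]. split.
  - apply (is_lim_seq_ext_loc (fun n => Re (u n))); trivial. exists N. intros n Hn. rewrite HN; trivial.
  - apply (is_lim_seq_ext_loc (fun n => Im (u n))); trivial. exists N. intros n Hn. rewrite HN; trivial.
Qed.

Lemma Clim_RtoC u (l : R) : is_lim_seq u l -> Clim (fun n => RtoC (u n)) (RtoC l).
Proof. intros H; split; [exact H|apply is_lim_seq_const]. Qed.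

Lemma Clim_Cmod u l :
  (forall e, 0 < e -> exists N, forall n, (N <= n)%nat -> Cmod (u n - l)%C < e) -> Clim u l.
Proof.
  intros H. split; apply is_lim_seq_spec; intros e; destruct (H e (cond_pos e)) as [N HN];
    exists N; intros n Hn; apply Rle_lt_trans with (2 := HN n Hn).
  - apply (Re_le_Cmod (u n - l)%C).
  - apply (Im_le_Cmod (u n - l)%C).
Qed.

Lemma Clim_comp u l (phi : nat -> nat) : filterlim phi eventually eventually -> Clim u l ->
  Clim (fun n => u (phi n)) l.
Proof.
  intros Hp [H1 H2]. split.
  - apply (is_lim_seq_subseq (fun n => Re (u n)) _ phi); trivial.
  - apply (is_lim_seq_subseq (fun n => Im (u n)) _ phi); trivial.
Qed.

Lemma sin_sqr_le a : sin a ^ 2 <= a ^ 2.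
Proof.
  assert (K : forall b, 0 <= b -> Rabs (sin b) <= b).
  { intros b Hb. assert (Hs := SIN_bound b). destruct (Rle_dec 1 b).
    - apply Rabs_le. lra.
    - assert (P := PI2_3_2). assert (H1 : 0 <= sin b) by (apply sin_ge_0; lra).
      rewrite Rabs_pos_eq by trivial. destruct Hb as [Hb|Hb].
      + left; apply sin_lt_x; trivial.
      + subst b. rewrite sin_0. lra. }
  rewrite <- (pow2_abs (sin a)), <- (pow2_abs a). apply pow_incr. split; [apply Rabs_pos|].
  replace (Rabs (sin a)) with (Rabs (sin (Rabs a))); [apply K, Rabs_pos|].
  unfold Rabs at 2; destruct (Rcase_abs a); trivial. rewrite sin_neg, Rabs_Ropp. trivial.
Qed.

Lemma sinh_lower a : a ^ 2 <= (exp a - exp (- a)) ^ 2.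
Proof.
  assert (K : forall a, 0 <= a -> a ^ 2 <= (exp a - exp (- a)) ^ 2).
  { intros b Hb. apply pow_incr. assert (H1 := exp_ineq1_le b).
    assert (H2 : exp (- b) <= 1) by (rewrite <- exp_0; apply exp_le_exp; lra). lra. }
  destruct (Rle_dec 0 a) as [H|H]; [apply K; trivial|].
  specialize (K (- a) ltac:(lra)). rewrite Ropp_involutive in K.
  replace (a ^ 2) with ((- a) ^ 2) by ring. rewrite <- (pow2_abs (exp a - _)), <- Rabs_Ropp, pow2_abs.
  replace (- (exp a - exp (- a))) with (exp (- a) - exp a) by ring. trivial.
Qed.

(** Reduces a complex power to a real one. With [e = exp (Re w * v)], the squared modulus is
    [(e - 1)^2 + 4 e sin (Im w * v / 2)^2]. With [a = Re w * v / 2], the sine squared is at most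
    [(Im w / Re w)^2 a^2], and [e a^2 <= (e - 1)^2] because [e = exp (2 a)] and
    [a^2 <= (exp a - exp (- a))^2]. *)
Lemma cexp_sub_one_bound w : 0 < Re w ->
  exists K, 0 <= K /\ forall v, Cmod (cexp (w * RtoC v) - 1)%C <= K * Rabs (exp (Re w * v) - 1).
Proof.
  intros Hw. set (s := Re w) in *. set (t := Im w).
  exists (sqrt (1 + 4 * (t / s) ^ 2)). split; [apply sqrt_pos|]. intros v.
  assert (P : 0 <= 1 + 4 * (t / s) ^ 2) by (assert (H := pow2_ge_0 (t / s)); lra).
  apply Rsqr_incr_0_var; [|apply Rmult_le_pos; [apply sqrt_pos|apply Rabs_pos]].
  rewrite Rsqr_mult, Rsqr_sqrt, <- Rsqr_abs by trivial.
  rewrite Rsqr_pow2. unfold Cmod. rewrite pow2_sqrt by (apply Rplus_le_le_0_compat; apply pow2_ge_0).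
  assert (R : Re (w * v)%C = s * v) by (simpl; unfold s, Re; ring).
  assert (I : Im (w * v)%C = t * v) by (simpl; unfold t, Im; ring).
  change (fst (cexp (w * v) - 1)%C) with (exp (Re (w * v)%C) * cos (Im (w * v)%C) + - 1).
  change (snd (cexp (w * v) - 1)%C) with (exp (Re (w * v)%C) * sin (Im (w * v)%C) + - 0).
  rewrite R, I.
  assert (S := sin2_cos2 (t * v)). unfold Rsqr in S.
  assert (Cd : cos (t * v) = 1 - 2 * sin (t / 2 * v) * sin (t / 2 * v)).
  { replace (t * v) with (2 * (t / 2 * v)) by field. apply cos_2a_sin. }
  set (a := s * v / 2).
  assert (E : exp (s * v) = exp a * exp a) by (unfold a; rewrite <- exp_plus; f_equal; field).
  assert (Q : exp a * exp (- a) = 1) by (rewrite <- exp_plus, Rplus_opp_r; apply exp_0).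
  assert (H1 := sinh_lower a). assert (H2 := sin_sqr_le (t / 2 * v)).
  assert (H3 : (t / 2 * v) ^ 2 = (t / s) ^ 2 * a ^ 2) by (unfold a; field; lra).
  assert (H4 : exp (s * v) * a ^ 2 <= (exp (s * v) - 1) ^ 2).
  { rewrite E. replace ((exp a * exp a - 1) ^ 2) with ((exp a * exp a) * (exp a - exp (- a)) ^ 2).
    - apply Rmult_le_compat_l; [|trivial]. left; apply Rmult_lt_0_compat; apply exp_pos.
    - rewrite <- Q. ring. }
  set (e := exp (s * v)) in *. assert (He : 0 < e) by apply exp_pos.
  replace ((e * cos (t * v) + -1) ^ 2 + (e * sin (t * v) + - 0) ^ 2)
    with ((e - 1) ^ 2 + 2 * e * (1 - cos (t * v)) + e ^ 2 * (sin (t * v) * sin (t * v) + cos (t * v) * cos (t * v) - 1)) by ring.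
  rewrite S, Cd. unfold Rsqr.
  assert (H5 : e * sin (t / 2 * v) ^ 2 <= (t / s) ^ 2 * (e - 1) ^ 2).
  { apply Rle_trans with (e * ((t / s) ^ 2 * a ^ 2)); [rewrite <- H3; apply Rmult_le_compat_l; lra|].
    assert (0 <= (t / s) ^ 2) by apply pow2_ge_0. nra. }
  nra.
Qed.

Lemma abs_exp_sub_one y : Rabs (exp y - 1) <= Rabs y * exp (Rabs y).
Proof.
  assert (H1 := exp_ineq1_le y). assert (H2 := exp_ineq1_le (- y)). rewrite exp_Ropp in H2.
  assert (Hy := exp_pos y).
  assert (H3 : exp y * / exp y = 1) by (field; lra).
  unfold Rabs at 2 3; destruct (Rcase_abs y).
  - assert (H4 : 1 <= exp (- y)) by (rewrite <- exp_0; apply exp_le_exp; lra).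
    rewrite Rabs_left1; [nra|]. assert (exp y <= exp 0) by (apply exp_le_exp; lra). rewrite exp_0 in *. lra.
  - rewrite Rabs_pos_eq by lra. nra.
Qed.

Lemma logisticW_mean_close z : 0 < Re z < 1 -> exists K, forall t, 0 < t <= 1 / 2 ->
  Cmod (CIline (fun x => cexp (z * t * x) * RtoC (logisticW x)) - 1)%C <= K * t.
Proof.
  intros Hz. destruct (cexp_sub_one_bound z (proj1 Hz)) as [K [HK BK]].
  (* This is [CIline_bound] with constant [4 K t] and rate [1/4]. Of the decay [exp (- |x|)] of
     [logisticW], a part [exp (|x| / 4)] pays for the linear factor [|x|] and [exp (|x| / 2)] for
     [exp (Re z * t * |x|)], where [t <= 1/2] enters. *)
  exists (4 * (4 * K) / (1 / 4)). intros t Ht.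
  assert (Rt : Re (z * t)%C = Re z * t) by (simpl; unfold Re; ring).
  assert (HW := Cexpdec_logisticW (z * t)%C ltac:(rewrite Rt; nra)).
  assert (H1 : Cexpdec 1 1 (fun x => RtoC (logisticW x))).
  { split; [lra|split; [intros; apply Ccont_RtoC, logisticW_continuous|]].
    intros x. rewrite Cmod_R. apply logisticW_expdec. }
  replace (RtoC 1) with (CIline (fun x => RtoC (logisticW x)))
    by (rewrite CIline_RtoC, Iline_logisticW; reflexivity).
  rewrite <- (CIline_minus _ _ _ _ _ _ HW H1).
  replace (4 * (4 * K) / (1 / 4) * t) with (4 * (4 * K * t) / (1 / 4)) by field.
  apply CIline_bound. split; [lra|split].
  - intros x. apply Ccont_minus; [apply HW|apply H1].
  - intros x. assert (HL := logisticW_bound x). assert (Ax := Rabs_pos x).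
    replace (cexp (z * t * x) * RtoC (logisticW x) - RtoC (logisticW x))%C
      with ((cexp (z * RtoC (t * x)) - 1) * RtoC (logisticW x))%C
      by (rewrite RtoC_mult, Cmult_assoc; ring).
    rewrite Cmod_mult, Cmod_R, (Rabs_pos_eq (logisticW x)) by lra.
    set (a := Rabs x) in *. set (y := Re z * (t * x)).
    assert (Hy : Rabs y = Re z * t * a) by (unfold y; rewrite !Rabs_mult, !Rabs_pos_eq by lra; unfold a; ring).
    assert (B := Rle_trans _ _ _ (BK (t * x)) (Rmult_le_compat_l _ _ _ HK (abs_exp_sub_one y))).
    assert (Hta : 0 <= t * a) by (apply Rmult_le_pos; lra).
    assert (Y1 : Rabs y <= t * (4 * exp (a / 4))).
    { rewrite Hy. assert (E := exp_ineq1_le (a / 4)). nra. }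
    assert (Y2 : exp (Rabs y) <= exp (a / 2)) by (rewrite Hy; apply exp_le_exp; nra).
    assert (B2 : Rabs y * exp (Rabs y) <= t * (4 * exp (a / 4)) * exp (a / 2)).
    { apply Rmult_le_compat; trivial; [apply Rabs_pos|left; apply exp_pos]. }
    apply Rle_trans with (K * (t * (4 * exp (a / 4)) * exp (a / 2)) * exp (- (1) * a)).
    + apply Rmult_le_compat; [apply Cmod_ge_0|lra| |apply HL].
      apply Rle_trans with (1 := B). apply Rmult_le_compat_l; trivial.
    + right. replace (exp (- (1 / 4) * a)) with (exp (a / 4) * exp (a / 2) * exp (- (1) * a)); [ring|].
      rewrite <- !exp_plus. f_equal. field.
Qed.

Lemma pow_half_lim : is_lim_seq (fun n => (1 / 2) ^ n) 0.
Proof. apply is_lim_seq_geom. rewrite Rabs_pos_eq; lra. Qed.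

Lemma pow_half_bounds n : 0 < (1 / 2) ^ S n <= 1 / 2.
Proof. induction n as [|n IH]; simpl in *; lra. Qed.

Lemma is_Cder_slope_lim f l : is_Cder f 0 l -> f 0 = 0%C ->
  Clim (fun n => f ((1 / 2) ^ S n)%R * RtoC (/ (1 / 2) ^ S n))%C l.
Proof.
  intros [Dr Di] Z.
  assert (Gen : forall (g : R -> R) m, is_derive g 0 m -> g 0 = 0 ->
    is_lim_seq (fun n => g ((1 / 2) ^ S n) * / (1 / 2) ^ S n) m).
  { intros g m Hg H0. apply is_derive_Reals in Hg. apply is_lim_seq_spec. intros e.
    destruct (Hg e (cond_pos e)) as [dl Hdl].
    assert (L := pow_half_lim). apply is_lim_seq_spec in L. destruct (L dl) as [N HN].
    exists N. intros n Hn. specialize (HN (S n) ltac:(lia)). assert (B := pow_half_bounds n).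
    rewrite Rminus_0_r in HN. specialize (Hdl ((1 / 2) ^ S n) ltac:(lra) HN).
    rewrite Rplus_0_l, H0, Rminus_0_r in Hdl. exact Hdl. }
  split.
  - apply (is_lim_seq_ext _ _ _ (fun n => eq_sym (re_scal_r _ _)) (Gen _ _ Dr (f_equal Re Z))).
  - apply (is_lim_seq_ext _ _ _ (fun n => eq_sym (im_scal_r _ _)) (Gen _ _ Di (f_equal Im Z))).
Qed.

Lemma is_Cder_csin_0 w : is_Cder (fun t => csin (w * RtoC t))%C 0 w.
Proof.
  assert (D1 : forall v, is_Cder (fun t => v * RtoC t)%C 0 v).
  { intros [v1 v2]. split; simpl; auto_derive; trivial; ring. }
  assert (D2 := is_Cder_cexp _ _ _ (D1 (Ci * w)%C)). assert (D3 := is_Cder_cexp _ _ _ (D1 (- (Ci * w))%C)).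
  assert (D4 := is_Cder_mult _ _ _ _ _ (is_Cder_const (- (1))%C 0) D3).
  assert (D5 := is_Cder_mult _ _ _ _ _ (is_Cder_plus _ _ _ _ _ D2 D4) (is_Cder_const (/ (2 * Ci))%C 0)).
  apply (is_Cder_eq _ _ _ w) in D5.
  - replace (fun t => csin (w * RtoC t))%C with
      (fun t : R => (cexp (Ci * w * t) + - (1) * cexp (- (Ci * w) * t)) * / (2 * Ci))%C; trivial.
    extensionality t. unfold csin.
    replace (Ci * (w * t))%C with (Ci * w * t)%C by ring.
    replace (- (Ci * w * t))%C with (- (Ci * w) * t)%C by ring. field. apply Ci_nz.
  - cbv beta. rewrite !Cmult_0_r, cexp_0. field. apply Ci_nz.
Qed.

(* [csin (z PI) * CIline (logisticK z)] is invariant under [z -> z / 2]; as [z -> 0] the two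
   factors behave like [z PI] and [1 / z]. *)
Lemma csin_logistic z : 0 < Re z < 1 ->
  (csin (z * PI) * CIline (logisticK z))%C = RtoC PI.
Proof.
  intros Hz.
  set (d := fun n => RtoC ((1 / 2) ^ S n)).
  assert (Rd : forall n, 0 < Re (z * d n)%C < 1).
  { intros n. assert (B := pow_half_bounds n). unfold d.
    replace (Re (z * RtoC ((1 / 2) ^ S n))%C) with (Re z * (1 / 2) ^ S n) by (cbn -[pow]; unfold Re; ring). nra. }
  set (f := fun z => (csin (z * PI) * CIline (logisticK z))%C).
  assert (Inv : forall n, f (z * d n)%C = f z).
  { induction n as [|n IH].
    - replace (z * d 0%nat)%C with (z / 2)%C by (unfold d; rewrite pow_1, RtoC_div by lra; field).
      unfold f. exact (csin_logistic_halving z Hz).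
    - rewrite <- IH. replace (z * d (S n))%C with (z * d n / 2)%C.
      + unfold f. exact (csin_logistic_halving _ (Rd n)).
      + unfold d. change ((1 / 2) ^ S (S n)) with (1 / 2 * (1 / 2) ^ S n).
        rewrite (RtoC_mult (1 / 2)), RtoC_div by lra. field. }
  assert (L1 : Clim (fun n => z * d n * CIline (logisticK (z * d n)))%C 1%C).
  { destruct (logisticW_mean_close z Hz) as [K HK]. apply Clim_Cmod. intros e He.
    assert (L : is_lim_seq (fun n => K * (1 / 2) ^ n) 0).
    { replace (Finite 0) with (Finite (K * 0)) by (f_equal; ring).
      apply is_lim_seq_mult'; [apply is_lim_seq_const|apply pow_half_lim]. }
    apply is_lim_seq_spec in L. destruct (L (mkposreal e He)) as [N HN]. exists N. intros n Hn.
    specialize (HN (S n) ltac:(lia)). rewrite Rminus_0_r in HN. rewrite logistic_by_parts by apply Rd.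
    apply Rle_lt_trans with (1 := HK _ (pow_half_bounds n)).
    apply Rle_lt_trans with (1 := Rle_abs _). exact HN. }
  assert (L2 : Clim (fun n => csin (z * RtoC PI * RtoC ((1 / 2) ^ S n)) * RtoC (/ (1 / 2) ^ S n))%C (z * RtoC PI)%C).
  { apply (is_Cder_slope_lim _ _ (is_Cder_csin_0 (z * RtoC PI)%C)). rewrite Cmult_0_r, csin_RtoC, sin_0. reflexivity. }
  assert (Hz0 : z <> 0) by (intros E; rewrite E in Hz; simpl in Hz; lra).
  assert (L3 := Clim_mult _ _ _ _ L1 L2).
  apply (Clim_ext_loc _ (fun _ => z * f z)%C) in L3.
  - assert (U := Clim_unique _ _ _ L3 (Clim_const _)). fold (f z).
    transitivity (z * f z / z)%C; [field; trivial|]. rewrite <- U. field. trivial.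
  - exists 0%nat. intros n _. rewrite <- (Inv n). unfold f, d.
    replace (z * RtoC ((1 / 2) ^ S n) * PI)%C with (z * PI * RtoC ((1 / 2) ^ S n))%C by ring.
    assert (B := pow_half_bounds n). rewrite RtoC_inv by lra. field. apply RtoC_neq_0. lra.
Qed.

Lemma CGamma_reflection z : 0 < Re z < 1 ->
  (csin (z * PI) * (CGamma z * CGamma (1 - z)))%C = RtoC PI.
Proof. intros Hz. rewrite CGamma_mul_CIline by trivial. apply csin_logistic; trivial. Qed.

(** * Gauss's multiplication formula *)

(** Lets the real exponent [Re w] be replaced by an integer [m], whose moments are computable from
    the functional equation. *)
Lemma exp_sub_one_mono s m v : 0 <= s <= m -> Rabs (exp (s * v) - 1) <= Rabs (exp (m * v) - 1).
Proof.
  intros H. destruct (Rle_dec 0 v) as [Hv|Hv].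
  - assert (1 <= exp (s * v)) by (rewrite <- exp_0; apply exp_le_exp; nra).
    assert (exp (s * v) <= exp (m * v)) by (apply exp_le_exp; nra).
    rewrite !Rabs_pos_eq by lra. lra.
  - assert (exp (s * v) <= 1) by (rewrite <- exp_0; apply exp_le_exp; nra).
    assert (exp (m * v) <= exp (s * v)) by (apply exp_le_exp; nra).
    rewrite !Rabs_left1 by lra. lra.
Qed.

(** The mean of [(X / n)^j] for a Gamma(n)-distributed [X]. *)
Definition moment (j n : nat) : R :=
  Gamma (INR n + INR j) / Gamma (INR n) * exp (- (INR j * ln (INR n))).

(** By [Gamma_succ], passing from [j] to [j + 1] multiplies the moment by [1 + j / n]. *)
Lemma moment_lim j : is_lim_seq (moment j) 1.
Proof.
  induction j as [|j IH].
  - apply (is_lim_seq_ext_loc (fun _ => 1)); [|apply is_lim_seq_const].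
    exists 1%nat. intros n Hn. apply le_INR in Hn. simpl in Hn. unfold moment. simpl.
    rewrite Rplus_0_r, Rmult_0_l, Ropp_0, exp_0. assert (H := Gamma_pos (INR n) ltac:(lra)). field. lra.
  - apply (is_lim_seq_ext_loc (fun n => moment j n * (1 + INR j * / INR n))).
    + exists 1%nat. intros n Hn. apply le_INR in Hn. simpl in Hn. unfold moment.
      rewrite S_INR. assert (Hj := pos_INR j).
      rewrite <- Rplus_assoc, (Gamma_succ (INR n + INR j)) by lra.
      replace (- ((INR j + 1) * ln (INR n))) with (- (INR j * ln (INR n)) + - ln (INR n)) by ring.
      rewrite exp_plus, (exp_Ropp (ln _)), exp_ln by lra.
      assert (H := Gamma_pos (INR n) ltac:(lra)). field. lra.
    + replace (Finite 1) with (Finite (1 * (1 + INR j * 0))) by (f_equal; ring).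
      apply is_lim_seq_mult'; trivial.
      apply is_lim_seq_plus'; [apply is_lim_seq_const|].
      apply is_lim_seq_mult'; [apply is_lim_seq_const|].
      apply (is_lim_seq_inv INR p_infty); [apply is_lim_seq_INR|discriminate].
Qed.

Lemma Iline_moment j n : (1 <= n)%nat ->
  (exists M d, expdec M d (fun x => exp (INR j * (x - ln (INR n))) * rgammaK (INR n) x)) /\
  Iline (fun x => exp (INR j * (x - ln (INR n))) * rgammaK (INR n) x) = Gamma (INR n) * moment j n.
Proof.
  intros Hn. apply le_INR in Hn. simpl in Hn. assert (Hj := pos_INR j).
  destruct (rgammaK_expdec (INR n + INR j) ltac:(lra)) as [M HM].
  assert (E : (fun x => exp (INR j * (x - ln (INR n))) * rgammaK (INR n) x) =
    (fun x => exp (- (INR j * ln (INR n))) * rgammaK (INR n + INR j) x)).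
  { extensionality x. unfold rgammaK. rewrite <- !exp_plus. f_equal. ring. }
  rewrite E. split.
  - do 2 eexists. apply expdec_scal. exact HM.
  - rewrite (Iline_scal _ _ _ _ HM), <- Gamma_Iline by lra. unfold moment.
    assert (H := Gamma_pos (INR n) ltac:(lra)). field. lra.
Qed.

Definition gratio (w : C) (n : nat) : C :=
  (CGamma (w + RtoC (INR n)) / (RtoC (Gamma (INR n)) * cexp (w * RtoC (ln (INR n)))))%C.

(* [Gamma(n+w) / (Gamma(n) n^w)] is the mean of [(X/n)^w] for [X] Gamma(n)-distributed.
   With [m >= Re w], [|y^w - 1| <= K |y^m - 1| <= K (e + (y^m - 1)^2 / e) / 2], and the
   second moment of [y^m - 1] tends to [0]. *)
Lemma gratio_bound w : 0 < Re w -> exists K m, 0 <= K /\ forall e n, 0 < e -> (1 <= n)%nat ->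
  Cmod (gratio w n - 1)%C <= K * (e + (moment (m + m) n - 2 * moment m n + 1) / e).
Proof.
  intros Hw. destruct (cexp_sub_one_bound w Hw) as [K [HK BK]].
  destruct (nfloor_ex (Re w) ltac:(lra)) as [m0 [_ Hm0]].
  set (m := S m0). assert (Hm : Re w <= INR m) by (unfold m; rewrite S_INR; lra).
  exists K, m. split; trivial. intros e n He Hn.
  destruct (Iline_moment 0 n Hn) as [[M0 [d0 X0]] I0].
  destruct (Iline_moment m n Hn) as [[M1 [d1 X1]] I1].
  destruct (Iline_moment (m + m) n Hn) as [[M2 [d2 X2]] I2].
  apply le_INR in Hn. simpl in Hn. set (L := ln (INR n)) in *. set (N := INR n) in *.
  assert (HG := Gamma_pos N ltac:(lra)).
  assert (Hwn : 0 < Re (w + N)%C) by (simpl; unfold Re in *; lra).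
  destruct (gammaK_expdec _ Hwn) as [M HM].
  destruct (gammaK_expdec (RtoC N) ltac:(simpl; lra)) as [M' HM'].
  assert (HM'' := Cexpdec_scal _ _ _ (cexp (w * L)) HM'). cbv beta in HM''.
  assert (HcL := cexp_neq_0 (w * L)%C). assert (HGC := RtoC_neq_0 (Gamma N) ltac:(lra)).
  set (h := fun x => ((cexp (w * RtoC (x - L)) - 1) * RtoC (rgammaK N x))%C).
  assert (Eh : forall x, (gammaK (w + N) x - cexp (w * L) * gammaK (RtoC N) x)%C
     = (cexp (w * L) * h x)%C).
  { intros x. unfold h. rewrite gammaK_RtoC. unfold gammaK, rgammaK.
    replace ((w + N) * x - RtoC (exp x))%C
      with (w * L + (w * RtoC (x - L) + RtoC (N * x - exp x)))%C
      by (rewrite !RtoC_minus, RtoC_mult; ring).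
    rewrite !cexp_plus, (cexp_RtoC (N * x - exp x)). ring. }
  assert (Eg : (gratio w n - 1)%C = (CIline (fun x => cexp (w * L) * h x) / (RtoC (Gamma N) * cexp (w * L)))%C).
  { rewrite <- (CIline_ext _ _ Eh), (CIline_minus _ _ _ _ _ _ HM HM''), (CIline_scal _ _ _ _ HM').
    rewrite <- !CGamma_CIline, CGamma_RtoC by (trivial; simpl; lra).
    unfold gratio. fold N L. field. split; trivial. }
  assert (X0' := expdec_scal _ _ _ (e + / e) X0).
  assert (X1' := expdec_scal _ _ _ (- (2 / e)) X1).
  assert (X2' := expdec_scal _ _ _ (/ e) X2). cbv beta in *.
  set (g := fun x => (K / 2) * (((e + / e) * (exp (INR 0 * (x - L)) * rgammaK N x)
     + - (2 / e) * (exp (INR m * (x - L)) * rgammaK N x)) + / e * (exp (INR (m + m) * (x - L)) * rgammaK N x))).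
  assert (Y01 := expdec_plus _ _ _ _ _ _ X0' X1'). assert (Y := expdec_plus _ _ _ _ _ _ Y01 X2').
  assert (Yg := expdec_scal _ _ _ (K / 2) Y). cbv beta in Y01, Y, Yg. fold g in Yg.
  assert (Ig : Iline g = K / 2 * (Gamma N * (e + (moment (m + m) n - 2 * moment m n + 1) / e))).
  { unfold g. rewrite (Iline_scal _ _ _ _ Y), (Iline_plus _ _ _ _ _ _ Y01 X2'), (Iline_plus _ _ _ _ _ _ X0' X1').
    rewrite (Iline_scal _ _ _ _ X0), (Iline_scal _ _ _ _ X1), (Iline_scal _ _ _ _ X2), I0, I1, I2.
    replace (moment 0 n) with 1.
    - field. lra.
    - unfold moment. simpl. fold N L. rewrite Rplus_0_r, Rmult_0_l, Ropp_0, exp_0. field. lra. }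
  rewrite Eg, Cmod_div by (apply Cmult_neq_0; trivial). rewrite Cmod_mult, Cmod_R, (Rabs_pos_eq (Gamma N)) by lra.
  assert (Hc0 : 0 < Cmod (cexp (w * L))) by (apply Cmod_gt_0; trivial).
  assert (Bh : forall x, Cmod (cexp (w * L) * h x)%C <= Cmod (cexp (w * L)) * g x).
  { intros x. rewrite Cmod_mult. apply Rmult_le_compat_l; [lra|].
    unfold h. rewrite Cmod_mult, Cmod_R.
    assert (Pr : 0 < rgammaK N x) by apply exp_pos. rewrite (Rabs_pos_eq (rgammaK N x)) by lra.
    assert (B1 := BK (x - L)).
    assert (B2 := exp_sub_one_mono (Re w) (INR m) (x - L) ltac:(lra)).
    set (y := exp (INR m * (x - L))) in *.
    assert (Ey : exp (INR (m + m) * (x - L)) = y * y).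
    { unfold y. rewrite <- exp_plus, plus_INR. f_equal. ring. }
    unfold g. fold y. rewrite Ey. simpl (INR 0). rewrite Rmult_0_l, exp_0.
    assert (B3 : Rabs (y - 1) <= (e + (y - 1) ^ 2 / e) / 2).
    { rewrite <- (pow2_abs (y - 1)). set (r := Rabs (y - 1)).
      apply Rmult_le_reg_r with (2 * e); [lra|].
      replace ((e + r ^ 2 / e) / 2 * (2 * e)) with (e * e + r ^ 2) by (field; lra).
      assert (0 <= (r - e) ^ 2) by apply pow2_ge_0. nra. }
    replace (K / 2 * ((e + / e) * (1 * rgammaK N x) + - (2 / e) * (y * rgammaK N x) + / e * (y * y * rgammaK N x)))
      with (K * ((e + (y - 1) ^ 2 / e) / 2) * rgammaK N x) by (field; lra).
    apply Rmult_le_compat_r; [lra|].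
    apply Rle_trans with (1 := B1). apply Rmult_le_compat_l; lra. }
  assert (Yg' := expdec_scal _ _ _ (Cmod (cexp (w * L))) Yg). cbv beta in Yg'.
  assert (HMh : exists M d, Cexpdec M d (fun x => cexp (w * L) * h x)%C).
  { do 2 eexists. split; [apply Yg'|split].
    - intros x. apply (Ccont_ext _ _ x Eh). apply Ccont_minus; [apply HM|apply HM''].
    - intros x. apply Rle_trans with (1 := Bh x). apply Rle_trans with (2 := proj2 (proj2 Yg') x). apply Rle_abs. }
  destruct HMh as [Mh [dh HMh]].
  assert (F := CIline_Cmod_le _ _ _ _ _ _ HMh Yg' Bh).
  rewrite (Iline_scal _ _ _ _ Yg), Ig in F.
  set (cc := Cmod (cexp (w * L))) in *.
  apply Rmult_le_reg_r with (Gamma N * cc); [apply Rmult_lt_0_compat; trivial|].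
  unfold Rdiv at 1. rewrite Rmult_assoc, Rinv_l, Rmult_1_r by (apply Rgt_not_eq, Rmult_lt_0_compat; trivial).
  apply Rle_trans with (1 := F). right. field. lra.
Qed.

Lemma gratio_lim w : 0 < Re w -> Clim (gratio w) 1%C.
Proof.
  intros Hw. destruct (gratio_bound w Hw) as [K [m [HK HB]]].
  apply Clim_Cmod. intros e He.
  (* For large [n] the second moment falls below [e'^2], so the bound of [gratio_bound] is at most
     [2 K e' < e]; [K + 1] avoids a division by zero. *)
  set (e' := e / (3 * (K + 1))). assert (He' : 0 < e') by (apply Rdiv_lt_0_compat; lra).
  assert (L : is_lim_seq (fun n => moment (m + m) n - 2 * moment m n + 1) 0).
  { replace (Finite 0) with (Finite (1 - 2 * 1 + 1)) by (f_equal; ring).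
    apply is_lim_seq_plus'; [|apply is_lim_seq_const].
    apply is_lim_seq_minus'; [apply moment_lim|].
    apply is_lim_seq_mult'; [apply is_lim_seq_const|apply moment_lim]. }
  apply is_lim_seq_spec in L. destruct (L (mkposreal (e' * e') ltac:(nra))) as [N HN]. simpl in HN.
  exists (S N). intros n Hn. specialize (HN n ltac:(lia)). rewrite Rminus_0_r in HN.
  apply Rle_lt_trans with (1 := HB e' n He' ltac:(lia)).
  apply Rabs_lt_between in HN.
  assert ((moment (m + m) n - 2 * moment m n + 1) / e' <= e').
  { apply Rmult_le_reg_r with e'; trivial. unfold Rdiv. rewrite Rmult_assoc, Rinv_l by lra. lra. }
  assert (E : e = e' * (3 * (K + 1))) by (unfold e'; field; lra).
  rewrite E. nra.
Qed.

(** * Finite products and the functional equation of the Gauss product *)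

Definition cprod (f : nat -> C) (n : nat) : C := Cprod (map f (seq 0 n)).

Lemma Cprod_app l l' : Cprod (l ++ l') = (Cprod l * Cprod l')%C.
Proof.
  unfold Cprod. induction l as [|a l IH]; simpl; [ring|]. rewrite IH. ring.
Qed.

Lemma cprod_0 f : cprod f 0 = 1%C.
Proof. reflexivity. Qed.

Lemma cprod_S f n : cprod f (S n) = (cprod f n * f n)%C.
Proof. unfold cprod. rewrite seq_S, map_app, Cprod_app. unfold Cprod at 2. simpl. ring. Qed.

Lemma cprod_head f n : cprod f (S n) = (f 0%nat * cprod (fun i => f (S i)) n)%C.
Proof. unfold cprod. simpl. rewrite <- seq_shift, map_map. reflexivity. Qed.

Lemma cprod_ext f g n : (forall i, (i < n)%nat -> f i = g i) -> cprod f n = cprod g n.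
Proof.
  intros H. induction n as [|n IH]; [reflexivity|].
  rewrite !cprod_S, IH, H by (auto; lia). reflexivity.
Qed.

Lemma cprod_mult f g n : cprod (fun i => f i * g i)%C n = (cprod f n * cprod g n)%C.
Proof.
  induction n as [|n IH]; [rewrite !cprod_0; ring|]. rewrite !cprod_S, IH. ring.
Qed.

Lemma cprod_rev f n : cprod (fun i => f (n - 1 - i)%nat) n = cprod f n.
Proof.
  induction n as [|n IH]; [reflexivity|].
  rewrite cprod_head, cprod_S, <- IH.
  replace (S n - 1 - 0)%nat with n by lia. rewrite Cmult_comm. f_equal.
  apply cprod_ext. intros i Hi. f_equal. lia.
Qed.

Lemma Clim_cprod (u : nat -> nat -> C) (l : nat -> C) q : (forall i, Clim (u i) (l i)) ->
  Clim (fun n => cprod (fun i => u i n) q) (cprod l q).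
Proof.
  intros H. induction q as [|q IH].
  - apply (Clim_ext_loc (fun _ => 1%C)); [exists 0%nat; reflexivity|]. apply Clim_const.
  - rewrite cprod_S. apply (Clim_ext_loc (fun n => cprod (fun i => u i n) q * u q n)%C).
    + exists 0%nat. intros n _. rewrite cprod_S. reflexivity.
    + apply Clim_mult; trivial.
Qed.

Lemma cprod_1 q : cprod (fun _ => 1%C) q = 1%C.
Proof. induction q as [|q IH]; [reflexivity|]. rewrite cprod_S, IH. ring. Qed.

Lemma cprod_cst c q : cprod (fun _ => c) q = (c ^ q)%C.
Proof. induction q as [|q IH]; [reflexivity|]. rewrite cprod_S, IH. simpl. ring. Qed.

Definition gprod (q : nat) (z : C) : C := cprod (fun i => CGamma (z + RtoC (INR i / INR q))%C) q.

Lemma INR_div_nonneg i q : (0 < q)%nat -> 0 <= INR i / INR q.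
Proof.
  intros Hq. apply Rmult_le_pos; [apply pos_INR|]. left; apply Rinv_0_lt_compat. apply lt_0_INR; trivial.
Qed.

(** The shift moves each factor to the next one and turns the last into
    [Gamma (z + 1) = z Gamma z]. *)
Lemma gprod_shift q z : (0 < q)%nat -> 0 < Re z ->
  gprod q (z + RtoC (1 / INR q))%C = (z * gprod q z)%C.
Proof.
  intros Hq Hz. destruct q as [|m]; [lia|]. assert (Hn := lt_0_INR _ Hq).
  unfold gprod. rewrite cprod_S, cprod_head.
  replace (z + RtoC (1 / INR (S m)) + RtoC (INR m / INR (S m)))%C with (z + 1)%C.
  - rewrite CGamma_succ by trivial.
    replace (z + RtoC (INR 0 / INR (S m)))%C with z.
    + rewrite (cprod_ext _ (fun i => CGamma (z + RtoC (INR (S i) / INR (S m))))%C); [ring|].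
      intros i _. f_equal. rewrite <- Cplus_assoc, <- RtoC_plus. do 2 f_equal. rewrite (S_INR i). field. lra.
    + replace (INR 0 / INR (S m)) with 0 by (simpl (INR 0); field; lra). ring.
  - rewrite <- Cplus_assoc, <- RtoC_plus. do 2 f_equal. rewrite (S_INR m) in *. field. lra.
Qed.

Definition rising (x : C) (n : nat) : C := cprod (fun j => x + RtoC (INR j))%C n.

Lemma CGamma_rising x n : 0 < Re x -> CGamma (x + RtoC (INR n))%C = (rising x n * CGamma x)%C.
Proof.
  intros Hx. induction n as [|n IH].
  - unfold rising. rewrite cprod_0. simpl (INR 0). rewrite Cplus_0_r. ring.
  - unfold rising in *. rewrite cprod_S, S_INR, RtoC_plus, Cplus_assoc.
    assert (Hn := pos_INR n).
    rewrite CGamma_succ by (simpl; unfold Re in *; lra). rewrite IH. ring.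
Qed.

(** The rising factorial of [q z] is the one in [CGamma_rising] at [q z]. Eliminating it between the
    two lets the ratio of the two sides of Gauss's formula be computed in the limit of large [n]. *)
Lemma gprod_rising q z n : (0 < q)%nat -> 0 < Re z ->
  (RtoC (INR q) ^ n * gprod q (z + RtoC (INR n / INR q)))%C = (rising (RtoC (INR q) * z) n * gprod q z)%C.
Proof.
  intros Hq Hz. assert (Hq0 := lt_0_INR _ Hq).
  induction n as [|n IH].
  - unfold rising. rewrite cprod_0. simpl (INR 0).
    replace (z + RtoC (0 / INR q))%C with z by (replace (0 / INR q) with 0 by (field; lra); ring).
    simpl. ring.
  - unfold rising in *. rewrite cprod_S.
    replace (z + RtoC (INR (S n) / INR q))%C with ((z + RtoC (INR n / INR q)) + RtoC (1 / INR q))%C.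
    + rewrite gprod_shift; trivial.
      * transitivity ((RtoC (INR q) * z + RtoC (INR n)) * (RtoC (INR q) ^ n * gprod q (z + RtoC (INR n / INR q))))%C.
        -- replace (RtoC (INR q) ^ S n)%C with (RtoC (INR q) * RtoC (INR q) ^ n)%C by reflexivity.
           assert (H0 : RtoC (INR q) <> 0) by (apply RtoC_neq_0; lra).
           rewrite (RtoC_div (INR n)) by lra. field. exact H0.
        -- rewrite IH. ring.
      * assert (H := INR_div_nonneg n q Hq). simpl. unfold Re in *. lra.
    + rewrite <- Cplus_assoc, <- RtoC_plus. do 2 f_equal. rewrite S_INR. field. lra.
Qed.

(** * Stirling's formula and the constant in Gauss's formula *)

(** At [1 / x] this reads [1 <= (x + 1/2) ln (1 + 1/x)], which makes [stirling] decrease along unit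
    steps; the companion upper bound makes the decrements summable by telescoping. *)
Lemma ln_one_add_lower x : 0 <= x -> 2 * x / (2 + x) <= ln (1 + x).
Proof.
  intros Hx. destruct (Req_dec x 0) as [E|E]; [subst; rewrite (Rplus_0_r 1), ln_1; right; field|].
  destruct (MVT_gen (fun x => ln (1 + x) - 2 * x / (2 + x)) 0 x (fun x => x ^ 2 / ((1 + x) * (2 + x) ^ 2))) as [c [Hc Hm]].
  - rewrite Rmin_left, Rmax_right by lra. intros y Hy. auto_derive; [lra|]. field; lra.
  - rewrite Rmin_left, Rmax_right by lra. intros y Hy. apply continuity_pt_filterlim.
    der_cont. lra.
  - rewrite Rmin_left, Rmax_right in Hc by lra.
    replace (ln (1 + 0) - 2 * 0 / (2 + 0)) with 0 in Hm by (rewrite (Rplus_0_r 1), ln_1; field).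
    assert (0 <= c ^ 2 / ((1 + c) * (2 + c) ^ 2)).
    { apply Rmult_le_pos; [apply pow2_ge_0|]. left; apply Rinv_0_lt_compat. nra. }
    assert (0 <= c ^ 2 / ((1 + c) * (2 + c) ^ 2) * (x - 0)) by (apply Rmult_le_pos; lra). lra.
Qed.

Lemma ln_one_add_upper x : 0 <= x -> ln (1 + x) <= x * (2 + x) / (2 * (1 + x)).
Proof.
  intros Hx. destruct (Req_dec x 0) as [E|E]; [subst; rewrite (Rplus_0_r 1), ln_1; right; field|].
  destruct (MVT_gen (fun x => x * (2 + x) / (2 * (1 + x)) - ln (1 + x)) 0 x (fun x => x ^ 2 / (2 * (1 + x) ^ 2))) as [c [Hc Hm]].
  - rewrite Rmin_left, Rmax_right by lra. intros y Hy. auto_derive; [lra|]. field; lra.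
  - rewrite Rmin_left, Rmax_right by lra. intros y Hy. apply continuity_pt_filterlim.
    der_cont. lra.
  - rewrite Rmin_left, Rmax_right in Hc by lra.
    replace (0 * (2 + 0) / (2 * (1 + 0)) - ln (1 + 0)) with 0 in Hm by (rewrite (Rplus_0_r 1), ln_1; field).
    assert (0 <= c ^ 2 / (2 * (1 + c) ^ 2)).
    { apply Rmult_le_pos; [apply pow2_ge_0|]. left; apply Rinv_0_lt_compat. nra. }
    assert (0 <= c ^ 2 / (2 * (1 + c) ^ 2) * (x - 0)) by (apply Rmult_le_pos; lra). lra.
Qed.

(** The logarithm of the quotient of [Gamma x] by [x^(x - 1/2) exp (- x)]. *)
Definition stirling (x : R) : R := ln (Gamma x) + x - (x - 1 / 2) * ln x.

Lemma stirling_step x : 1 <= x ->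
  - (1 / 4 * (/ x - / (x + 1))) <= stirling (x + 1) - stirling x <= 0.
Proof.
  intros Hx. unfold stirling. rewrite Gamma_succ, ln_mult by (try apply Gamma_pos; lra).
  assert (E : ln (x + 1) = ln x + ln (1 + / x)).
  { rewrite <- ln_mult by (try apply Rplus_lt_0_compat; try apply Rinv_0_lt_compat; lra). f_equal. field. lra. }
  rewrite E. assert (Hi : 0 < / x) by (apply Rinv_0_lt_compat; lra).
  assert (H1 := ln_one_add_lower (/ x) ltac:(lra)). assert (H2 := ln_one_add_upper (/ x) ltac:(lra)).
  replace (2 * / x / (2 + / x)) with (/ (x + 1 / 2)) in H1 by (field; lra).
  assert (H1' := Rmult_le_compat_l (x + 1 / 2) _ _ ltac:(lra) H1). rewrite Rinv_r in H1' by lra.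
  assert (H2' := Rmult_le_compat_l (x + 1 / 2) _ _ ltac:(lra) H2).
  replace ((x + 1 / 2) * (/ x * (2 + / x) / (2 * (1 + / x)))) with (1 + 1 / 4 * (/ x - / (x + 1))) in H2' by (field; lra).
  replace (x + 1 - 1 / 2) with (x + 1 / 2) by field.
  split; lra.
Qed.

Lemma stirling_cv : exists A : R, is_lim_seq (fun n => stirling (INR n)) A.
Proof.
  assert (X : ex_finite_lim_seq (fun n => stirling (INR (S n)))).
  (* The decrements are at most [1/4 (1/k - 1/(k+1))], which sum to [1/4]; the induction below
     carries the telescoped remainder. *)
  { apply (ex_finite_lim_seq_decr _ (stirling 1 - 1 / 4)).
    - intros n. assert (H := pos_INR n). rewrite (S_INR (S n)).
      assert (K := stirling_step (INR (S n)) ltac:(rewrite S_INR; lra)). lra.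
    - assert (K : forall n, stirling 1 - 1 / 4 + 1 / 4 * / INR (S n) <= stirling (INR (S n))).
      { induction n as [|n IH].
        - simpl (INR 1). lra.
        - rewrite (S_INR (S n)). assert (Hn := pos_INR n).
          assert (Z := stirling_step (INR (S n)) ltac:(rewrite S_INR; lra)). lra. }
      intros n. specialize (K n). assert (0 < / INR (S n)) by (apply Rinv_0_lt_compat, lt_0_INR; lia). lra. }
  destruct X as [A HA]. exists A. apply (is_lim_seq_incr_1 (fun n => stirling (INR n))). exact HA.
Qed.

Lemma cprod_cexp_arith (z : C) (q : R) (l : C) k : q <> 0 ->
  cprod (fun i => cexp ((z + RtoC (INR i / q)) * l)%C) k =
  cexp ((RtoC (INR k) * z + RtoC (INR k * (INR k - 1) / 2 / q)) * l)%C.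
Proof.
  intros Hq. induction k as [|k IH].
  - rewrite cprod_0. simpl (INR 0). rewrite <- cexp_0. f_equal.
    replace (0 * (0 - 1) / 2 / q) with 0 by (field; trivial). ring.
  - rewrite cprod_S, IH, <- cexp_plus. f_equal. rewrite S_INR.
    replace ((INR k + 1) * (INR k + 1 - 1) / 2 / q) with (INR k * (INR k - 1) / 2 / q + INR k / q) by (field; trivial).
    rewrite !RtoC_plus. ring.
Qed.

(** An exact identity, by the definition of [gratio]; the powers [n^(i/q)] of the factors multiply
    to [n^((q-1)/2)]. *)
Lemma gprod_gratio q z n : (0 < q)%nat -> 0 < Re z -> (1 <= n)%nat ->
  gprod q (z + RtoC (INR n))%C =
  (RtoC (Gamma (INR n) ^ q * exp ((INR q - 1) / 2 * ln (INR n)))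
   * cexp (RtoC (INR q) * z * RtoC (ln (INR n)))
   * cprod (fun i => gratio (z + RtoC (INR i / INR q)) n) q)%C.
Proof.
  intros Hq Hz Hn. assert (Hq0 := lt_0_INR _ Hq). apply le_INR in Hn. simpl in Hn.
  assert (HG := Gamma_pos (INR n) ltac:(lra)). assert (HGC := RtoC_neq_0 _ (Rgt_not_eq _ _ HG)).
  unfold gprod.
  rewrite (cprod_ext _ (fun i => (gratio (z + RtoC (INR i / INR q)) n) *
    (RtoC (Gamma (INR n)) * cexp ((z + RtoC (INR i / INR q)) * RtoC (ln (INR n)))))%C).
  - rewrite cprod_mult, cprod_mult, cprod_cst, cprod_cexp_arith by lra.
    replace (INR q * (INR q - 1) / 2 / INR q) with ((INR q - 1) / 2) by (field; lra).
    rewrite Cmult_plus_distr_r, cexp_plus, <- RtoC_mult, cexp_RtoC, RtoC_mult, RtoC_pow. ring.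
  - intros i _. unfold gratio.
    replace (z + RtoC (INR n) + RtoC (INR i / INR q))%C with (z + RtoC (INR i / INR q) + RtoC (INR n))%C by ring.
    field. split; [apply cexp_neq_0|trivial].
Qed.

(** The logarithm of this sequence is [q stirling(n) - stirling(q n) + (ln q) / 2], because all
    growing terms cancel. *)
Lemma stirling_const_ratio (A : R) q : (0 < q)%nat -> is_lim_seq (fun n => stirling (INR n)) A ->
  is_lim_seq (fun n => INR q ^ (q * n) * (Gamma (INR n) ^ q * exp ((INR q - 1) / 2 * ln (INR n)))
                       / Gamma (INR (q * n)))
    (exp ((INR q - 1) * A + 1 / 2 * ln (INR q))).
Proof.
  intros Hq HA. assert (Hq0 := lt_0_INR _ Hq).
  apply (is_lim_seq_ext_loc (fun n => exp (INR q * stirling (INR n) - stirling (INR (q * n)) + 1 / 2 * ln (INR q)))).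
  - exists 1%nat. intros n Hn. apply le_INR in Hn. simpl in Hn.
    assert (HG := Gamma_pos (INR n) ltac:(lra)).
    assert (Hqn : 0 < INR (q * n)) by (rewrite mult_INR; nra).
    assert (HG2 := Gamma_pos (INR (q * n)) Hqn).
    assert (Pw : forall x k, 0 < x -> x ^ k = exp (INR k * ln x)).
    { intros x k Hx. rewrite <- Rpower_pow by trivial. reflexivity. }
    rewrite (Pw (INR q)), (Pw (Gamma (INR n))) by trivial.
    rewrite <- (exp_ln (Gamma (INR (q * n)))) at 1 by trivial.
    unfold Rdiv at 2. rewrite <- exp_Ropp, <- !exp_plus. f_equal.
    unfold stirling. rewrite !mult_INR, ln_mult by lra. field.
  - apply (is_lim_seq_continuous exp _ ((INR q - 1) * A + 1 / 2 * ln (INR q))).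
    + apply derivable_continuous_pt, derivable_pt_exp.
    + apply is_lim_seq_plus'; [|apply is_lim_seq_const].
      replace ((INR q - 1) * A) with (INR q * A - A) by ring.
      apply is_lim_seq_minus'.
      * apply is_lim_seq_mult'; [apply is_lim_seq_const|trivial].
      * apply (is_lim_seq_subseq (fun n => stirling (INR n)) A (fun n => (q * n)%nat)); trivial.
        apply eventually_subseq. intros n. lia.
Qed.

(** One sequence, two limits. Eliminating the rising factorial of length [q n] between
    [gprod_rising] and [CGamma_rising] expresses [gratio (q z) (q n)] through the ratios
    [gratio (z + i/q) n], all of which tend to 1; the real prefactor converges by
    [stirling_const_ratio]. *)
Lemma gauss_multiplication_stirling (A : R) q z : (0 < q)%nat -> 0 < Re z ->
  is_lim_seq (fun n => stirling (INR n)) A ->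
  (cexp (RtoC (INR q) * z * RtoC (ln (INR q))) * gprod q z)%C =
  (RtoC (exp ((INR q - 1) * A + 1 / 2 * ln (INR q))) * CGamma (RtoC (INR q) * z))%C.
Proof.
  intros Hq Hz HA. assert (Hq0 := lt_0_INR _ Hq).
  assert (Hqz : 0 < Re (RtoC (INR q) * z)%C) by (simpl; unfold Re in *; nra).
  set (qz := (RtoC (INR q) * z)%C) in *.
  set (rho := fun n => INR q ^ (q * n) * (Gamma (INR n) ^ q * exp ((INR q - 1) / 2 * ln (INR n)))
                       / Gamma (INR (q * n))).
  assert (L1 : Clim (fun n => RtoC (rho n) * cprod (fun i => gratio (z + RtoC (INR i / INR q)) n) q * CGamma qz)%C
     (RtoC (exp ((INR q - 1) * A + 1 / 2 * ln (INR q))) * 1 * CGamma qz)%C).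
  { apply Clim_mult; [|apply Clim_const]. apply Clim_mult.
    - apply Clim_RtoC, stirling_const_ratio; trivial.
    - rewrite <- (cprod_1 q). apply (Clim_cprod (fun i n => gratio (z + RtoC (INR i / INR q)) n)%C).
      intros i. apply gratio_lim. assert (H := INR_div_nonneg i q Hq). simpl. unfold Re in *. lra. }
  assert (L2 : Clim (fun n => gratio qz (q * n) * (cexp (qz * RtoC (ln (INR q))) * gprod q z))%C
     (1 * (cexp (qz * RtoC (ln (INR q))) * gprod q z))%C).
  { apply Clim_mult; [|apply Clim_const].
    apply (Clim_comp (gratio qz) 1%C (fun n => (q * n)%nat)); [|apply gratio_lim; trivial].
    apply eventually_subseq. intros n. lia. }
  apply (Clim_ext_loc _ (fun n => gratio qz (q * n) * (cexp (qz * RtoC (ln (INR q))) * gprod q z))%C) in L1.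
  - assert (U := Clim_unique _ _ _ L1 L2). rewrite Cmult_1_r, Cmult_1_l in U. symmetry. exact U.
  - exists 1%nat. intros n Hn.
    assert (E1 := gprod_rising q z (q * n) Hq Hz).
    replace (INR (q * n) / INR q) with (INR n) in E1 by (rewrite mult_INR; field; lra).
    rewrite gprod_gratio in E1 by trivial. fold qz in E1.
    assert (E2 := CGamma_rising qz (q * n) Hqz).
    apply le_INR in Hn. simpl in Hn.
    assert (Hqn : 0 < INR (q * n)) by (rewrite mult_INR; nra).
    assert (HG2 := RtoC_neq_0 _ (Rgt_not_eq _ _ (Gamma_pos (INR (q * n)) Hqn))).
    assert (Hc1 := cexp_neq_0 (qz * RtoC (ln (INR n)))%C).
    assert (Hc2 := cexp_neq_0 (qz * RtoC (ln (INR q)))%C).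
    unfold gratio at 2. rewrite E2.
    replace (ln (INR (q * n))) with (ln (INR q) + ln (INR n)) by (rewrite mult_INR, ln_mult; lra).
    rewrite RtoC_plus, Cmult_plus_distr_l, cexp_plus.
    unfold rho. rewrite RtoC_div, RtoC_mult, RtoC_pow by (apply Rgt_not_eq, Gamma_pos; trivial).
    set (P := cprod _ q) in *. set (X := RtoC (_ ^ q * _)) in *.
    transitivity (RtoC (INR q) ^ (q * n) * (X * cexp (qz * RtoC (ln (INR n))) * P) * CGamma qz
       / (RtoC (Gamma (INR (q * n))) * cexp (qz * RtoC (ln (INR n)))))%C.
    + field. split; trivial.
    + rewrite E1. field. repeat split; trivial.
Qed.

(** At [q = 2], [z = 1/2] the multiplication formula contains only [Gamma (1/2)] and [Gamma 1], and
    reflection gives [Gamma (1/2)^2 = pi]; squaring leaves an equation for [A]. *)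
Lemma stirling_limit (A : R) : is_lim_seq (fun n => stirling (INR n)) A -> A = 1 / 2 * ln (2 * PI).
Proof.
  intros HA. assert (P := PI_RGT_0).
  assert (H2 : 0 < Re (RtoC (1 / 2))) by (simpl; lra).
  assert (E := gauss_multiplication_stirling A 2 (RtoC (1 / 2)) ltac:(lia) H2 HA).
  unfold gprod in E. rewrite !cprod_S, cprod_0 in E. simpl (INR 2) in E. simpl (INR 0) in E. simpl (INR 1) in E.
  rewrite <- !RtoC_plus, <- !RtoC_mult, cexp_RtoC in E.
  replace ((1 + 1) * (1 / 2)) with 1 in E by field.
  replace (1 / 2 + 0 / (1 + 1)) with (1 / 2) in E by field.
  replace (1 / 2 + 1 / (1 + 1)) with 1 in E by field.
  rewrite !CGamma_RtoC, Gamma_1, <- !RtoC_mult in E by lra. apply RtoC_inj in E.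
  replace (1 + 1) with 2 in E by ring.
  rewrite !Rmult_1_l, !Rmult_1_r, exp_ln in E by lra.
  assert (R := CGamma_reflection (RtoC (1 / 2)) ltac:(simpl; lra)).
  rewrite <- RtoC_minus, <- RtoC_mult in R. replace (1 - 1 / 2) with (1 / 2) in R by field.
  rewrite csin_RtoC, CGamma_RtoC, <- !RtoC_mult in R by lra. apply RtoC_inj in R.
  replace (1 / 2 * PI) with (PI / 2) in R by field. rewrite sin_PI2, Rmult_1_l in R.
  apply (f_equal (fun x => ln (x * x))) in E.
  replace (2 * Gamma (1 / 2) * (2 * Gamma (1 / 2))) with (2 * (2 * (Gamma (1 / 2) * Gamma (1 / 2)))) in E by ring.
  rewrite R, <- exp_plus, ln_exp, ln_mult in E by lra.
  replace (2 - 1) with 1 in E by ring. lra.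
Qed.

Lemma gauss_multiplication q z : (0 < q)%nat -> 0 < Re z ->
  (cexp (RtoC (INR q) * z * RtoC (ln (INR q))) * gprod q z)%C =
  (RtoC (exp ((INR q - 1) / 2 * ln (2 * PI) + 1 / 2 * ln (INR q))) * CGamma (RtoC (INR q) * z))%C.
Proof.
  intros Hq Hz. destruct stirling_cv as [A HA].
  rewrite (gauss_multiplication_stirling A q z Hq Hz HA), (stirling_limit A HA).
  do 3 f_equal. field.
Qed.

(** * Mellin-Barnes integrals *)

Definition vline (c t : R) : C := (c, t).

(** With [w = P s], [2 i sin (pi w) = exp (i pi w) (1 - exp (- 2 i pi w))]. On the line,
    [- 2 i pi w] has real part [2 pi P t] and imaginary part [- 2 pi P c]; writing the sign as
    [exp (- i pi)] gives a logistic denominator at height [- (2 pi P c + pi)], which lies in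
    [(- pi, pi)] exactly when [-1 < P c < 0]. The power [exp (- w y)] moves into the parameter of
    the logistic integrand. *)
Lemma sine_kernel_logistic P c y t : -1 < P * c < 0 ->
  csin (P * vline c t * PI)%C <> 0 /\
  (RtoC PI / csin (RtoC P * vline c t * RtoC PI) * cexp (- (RtoC P * vline c t * RtoC y)))%C =
  (RtoC (- (2 * PI) * exp (y / 2))
   * logisticF (RtoC (1 / 2) - Ci * RtoC (y / (2 * PI))) (2 * PI * P * t) (- (2 * PI * (P * c) + PI)))%C.
Proof.
  intros HP. assert (Ppos := PI_RGT_0).
  set (th := - (2 * PI * (P * c) + PI)).
  assert (Hth : - PI < th < PI) by (unfold th; nra).
  assert (HA := logisticA_neq_0 (2 * PI * P * t) th Hth).
  set (w := (P * vline c t)%C).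
  set (e1 := cexp (Ci * (w * PI))%C). assert (He1 : e1 <> 0) by apply cexp_neq_0.
  assert (Z : (RtoC (2 * PI * P * t) + Ci * th)%C = (- (Ci * (w * PI)) + (- (Ci * (w * PI)) + Ci * RtoC (- PI)))%C).
  { unfold w, vline, th. apply C_ext; simpl; ring. }
  assert (EP : cexp (Ci * RtoC (- PI))%C = (- (1))%C).
  { rewrite cexp_Ci, cos_neg, sin_neg, cos_PI, sin_PI. apply C_ext; simpl; ring. }
  assert (EA : logisticA (2 * PI * P * t) th = (2 * Ci * csin (w * PI) / e1)%C).
  { unfold logisticA. rewrite Z, !cexp_plus, EP, cexp_opp. fold e1.
    unfold csin. rewrite cexp_opp. fold e1. field. split; trivial; apply Ci_nz. }
  assert (HS : csin (w * PI)%C <> 0).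
  { intros K. apply HA. rewrite EA, K. field. trivial. }
  split; trivial.
  unfold logisticF. rewrite EA.
  replace ((RtoC (1 / 2) - Ci * RtoC (y / (2 * PI))) * (RtoC (2 * PI * P * t) + Ci * th))%C
    with (- (Ci * (w * PI)) + ((Ci * RtoC (- (PI / 2))) + (RtoC (- (y / 2)) + - (w * y))))%C.
  - rewrite !cexp_plus, cexp_RtoC, (cexp_opp (Ci * _)). fold e1.
    replace (cexp (Ci * RtoC (- (PI / 2)))) with (- Ci)%C
      by (rewrite cexp_Ci, cos_neg, sin_neg, cos_PI2, sin_PI2; apply C_ext; simpl; ring).
    assert (E2 : (RtoC (exp (y / 2)) * RtoC (exp (- (y / 2))))%C = 1%C).
    { rewrite <- RtoC_mult, <- exp_plus, Rplus_opp_r, exp_0. reflexivity. }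
    transitivity (PI / csin (w * PI) * (RtoC (exp (y / 2)) * RtoC (exp (- (y / 2)))) * cexp (- (w * y)))%C.
    + rewrite E2. ring.
    + replace (- (2 * PI) * exp (y / 2)) with (-2 * (PI * exp (y / 2))) by ring.
      rewrite !RtoC_mult. field. repeat split; trivial. apply Ci_nz.
  - unfold w, vline, th. apply C_ext; simpl; field; lra.
Qed.

Lemma vline_cont c t : Ccont (vline c) t.
Proof. split; [apply continuous_const|apply continuous_id]. Qed.

Definition sineK (P c t : R) : C := (PI / csin (P * vline c t * PI))%C.

Lemma sineK_cont P c t : -1 < P * c < 0 -> Ccont (sineK P c) t.
Proof.
  intros HP. apply Ccont_div; [apply Ccont_const| |apply (sine_kernel_logistic P c 0 t HP)].
  apply (csin_cont (fun t => RtoC P * vline c t * PI)%C). Ccont_auto. apply vline_cont.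
Qed.

(** The logistic integral is taken at [z = 1/2 - i y / (2 pi)], where [sin (pi z)] is the hyperbolic
    cosine of [y / 2]; below, [h] is [exp (y / 2)]. *)
Lemma sineK_Cexpdec P c y : 0 < P -> -1 < P * c < 0 ->
  (exists M d, Cexpdec M d (fun t => sineK P c t * cexp (- (RtoC P * vline c t * RtoC y)))%C) /\
  CIline (fun t => sineK P c t * cexp (- (P * vline c t * y)))%C =
  RtoC (- (2 * PI / P) * / (1 + exp (- y))).
Proof.
  intros HP0 HP. assert (Ppos := PI_RGT_0).
  set (th := - (2 * PI * (P * c) + PI)).
  assert (Hth : - PI < th < PI) by (unfold th; nra).
  set (z := (RtoC (1 / 2) - Ci * RtoC (y / (2 * PI)))%C).
  assert (Rz : Re z = 1 / 2) by (unfold z; simpl; ring).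
  assert (Hz : 0 < Re z < 1) by lra.
  destruct (logisticF_Cexpdec z th Hz Hth) as [M [d HM]].
  assert (Hb : 0 < 2 * PI * P) by nra.
  assert (HMa := Cexpdec_affine _ _ _ (2 * PI * P) 0 ltac:(lra) HM).
  assert (Em : forall t, (sineK P c t * cexp (- (P * vline c t * y)))%C =
    (RtoC (- (2 * PI) * exp (y / 2)) * (fun x => logisticF z (2 * PI * P * x + 0) th) t)%C).
  { intros t. rewrite Rplus_0_r. apply sine_kernel_logistic; trivial. }
  rewrite (functional_extensionality _ _ Em). split.
  - do 2 eexists. apply Cexpdec_scal. exact HMa.
  - rewrite (CIline_scal _ _ _ _ HMa).
    rewrite (CIline_affine _ _ (fun x => logisticF z x th) (2 * PI * P) 0 Hb HM).
    rewrite logistic_shift by trivial.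
    assert (E := csin_logistic z Hz).
    set (h := exp (y / 2)). assert (Hh : 0 < h) by apply exp_pos.
    assert (Es : csin (z * PI)%C = RtoC ((h + / h) / 2)).
    { unfold csin.
      replace (Ci * (z * PI))%C with (Ci * RtoC (PI / 2) + RtoC (y / 2))%C
        by (unfold z; apply C_ext; simpl; field; lra).
      rewrite cexp_opp, cexp_plus, cexp_RtoC, cexp_Ci, cos_PI2, sin_PI2. fold h.
      change (0, 1) with Ci.
      assert (Hc : RtoC h <> 0) by (apply RtoC_neq_0; lra).
      rewrite RtoC_div, RtoC_plus, RtoC_inv by lra.
      assert (Ic : (/ Ci)%C = (- Ci)%C).
      { apply C_ext; simpl; field. }
      transitivity ((Ci * h - / Ci * / h) / (2 * Ci))%C.
      - field. split; trivial; apply Ci_nz.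
      - rewrite Ic. field. split; trivial; apply Ci_nz. }
    rewrite Es in E.
    assert (Hq : (h + / h) / 2 <> 0) by (assert (0 < / h) by (apply Rinv_0_lt_compat; trivial); lra).
    assert (EJ : CIline (logisticK z) = RtoC (PI / ((h + / h) / 2))).
    { rewrite RtoC_div, <- E by trivial. field. apply RtoC_neq_0; trivial. }
    rewrite EJ, <- RtoC_div, <- RtoC_mult by lra. f_equal.
    replace (exp (- y)) with (/ h * / h).
    + assert (0 < / h) by (apply Rinv_0_lt_compat; trivial). field. repeat split; try lra; nra.
    + unfold h. rewrite <- !exp_Ropp, <- exp_plus. f_equal. field.
Qed.

(** For complex [l] no real translation reduces this to [Gamma 1], so the antiderivative
    [- exp (- l exp v) / l] is evaluated at both ends instead. *)
Lemma CIline_exp_kernel (l : C) : 0 < Re l ->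
  (exists M, 0 <= M /\ Cexpdec M 1 (fun v => cexp (v - l * RtoC (exp v))%C)) /\
  CIline (fun v => cexp (v - l * RtoC (exp v))%C) = (/ l)%C.
Proof.
  intros Hl.
  assert (Hl0 : l <> 0) by (intros K; rewrite K in Hl; simpl in Hl; lra).
  destruct (exp_kernel_decay 1 (Re l) Rlt_0_1 Hl) as [M [HM B]].
  assert (Cm : forall v, Cmod (cexp (RtoC v - l * RtoC (exp v))%C) = exp (1 * v - Re l * exp v)).
  { intros v. rewrite Cmod_cexp. f_equal. simpl. unfold Re; ring. }
  assert (HE : Cexpdec M 1 (fun v => cexp (v - l * RtoC (exp v))%C)).
  { split; [lra|split].
    - intros v. Ccont_auto.
    - intros v. rewrite Cm. apply B. }
  split; [exists M; split; trivial|].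
  set (F := fun v => (- (cexp (- (l * RtoC (exp v))) / l))%C).
  assert (DF : forall v, is_Cder F v (cexp (v - l * RtoC (exp v))%C)).
  { intros v.
    assert (D1 : is_Cder (fun v => - (l * RtoC (exp v)))%C v (- (l * RtoC (exp v)))%C).
    { destruct l as [l1 l2]. split; simpl; auto_derive; trivial; ring. }
    apply is_Cder_cexp in D1.
    assert (D2 := is_Cder_mult (fun _ => (- / l)%C) _ v 0%C _ (is_Cder_const _ v) D1).
    apply (is_Cder_eq _ _ _ (cexp (v - l * RtoC (exp v))%C)) in D2.
    - replace F with (fun u => (- / l) * cexp (- (l * RtoC (exp u))))%C; [exact D2|].
      extensionality u. unfold F. field. trivial.
    - unfold Cminus. rewrite cexp_plus, cexp_RtoC. field. trivial. }
  (* Since [F v = F0 (exp v)], the limit of [F] at minus infinity is [F0 0 = - 1 / l]. *)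
  set (F0 := fun y : R => (- (cexp (- (l * y)) / l))%C).
  assert (C0 : Ccont F0 0).
  { unfold F0. Ccont_auto. }
  assert (V0 : F0 0 = (- / l)%C).
  { unfold F0. rewrite Cmult_0_r. replace (- 0)%C with (RtoC 0) by ring. rewrite cexp_0. field. trivial. }
  assert (BF : forall v, Cmod (F v) <= / Cmod l * exp (- Re l * exp v)).
  { intros v. unfold F. rewrite Cmod_opp, Cmod_div, Cmod_cexp by trivial. right. unfold Rdiv. rewrite Rmult_comm.
    do 2 f_equal. simpl. unfold Re; ring. }
  assert (LB : filterlim (fun v => / Cmod l * exp (- Re l * exp v)) (Rbar_locally p_infty) (locally 0)).
  { replace 0 with (/ Cmod l * 0) by ring.
    apply (filterlim_comp _ _ _ (fun v => exp (- Re l * exp v)) (fun y => / Cmod l * y) _ (locally 0)).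
    - apply (filterlim_comp _ _ _ (fun v => - Re l * exp v) exp _ (Rbar_locally m_infty)); [|apply is_lim_exp_m].
      assert (X : is_lim (fun v => - Re l * exp v) p_infty m_infty).
      { replace m_infty with (Rbar_mult (- Re l) p_infty).
        - apply is_lim_scal_l, is_lim_exp_p.
        - simpl. destruct (Rle_dec 0 (- Re l)); [exfalso; lra|reflexivity]. }
      exact X.
    - der_cont. }
  assert (Gen : forall p : C -> R, (forall z, Rabs (p z) <= Cmod z) ->
     filterlim (fun v => p (F v)) (Rbar_locally p_infty) (locally 0)).
  { intros p Hp. apply filterlim_locally. intros e.
    assert (X := proj1 (filterlim_locally _ _) LB e). revert X. apply filter_imp. intros v Hv.
    change (Rabs (/ Cmod l * exp (- Re l * exp v) - 0) < e) in Hv. change (Rabs (p (F v) - 0) < e).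
    rewrite Rminus_0_r in *. apply Rle_lt_trans with (1 := Hp _). apply Rle_lt_trans with (1 := BF v).
    apply Rle_lt_trans with (2 := Hv). apply Rle_abs. }
  destruct C0 as [C0r C0i].
  apply C_ext.
  - apply (eq_trans (Iline_derive M 1 _ (fun v => Re (F v)) (Cexpdec_Re _ _ _ HE) (fun v => proj1 (DF v))
      (Re (F0 0)) 0 (filterlim_comp _ _ _ exp (fun y => Re (F0 y)) _ (locally 0) _ is_lim_exp_m C0r)
      (Gen Re Re_le_Cmod))).
    rewrite V0. simpl. unfold Rminus. rewrite Rplus_0_l, Ropp_involutive. reflexivity.
  - apply (eq_trans (Iline_derive M 1 _ (fun v => Im (F v)) (Cexpdec_Im _ _ _ HE) (fun v => proj2 (DF v))
      (Im (F0 0)) 0 (filterlim_comp _ _ _ exp (fun y => Im (F0 y)) _ (locally 0) _ is_lim_exp_m C0i)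
      (Gen Im Im_le_Cmod))).
    rewrite V0. simpl. unfold Rminus. rewrite Rplus_0_l, Ropp_involutive. reflexivity.
Qed.

(** In [y = exp v] the integrand is [1 / (1 + exp (y - Y))] on [y > 0], the derivative of
    [- ln (1 + exp (Y - y))]. This is where the logarithm in [mellin_log] comes from. *)
Lemma Iline_softplus Y :
  (exists M, expdec M 1 (fun v => exp v * / (1 + exp (exp v - Y)))) /\
  Iline (fun v => exp v * / (1 + exp (exp v - Y))) = ln (1 + exp Y).
Proof.
  destruct (exp_kernel_decay 1 1 Rlt_0_1 Rlt_0_1) as [M [HM B]].
  assert (HE : expdec (exp Y * M) 1 (fun v => exp v * / (1 + exp (exp v - Y)))).
  { split; [lra|split].
    - intros v. der_cont. assert (H := exp_pos (exp v - Y)). unfold Rminus in *. lra.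
    - intros v. assert (H := exp_pos (exp v - Y)). assert (Hv := exp_pos v).
      rewrite Rabs_pos_eq by (apply Rmult_le_pos; [lra|left; apply Rinv_0_lt_compat; lra]).
      apply Rle_trans with (exp Y * exp (1 * v - 1 * exp v)).
      + replace (exp Y * exp (1 * v - 1 * exp v)) with (exp v * / exp (exp v - Y)).
        * apply Rmult_le_compat_l; [lra|]. apply Rinv_le_contravar; lra.
        * rewrite <- exp_Ropp, <- !exp_plus. f_equal. ring.
      + rewrite Rmult_assoc. apply Rmult_le_compat_l; [left; apply exp_pos|]. apply B. }
  split; [eexists; exact HE|].
  assert (Q : forall y, 0 < 1 + exp (Y - y)) by (intros y; assert (H := exp_pos (Y - y)); lra).
  rewrite (Iline_derive _ _ _ (fun v => - ln (1 + exp (Y - exp v))) HE) with (la := - ln (1 + exp (Y - 0))) (lb := 0).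
  - rewrite Rminus_0_r. ring.
  - intros v. assert (H := Q (exp v)). auto_derive; [unfold Rminus in H; lra|].
    replace (exp v - Y) with (- (Y - exp v)) by ring. rewrite exp_Ropp.
    unfold Rminus in *. assert (X := exp_pos (Y + - exp v)). field. lra.
  - apply (filterlim_comp _ _ _ exp (fun y => - ln (1 + exp (Y - y))) _ (locally 0)).
    + apply is_lim_exp_m.
    + der_cont.
      assert (H := Q 0). unfold Rminus in H. lra.
  - replace 0 with (- ln (1 + 0)) by (rewrite Rplus_0_r, ln_1; ring).
    apply (filterlim_comp _ _ _ (fun v => exp (Y - exp v)) (fun y => - ln (1 + y)) _ (locally 0)).
    + apply (filterlim_comp _ _ _ (fun v => Y - exp v) exp _ (Rbar_locally m_infty)); [|apply is_lim_exp_m].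
      assert (X : is_lim (fun v => Y - exp v) p_infty m_infty).
      { apply (is_lim_minus (fun _ => Y) exp p_infty Y p_infty); [apply is_lim_const|apply is_lim_exp_p|reflexivity]. }
      exact X.
    + der_cont. lra.
Qed.

Lemma vline_neq_0 c t : c <> 0 -> vline c t <> 0.
Proof. intros Hc K. apply (f_equal Re) in K. simpl in K. lra. Qed.

Lemma mellin_log_Cexpdec P c Y : 0 < P -> -1 < P * c < 0 -> exists M d,
  Cexpdec M d (fun t => sineK P c t / vline c t * cexp (- (RtoC P * vline c t * RtoC Y)))%C.
Proof.
  intros HP0 HP. assert (Hc : c < 0) by nra.
  destruct (sineK_Cexpdec P c Y HP0 HP) as [[M [d HM]] _].
  exists (M / Rabs c), d. split; [apply HM|split].
    - intros t. apply Ccont_mult.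
      + apply Ccont_div; [apply sineK_cont; trivial|apply vline_cont|apply vline_neq_0; lra].
      + Ccont_auto. apply vline_cont.
    - intros t. assert (Hv := vline_neq_0 c t ltac:(lra)).
      replace (sineK P c t / vline c t * cexp (- (P * vline c t * Y)))%C
        with (sineK P c t * cexp (- (P * vline c t * Y)) / vline c t)%C by (field; trivial).
      rewrite Cmod_div by trivial.
      assert (H1 := Re_le_Cmod (vline c t)). simpl in H1.
      assert (Hc0 : 0 < Rabs c) by (apply Rabs_pos_lt; lra).
      replace (M / Rabs c * exp (- d * Rabs t)) with ((M * exp (- d * Rabs t)) * / Rabs c) by (field; lra).
      apply Rmult_le_compat; [apply Cmod_ge_0| |apply HM|apply Rinv_le_contravar; lra].
      left; apply Rinv_0_lt_compat. lra.
Qed.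

(* Inverse Mellin transform of [PI / (w sin (PI w))]: the factor [/ s] is itself written as
   an integral, which reduces everything to [sineK_Cexpdec]. *)
Lemma mellin_log P c Y : 0 < P -> -1 < P * c < 0 ->
  CIline (fun t => sineK P c t / vline c t * cexp (- (RtoC P * vline c t * RtoC Y)))%C =
  RtoC (2 * PI * ln (1 + exp Y)).
Proof.
  intros HP0 HP. assert (Hc : c < 0) by nra.
  set (h := fun t v => (sineK P c t * cexp (- (P * vline c t * Y))
       * cexp (RtoC v - (- (RtoC P * vline c t)) * RtoC (exp v)))%C).
  destruct (sineK_Cexpdec P c Y HP0 HP) as [[M [d HM]] _].
  assert (Rl : forall t, Re (- (P * vline c t))%C = - (P * c)) by (intros; unfold vline; simpl; ring).
  assert (Hl : 0 < - (P * c)) by lra.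
  destruct (exp_kernel_decay 1 (- (P * c)) Rlt_0_1 Hl) as [M2 [HM2 B2]].
  assert (HM0 := Cexpdec_cst_nonneg _ _ _ HM).
  set (d' := Rmin d 1). assert (Hd' : 0 < d' /\ d' <= d /\ d' <= 1).
  { unfold d'. split; [apply Rmin_glb_lt; [apply HM|lra]|split; [apply Rmin_l|apply Rmin_r]]. }
  assert (HB : forall t v, Cmod (h t v) <= M * M2 * exp (- d' * Rabs t) * exp (- d' * Rabs v)).
  { intros t v. unfold h. rewrite Cmod_mult.
    replace (M * M2 * exp (- d' * Rabs t) * exp (- d' * Rabs v))
      with ((M * exp (- d' * Rabs t)) * (M2 * exp (- d' * Rabs v))) by ring.
    assert (At := Rabs_pos t). assert (Av := Rabs_pos v).
    apply Rmult_le_compat; try apply Cmod_ge_0.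
    - apply Rle_trans with (1 := proj2 (proj2 HM) t). apply Rmult_le_compat_l; trivial.
      apply exp_le_exp. nra.
    - rewrite Cmod_cexp.
      replace (Re (v - - (P * vline c t) * RtoC (exp v))%C) with (1 * v - - (P * c) * exp v)
        by (unfold vline; simpl; ring).
      apply Rle_trans with (1 := B2 v). apply Rmult_le_compat_l; trivial. apply exp_le_exp. nra. }
  assert (vc2 : forall p : R * R, Ccont (fun p : R * R => vline c (fst p)) p).
  { intros p. split; [apply continuous_const|apply Ccont2_fst]. }
  assert (HC : Ccont2 h).
  { intros p. assert (vp := vc2 p). assert (HS := proj1 (sine_kernel_logistic P c 0 (fst p) HP)).
    unfold h, sineK. Ccont_auto.
    apply (csin_cont (fun p : R * R => RtoC P * vline c (fst p) * PI)%C). Ccont_auto. }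
  assert (F := Cfubini _ d' h HC HB (proj1 Hd')).
  assert (HPC : RtoC P <> 0) by (apply RtoC_neq_0; lra).
  assert (E1 : forall t, CIline (h t) =
     (RtoC (- / P) * (sineK P c t / vline c t * cexp (- (P * vline c t * Y))))%C).
  { intros t. destruct (CIline_exp_kernel (- (P * vline c t))%C) as [[M3 [_ H3]] E3];
      [rewrite Rl; trivial|].
    assert (Hv := vline_neq_0 c t ltac:(lra)).
    unfold h. rewrite (CIline_scal _ _ _ _ H3), E3. rewrite RtoC_opp, RtoC_inv by lra.
    field. split; trivial. }
  assert (E2 : forall v, CIline (fun t => h t v) = RtoC ((- (2 * PI / P)) * (exp v * / (1 + exp (exp v - Y))))).
  { intros v. destruct (sineK_Cexpdec P c (Y - exp v) HP0 HP) as [[M3 [d3 H3]] E3].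
    transitivity (CIline (fun t => RtoC (exp v) *
        (sineK P c t * cexp (- (P * vline c t * RtoC (Y - exp v)))))%C).
    - apply CIline_ext. intros t. unfold h.
      replace (- (P * vline c t * RtoC (Y - exp v)))%C
        with (- (P * vline c t * Y) + P * vline c t * RtoC (exp v))%C by (rewrite RtoC_minus; ring).
      replace (v - - (P * vline c t) * RtoC (exp v))%C with (v + P * vline c t * RtoC (exp v))%C by ring.
      rewrite !cexp_plus, (cexp_RtoC v). ring.
    - rewrite (CIline_scal _ _ _ _ H3), E3, <- RtoC_mult. f_equal.
      replace (- (Y - exp v)) with (exp v - Y) by ring. ring. }
  rewrite (CIline_ext _ _ E1), (CIline_ext _ _ E2) in F.
  destruct (Iline_softplus Y) as [[M4 H4] E4].
  rewrite CIline_RtoC, (Iline_scal _ _ _ _ H4), E4 in F.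
  destruct (mellin_log_Cexpdec P c Y HP0 HP) as [M5 [d5 HS]].
  rewrite (CIline_scal _ _ _ _ HS) in F.
  transitivity (RtoC (- P) * (RtoC (- / P) * CIline (fun t => sineK P c t / vline c t * cexp (- (P * vline c t * Y)))))%C.
  - rewrite Cmult_assoc, <- RtoC_mult. replace (- P * - / P) with 1 by (field; lra). ring.
  - apply (eq_trans (f_equal (Cmult (RtoC (- P))) F)). rewrite <- RtoC_mult. f_equal. field. lra.
Qed.

Lemma Cexpdec_CIline_param M d h : Ccont2 h ->
  (forall x y, Cmod (h x y) <= M * exp (- d * Rabs x) * exp (- d * Rabs y)) -> 0 < d ->
  Cexpdec (4 * M / d) d (fun x => CIline (h x)).
Proof.
  intros Hh Hb Hd.
  assert (Xr := expdec_Iline_param M d _ (Ccont2_Re _ Hh)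
    (fun x y => Rle_trans _ _ _ (Re_le_Cmod _) (Hb x y)) Hd).
  assert (Xi := expdec_Iline_param M d _ (Ccont2_Im _ Hh)
    (fun x y => Rle_trans _ _ _ (Im_le_Cmod _) (Hb x y)) Hd).
  split; [trivial|split].
  - intros x. destruct Xr as [_ [Cr _]]. destruct Xi as [_ [Cim _]]. split; [apply Cr|apply Cim].
  - intros x. replace (4 * M / d * exp (- d * Rabs x)) with (4 * (M * exp (- d * Rabs x)) / d) by (field; lra).
    apply CIline_bound. split; [trivial|split; [apply Ccont2_1; trivial|apply Hb]].
Qed.

(** The function [ln (1 + A u^k)] in the variables [u = exp x] and [l = ln A]. *)
Definition softplus (k l x : R) : R := ln (1 + exp (k * x + l)).

Lemma softplus_bounds k l x : 0 <= softplus k l x <= exp (k * x + l).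
Proof.
  unfold softplus. assert (Hx := exp_pos (k * x + l)).
  assert (I := exp_ineq1_le (exp (k * x + l))).
  split.
  - rewrite <- ln_1. left; apply ln_increasing; lra.
  - rewrite <- (ln_exp (exp (k * x + l))) at 2.
    destruct I as [I|I]; [left; apply ln_increasing; lra|rewrite <- I; lra].
Qed.

Lemma softplus_continuous k l x : continuous (softplus k l) x.
Proof.
  unfold softplus. der_cont.
  assert (Hx := exp_pos (k * x + l)). lra.
Qed.

Lemma softplus_gamma_expdec a k l : 0 < a -> 0 < k ->
  exists M d, expdec M d (fun x => rgammaK a x * softplus k l x).
Proof.
  intros Ha Hk. destruct (exp_kernel_decay (a + k) 1 ltac:(lra) Rlt_0_1) as [M [HM B]].
  exists (exp l * M), (a + k). split; [lra|split].
  - intros x. apply (continuous_Rmult (rgammaK a) (softplus k l)); [apply rgammaK_continuous|apply softplus_continuous].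
  - intros x. unfold rgammaK. assert (Hy := exp_pos (a * x - exp x)).
    assert (S := softplus_bounds k l x).
    rewrite Rabs_pos_eq by (apply Rmult_le_pos; lra).
    apply Rle_trans with (exp l * exp ((a + k) * x - 1 * exp x)).
    + replace (exp l * exp ((a + k) * x - 1 * exp x)) with (exp (a * x - exp x) * exp (k * x + l))
        by (rewrite <- !exp_plus; f_equal; ring).
      apply Rmult_le_compat_l; lra.
    + rewrite Rmult_assoc. apply Rmult_le_compat_l; [left; apply exp_pos|apply B].
Qed.

Definition mbK (P Q c a lA t : R) : C :=
  (sineK P c t / vline c t * cexp (- (P * vline c t * lA))
   * CGamma (a - Q * vline c t))%C.

(** The modulus of [gammaK (a - Q s) x] depends on [s] only through [Re s = c], so the product bound
    for Fubini takes its decay in [t] from the sine factor alone. In the [t]-integral the factor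
    [exp (- Q s x)] merges with [exp (- P s lA)], which is [mellin_log] at [Q / P * x + lA]. *)
Lemma mellin_barnes P Q c a lA : 0 < P -> 0 < Q -> -1 < P * c < 0 -> 0 < a ->
  (exists M d, Cexpdec M d (mbK P Q c a lA)) /\
  CIline (mbK P Q c a lA) =
  RtoC (2 * PI * Iline (fun x => rgammaK a x * softplus (Q / P) lA x)).
Proof.
  intros HP0 HQ HP Ha.
  set (K := fun t Y => (sineK P c t / vline c t * cexp (- (P * vline c t * Y)))%C).
  set (h := fun t x => (K t lA * gammaK (a - Q * vline c t) x)%C).
  destruct (mellin_log_Cexpdec P c lA HP0 HP) as [M [d HM]].
  assert (HM0 := Cexpdec_cst_nonneg _ _ _ HM).
  assert (Rz : forall t, Re (a - Q * vline c t)%C = a - Q * c) by (intros; unfold vline; simpl; ring).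
  assert (Hk : 0 < a - Q * c) by nra.
  destruct (exp_kernel_decay (a - Q * c) 1 Hk Rlt_0_1) as [M2 [HM2 B2]].
  set (d' := Rmin d (a - Q * c)). assert (Hd' : 0 < d' /\ d' <= d /\ d' <= a - Q * c).
  { unfold d'. split; [apply Rmin_glb_lt; [apply HM|lra]|split; [apply Rmin_l|apply Rmin_r]]. }
  assert (HB : forall t v, Cmod (h t v) <= M * M2 * exp (- d' * Rabs t) * exp (- d' * Rabs v)).
  { intros t v. unfold h. rewrite Cmod_mult.
    replace (M * M2 * exp (- d' * Rabs t) * exp (- d' * Rabs v))
      with ((M * exp (- d' * Rabs t)) * (M2 * exp (- d' * Rabs v))) by ring.
    assert (At := Rabs_pos t). assert (Av := Rabs_pos v).
    apply Rmult_le_compat; try apply Cmod_ge_0.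
    - apply Rle_trans with (1 := proj2 (proj2 HM) t). apply Rmult_le_compat_l; trivial.
      apply exp_le_exp. nra.
    - rewrite Cmod_gammaK, Rz. rewrite <- (Rmult_1_l (exp v)).
      apply Rle_trans with (1 := B2 v). apply Rmult_le_compat_l; trivial. apply exp_le_exp. nra. }
  assert (vc2 : forall p : R * R, Ccont (fun p : R * R => vline c (fst p)) p).
  { intros p. split; [apply continuous_const|apply Ccont2_fst]. }
  assert (HC : Ccont2 h).
  { intros p. apply Ccont_mult.
    - destruct (proj1 (proj2 HM) (fst p)) as [Cr Cim]. split.
      + apply (continuous_comp (fun p : R * R => fst p) (fun t => Re (K t lA))); [apply Ccont2_fst|exact Cr].
      + apply (continuous_comp (fun p : R * R => fst p) (fun t => Im (K t lA))); [apply Ccont2_fst|exact Cim].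
    - assert (vp := vc2 p). unfold gammaK. Ccont_auto. }
  assert (F := Cfubini _ d' h HC HB (proj1 Hd')).
  assert (X := Cexpdec_CIline_param _ d' h HC HB (proj1 Hd')).
  assert (E1 : (fun t => CIline (h t)) = mbK P Q c a lA).
  { extensionality t. unfold mbK.
    assert (Hz : 0 < Re (a - Q * vline c t)%C) by (rewrite Rz; trivial).
    destruct (gammaK_expdec _ Hz) as [M3 H3].
    rewrite CGamma_CIline by trivial. unfold h. rewrite (CIline_scal _ _ _ _ H3). reflexivity. }
  rewrite E1 in F, X. split; [eexists; eexists; exact X|].
  rewrite F.
  assert (E2 : forall x, CIline (fun t => h t x) =
     RtoC (2 * PI * (rgammaK a x * softplus (Q / P) lA x))).
  { intros x. destruct (mellin_log_Cexpdec P c (Q / P * x + lA) HP0 HP) as [M3 [d3 H3]].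
    transitivity (CIline (fun t => RtoC (rgammaK a x) *
      (sineK P c t / vline c t * cexp (- (P * vline c t * RtoC (Q / P * x + lA)))))%C).
    - apply CIline_ext. intros t. unfold h, K. rewrite <- gammaK_RtoC. unfold gammaK.
      replace ((a - Q * vline c t) * x - RtoC (exp x))%C
        with (a * x - RtoC (exp x) + - (Q * vline c t * x))%C by ring.
      replace (- (P * vline c t * RtoC (Q / P * x + lA)))%C
        with (- (Q * vline c t * x) + - (P * vline c t * lA))%C.
      + rewrite !(cexp_plus _ (- _)%C). ring.
      + rewrite RtoC_plus, RtoC_mult, RtoC_div by lra. field. apply RtoC_neq_0; lra.
    - rewrite (CIline_scal _ _ _ _ H3), mellin_log, <- RtoC_mult by trivial. unfold softplus. f_equal. ring. }
  rewrite (CIline_ext _ _ E2), CIline_RtoC. f_equal.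
  destruct (softplus_gamma_expdec a (Q / P) lA Ha ltac:(apply Rdiv_lt_0_compat; trivial)) as [M4 [d4 HG]].
  apply (Iline_scal _ _ _ _ HG).
Qed.

Lemma csin_opp w : csin (- w)%C = (- csin w)%C.
Proof.
  unfold csin. replace (Ci * - w)%C with (- (Ci * w))%C by ring.
  replace (- - (Ci * w))%C with (Ci * w)%C by ring. field. apply Ci_nz.
Qed.

Lemma CGamma_neq_0 z : 0 < Re z < 1 -> CGamma z <> 0.
Proof.
  intros Hz K. assert (E := CGamma_reflection z Hz). rewrite K in E.
  assert (P := PI_RGT_0). apply (RtoC_neq_0 PI); [lra|]. rewrite <- E. ring.
Qed.

(* Gauss multiplication at [-s] and at [1/p + s] collapses the [p] reflection products
   [Gamma (i/p - s) * Gamma (1 - i/p + s)] to a single one. *)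
Lemma gprod_reflection p c t : (0 < p)%nat -> -1 < INR p * c < 0 ->
  (gprod p (- vline c t) * gprod p (RtoC (1 / INR p) + vline c t))%C =
  (- (RtoC (exp ((INR p - 1) * ln (2 * PI))) * sineK (INR p) c t))%C.
Proof.
  intros Hp HP. assert (Hp0 := lt_0_INR _ Hp). assert (Hc : c < 0) by nra.
  set (s := vline c t). set (P := INR p) in *.
  assert (Hcp : - (1 / P) < c).
  { apply Rmult_lt_reg_l with P; trivial. replace (P * - (1 / P)) with (-1) by (field; lra). lra. }
  assert (E1 := gauss_multiplication p (- s)%C Hp ltac:(unfold s, vline; simpl; lra)).
  assert (E2 := gauss_multiplication p (RtoC (1 / P) + s)%C Hp ltac:(unfold s, vline; simpl; lra)).
  fold P in E1, E2.
  set (K := RtoC (exp ((P - 1) / 2 * ln (2 * PI) + 1 / 2 * ln P))) in *.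
  assert (HPC : RtoC P <> 0) by (apply RtoC_neq_0; lra).
  set (w := (P * s)%C).
  replace (P * - s)%C with (- w)%C in E1 by (unfold w; ring).
  replace (P * (RtoC (1 / P) + s))%C with (1 - - w)%C in E2
    by (unfold w; rewrite RtoC_div by lra; field; trivial).
  assert (R := CGamma_reflection (- w)%C ltac:(unfold w, s, vline; simpl; lra)).
  destruct (sine_kernel_logistic P c 0 t HP) as [HS _]. fold s w in HS.
  replace (- w * PI)%C with (- (w * PI))%C in R by ring. rewrite csin_opp in R.
  assert (EG : (CGamma (- w) * CGamma (1 - - w))%C = (- (PI / csin (w * PI)))%C).
  { rewrite <- R at 1. set (S := csin _) in *. field. trivial. }
  assert (EK : (K * K)%C = (RtoC (exp ((P - 1) * ln (2 * PI))) * P)%C).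
  { unfold K. rewrite <- !RtoC_mult. f_equal. transitivity (exp ((P - 1) * ln (2 * PI)) * exp (ln P)); [|rewrite (exp_ln P) by trivial; reflexivity].
    rewrite <- !exp_plus. f_equal. field. }
  assert (EL : (cexp (- w * RtoC (ln P)) * cexp ((1 - - w) * RtoC (ln P)))%C = RtoC P).
  { rewrite <- cexp_plus. replace (- w * RtoC (ln P) + (1 - - w) * RtoC (ln P))%C with (RtoC (ln P)) by ring.
    rewrite cexp_RtoC, exp_ln by trivial. reflexivity. }
  assert (Pr : (P * (gprod p (- s) * gprod p (RtoC (1 / P) + s)))%C =
    (K * K * (CGamma (- w) * CGamma (1 - - w)))%C).
  { rewrite <- EL.
    transitivity ((cexp (- w * RtoC (ln P)) * gprod p (- s)) * (cexp ((1 - - w) * RtoC (ln P)) * gprod p (RtoC (1 / P) + s)))%C; [ring|].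
    rewrite E1, E2. ring. }
  rewrite EK, EG in Pr. unfold sineK. fold s w.
  transitivity (P * (gprod p (- s) * gprod p (RtoC (1 / P) + s)) / P)%C; [field; trivial|].
  rewrite Pr. field. split; trivial.
Qed.

Lemma gprod_gauss_vline q a c t : (0 < q)%nat -> 0 < a -> c < 0 ->
  gprod q (RtoC (a / INR q) - vline c t)%C =
  (RtoC (exp ((INR q - 1) / 2 * ln (2 * PI) + (1 / 2 - a) * ln (INR q)))
   * cexp (RtoC (INR q) * vline c t * RtoC (ln (INR q)))
   * CGamma (a - RtoC (INR q) * vline c t))%C.
Proof.
  intros Hq Ha Hc. assert (Hq0 := lt_0_INR _ Hq). set (Q := INR q) in *.
  assert (HQC : RtoC Q <> 0) by (apply RtoC_neq_0; lra).
  assert (Haq : 0 < a / Q) by (apply Rdiv_lt_0_compat; trivial).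
  assert (E := gauss_multiplication q (RtoC (a / Q) - vline c t)%C Hq ltac:(unfold vline; simpl; lra)).
  fold Q in E.
  replace (Q * (RtoC (a / Q) - vline c t))%C with (a - Q * vline c t)%C in E
    by (rewrite RtoC_div by lra; field; trivial).
  set (w := (Q * vline c t * RtoC (ln Q))%C).
  replace ((a - Q * vline c t) * RtoC (ln Q))%C with (RtoC (a * ln Q) - w)%C in E
    by (unfold w; rewrite RtoC_mult; ring).
  rewrite cexp_minus, cexp_RtoC in E.
  assert (Hw := cexp_neq_0 w). assert (HA := RtoC_neq_0 _ (Rgt_not_eq _ _ (exp_pos (a * ln Q)))).
  set (X := gprod q _) in *. set (Y := CGamma _) in *.
  transitivity (cexp w / RtoC (exp (a * ln Q)) * (RtoC (exp (a * ln Q)) / cexp w * X))%C; [field; split; trivial|].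
  rewrite E.
  replace ((Q - 1) / 2 * ln (2 * PI) + (1 / 2 - a) * ln Q)
    with (((Q - 1) / 2 * ln (2 * PI) + 1 / 2 * ln Q) + - (a * ln Q)) by ring.
  rewrite (exp_plus _ (- (a * ln Q))), exp_Ropp, (RtoC_mult _ (/ _)), RtoC_inv by (apply Rgt_not_eq, exp_pos).
  field. trivial.
Qed.

Lemma Cprod_DeltaL_minus n b s :
  Cprod (map (fun bj => CGamma (Cminus (RtoC bj) s)) (DeltaL n b)) = gprod n (RtoC (b / INR n) - s)%C.
Proof.
  unfold DeltaL. rewrite map_map. apply (f_equal Cprod), map_ext. intros i.
  f_equal. unfold Rdiv. rewrite Rmult_plus_distr_r, RtoC_plus. ring.
Qed.

(** Reversing the index turns [1 - i/n] into [1/n + (n - 1 - i)/n], so this is again a Gauss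
    product. *)
Lemma Cprod_DeltaL_one_minus n s : (0 < n)%nat ->
  Cprod (map (fun aj => CGamma (Cplus (RtoC (1 - aj)) s)) (DeltaL n 0)) = gprod n (RtoC (1 / INR n) + s)%C.
Proof.
  intros Hn. assert (Hn0 := lt_0_INR _ Hn).
  unfold DeltaL. rewrite map_map. unfold gprod.
  change (cprod (fun i => CGamma (RtoC (1 - (0 + INR i) / INR n) + s)%C) n =
          cprod (fun i => CGamma (RtoC (1 / INR n) + s + RtoC (INR i / INR n)))%C n).
  rewrite <- cprod_rev. apply cprod_ext. intros i Hi. f_equal.
  replace (1 - (0 + INR (n - 1 - i)) / INR n) with (1 / INR n + INR i / INR n).
  - rewrite RtoC_plus. ring.
  - rewrite !minus_INR by lia. simpl (INR 1). field. lra.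
Qed.

Lemma DeltaL_length n b : length (DeltaL n b) = n.
Proof. unfold DeltaL. rewrite length_map, length_seq. reflexivity. Qed.

Lemma firstn_app_exact {T} (l l' : list T) n : length l = n -> firstn n (l ++ l') = l.
Proof.
  intros <-. rewrite firstn_app, Nat.sub_diag, firstn_all. simpl. apply app_nil_r.
Qed.

Lemma skipn_app_exact {T} (l l' : list T) n : length l = n -> skipn n (l ++ l') = l'.
Proof.
  intros <-. rewrite skipn_app, Nat.sub_diag, skipn_all. reflexivity.
Qed.

(** The trailing parameters [0] below and [1] above contribute
    [Gamma (- s) / Gamma (1 - s) = - 1 / s], whose sign cancels the one in [gprod_reflection]. The
    hypothesis on [ln z] says [z = q^(-q) A^(-p)]: its first factor cancels the [q^(q s)] of Gauss's
    formula for the block [DeltaL q a], its second is the power of [A] in [mbK]. *)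
Lemma meijerG_eval p q a c lA z : (0 < p)%nat -> (0 < q)%nat -> 0 < a -> -1 < INR p * c < 0 ->
  ln z = - (INR q * ln (INR q)) - INR p * lA ->
  meijerG (q + p + 1) p (DeltaL p 0 ++ 1 :: nil) (DeltaL p 0 ++ DeltaL q a ++ 0 :: nil) c z =
  RtoC (exp ((INR p - 1) * ln (2 * PI) + ((INR q - 1) / 2 * ln (2 * PI) + (1 / 2 - a) * ln (INR q)))
   * Iline (fun x => rgammaK a x * softplus (INR q / INR p) lA x)).
Proof.
  intros Hp Hq Ha HP Hz. assert (Hp0 := lt_0_INR _ Hp). assert (Hq0 := lt_0_INR _ Hq).
  assert (Hc : c < 0) by nra. assert (Ppos := PI_RGT_0).
  assert (Hc1 : -1 < c).
  { assert (1 <= INR p) by (apply (le_INR 1); lia). nra. }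
  destruct (mellin_barnes (INR p) (INR q) c a lA Hp0 Hq0 HP Ha) as [[M [d HM]] E].
  unfold meijerG.
  rewrite (firstn_app_exact _ _ p) by apply DeltaL_length.
  rewrite (skipn_app_exact _ _ p) by apply DeltaL_length.
  rewrite firstn_all2, skipn_all2
    by (rewrite !length_app, !DeltaL_length; simpl; lia).
  set (C1 := RtoC (exp ((INR p - 1) * ln (2 * PI)))).
  set (C2 := RtoC (exp ((INR q - 1) / 2 * ln (2 * PI) + (1 / 2 - a) * ln (INR q)))).
  assert (HK := Cexpdec_scal _ _ _ (C1 * C2)%C HM).
  match goal with |- Cmult _ (Cint_line ?f) = _ => replace f with (fun t => (C1 * C2) * mbK (INR p) (INR q) c a lA t)%C end.
  - rewrite (Cint_line_CIline _ _ _ HK), (CIline_scal _ _ _ _ HM), E.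
    unfold C1, C2. rewrite <- !RtoC_mult. f_equal. rewrite (exp_plus ((INR p - 1) * ln (2 * PI))). field. lra.
  - extensionality t. cbv zeta. change ((c, t) : C) with (vline c t).
    rewrite !map_app, !Cprod_app, !Cprod_DeltaL_minus, Cprod_DeltaL_one_minus by trivial.
    unfold mbK.
    set (s := vline c t). simpl (map _ (_ :: nil)). unfold Cprod. simpl fold_right.
    assert (Hs0 : s <> 0) by (apply vline_neq_0; lra).
    assert (Hs : 0 < Re (- s)%C < 1) by (unfold s, vline; simpl; lra).
    replace (RtoC 0 - s)%C with (- s)%C by ring.
    replace (RtoC 1 - s)%C with (- s + 1)%C by ring.
    rewrite CGamma_succ by apply Hs. assert (HG := CGamma_neq_0 (- s)%C Hs).
    replace (RtoC (0 / INR p) - s)%C with (- s)%C by (unfold Rdiv; rewrite Rmult_0_l; ring).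
    assert (EQ := gprod_gauss_vline q a c t Hq Ha Hc). fold s C2 in EQ. rewrite EQ.
    rewrite Cpowr_cexp, Hz.
    assert (ER := gprod_reflection p c t Hp HP). fold s C1 in ER.
    replace (- (RtoC (INR p) * s * lA))%C
      with (RtoC (INR q) * s * RtoC (ln (INR q)) + s * RtoC (- (INR q * ln (INR q)) - INR p * lA))%C
      by (rewrite RtoC_minus, RtoC_opp, !RtoC_mult; ring).
    rewrite cexp_plus.
    set (g1 := gprod p (- s)%C) in *. set (g2 := gprod p (RtoC (1 / INR p) + s)%C) in *.
    set (e1 := cexp (RtoC (INR q) * s * RtoC (ln (INR q)))%C).
    set (e2 := cexp (s * _)%C). set (G1 := CGamma (a - _)%C).
    transitivity ((g1 * g2) * (- (C2 * e1 * G1 * e2 / s)))%C.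
    + rewrite ER. field. trivial.
    + field. split; [trivial|]. trivial.
Qed.

(** * The ergodic capacity *)

Lemma is_series_RtoC (u : nat -> R) (l : R) : is_series u l ->
  is_series (V := C_NormedModule) (fun k => RtoC (u k)) (RtoC l).
Proof.
  intros H.
  assert (E : forall n, sum_n (G := C_NormedModule) (fun k => RtoC (u k)) n = RtoC (sum_n u n)).
  { induction n as [|n IH]; [rewrite !sum_O; reflexivity|].
    rewrite !sum_Sn, IH. symmetry. apply RtoC_plus. }
  apply (filterlim_ext (fun n => RtoC (sum_n u n))); [intros; symmetry; apply E|].
  apply (filterlim_comp _ _ _ (sum_n u) RtoC _ (locally l)); [exact H|].
  intros Q [e He]. exists e. intros y Hy. apply He. split; [exact Hy|apply ball_center].
Qed.

Lemma pow_div_fact_le_exp x k : 0 <= x -> x ^ k / INR (fact k) <= exp x.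
Proof.
  intros Hx. set (u := fun n => x ^ n / INR (fact n)).
  assert (H : is_series u (exp x)).
  { apply (is_series_ext (fun n => scal (pow_n (K := R_AbsRing) x n) (/ INR (fact n)))).
    - intros n. rewrite pow_n_pow. reflexivity.
    - apply (is_exp_Reals x). }
  assert (T : forall n, 0 <= u n).
  { intros n. apply Rmult_le_pos; [apply pow_le; trivial|left; apply Rinv_0_lt_compat, INR_fact_lt_0]. }
  assert (S : forall n, sum_n u (S n) = sum_n u n + u (S n)) by (intros; apply (sum_Sn (G := R_AbelianMonoid) u)).
  apply Rle_trans with (sum_n u k).
  - change (u k <= sum_n u k). destruct k as [|k]; [rewrite sum_O; lra|]. rewrite S.
    assert (P : 0 <= sum_n u k).
    { induction k as [|k IH]; [rewrite sum_O; apply T|]. rewrite S. specialize (T (Datatypes.S k)). lra. }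
    lra.
  - apply (is_lim_seq_incr_compare _ (exp x)); [exact H|].
    intros n. rewrite S. specialize (T (Datatypes.S n)). lra.
Qed.

Lemma poch_pos a n : 0 < a -> 0 < poch a n.
Proof.
  intros Ha. induction n as [|n IH]; simpl; [lra|]. assert (Hn := pos_INR n).
  apply Rmult_lt_0_compat; lra.
Qed.

Lemma Gamma_poch a n : 0 < a -> Gamma (a + INR n) = poch a n * Gamma a.
Proof.
  intros Ha. induction n as [|n IH]; [simpl; rewrite Rplus_0_r; ring|].
  rewrite S_INR, <- Rplus_assoc. assert (Hn := pos_INR n).
  rewrite Gamma_succ by lra. rewrite IH. simpl. ring.
Qed.

Lemma ex_series_poch_ratio a b r : 0 < a -> 0 < b -> 0 < r < 1 ->
  ex_series (fun k => poch a k / poch b k * r ^ k).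
Proof.
  intros Ha Hb Hr.
  assert (Pos : forall k, 0 < poch a k / poch b k * r ^ k).
  { intros k. apply Rmult_lt_0_compat; [apply Rdiv_lt_0_compat; apply poch_pos; trivial|apply pow_lt; lra]. }
  apply (ex_series_ext (fun k => Rabs (poch a k / poch b k * r ^ k))).
  { intros k. apply Rabs_pos_eq. left; apply Pos. }
  apply (ex_series_DAlembert _ r); [lra|intros n; apply Rgt_not_eq, Pos|].
  apply (is_lim_seq_ext (fun n => (1 + (a - b) * / (b + INR n)) * r)).
  - intros n. assert (Hn := pos_INR n). assert (H1 := poch_pos a n Ha). assert (H2 := poch_pos b n Hb).
    assert (H3 := pow_lt r n ltac:(lra)).
    rewrite Rabs_pos_eq by (left; apply Rdiv_lt_0_compat; apply Pos).
    simpl. field. repeat split; lra.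
  - replace (Finite r) with (Finite ((1 + (a - b) * 0) * r)) by (f_equal; ring).
    apply is_lim_seq_mult'; [|apply is_lim_seq_const].
    apply is_lim_seq_plus'; [apply is_lim_seq_const|].
    apply is_lim_seq_mult'; [apply is_lim_seq_const|].
    apply (is_lim_seq_inv (fun n => b + INR n) p_infty); [|discriminate].
    apply (is_lim_seq_plus (fun _ => b) INR b p_infty); [apply is_lim_seq_const|apply is_lim_seq_INR|reflexivity].
Qed.

(** The power [exp x ^ n] of the expanded confluent series is absorbed into the gamma kernel,
    raising its parameter to [mX + n]; likewise [poch mX n * Gamma mX] has become
    [Gamma (mX + n)]. *)
Definition capacity_term (mX mY bb k l : R) (n : nat) (x : R) : R :=
  poch mY n / Gamma (mX + INR n) * bb ^ n / INR (fact n) * (rgammaK (mX + INR n) x * softplus k l x).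

Definition capacity_sum (mX mY bb k l x : R) : R :=
  rgammaK mX x * softplus k l x / Gamma mX * hyp1F1 mY mX (bb * exp x).

(* With [bb < rho < 1], the bound [(rho e^x)^n / n! <= exp (rho e^x)] leaves the geometric
   factor [(bb / rho)^n] and the integrable factor [exp (- (1 - rho) e^x)]. *)
Lemma capacity_term_bound mX mY bb k l : 0 < mX -> 0 < mY -> 0 < bb < 1 -> 0 < k ->
  exists (M : nat -> R) d, 0 < d /\ ex_series M /\ forall n, expdec (M n) d (capacity_term mX mY bb k l n).
Proof.
  intros HX HY Hb Hk. set (rho := (1 + bb) / 2). assert (Hr : bb < rho < 1) by (unfold rho; lra).
  destruct (exp_kernel_decay (mX + k) (1 - rho) ltac:(lra) ltac:(lra)) as [M0 [HM0 B]].
  assert (HG := Gamma_pos mX HX).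
  exists (fun n => exp l * M0 / Gamma mX * (poch mY n / poch mX n * (bb / rho) ^ n)), (mX + k).
  split; [lra|split].
  - apply (ex_series_scal (exp l * M0 / Gamma mX) (fun n => poch mY n / poch mX n * (bb / rho) ^ n)).
    apply ex_series_poch_ratio; trivial. split; [apply Rdiv_lt_0_compat; lra|].
    apply Rmult_lt_reg_r with rho; [lra|]. unfold Rdiv. rewrite Rmult_assoc, Rinv_l by lra. lra.
  - intros n.
    assert (H1 := poch_pos mX n HX). assert (H2 := poch_pos mY n HY).
    assert (H3 : 0 < (bb / rho) ^ n) by (apply pow_lt, Rdiv_lt_0_compat; lra).
    split; [lra|split].
    + intros x. apply (continuous_Rmult (fun _ => poch mY n / Gamma (mX + INR n) * bb ^ n / INR (fact n))); [apply continuous_const|].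
      apply (continuous_Rmult (rgammaK (mX + INR n)) (softplus k l)); [apply rgammaK_continuous|apply softplus_continuous].
    + intros x. unfold capacity_term. rewrite Gamma_poch by trivial.
      assert (S := softplus_bounds k l x). assert (HR : 0 < rgammaK (mX + INR n) x) by apply exp_pos.
      assert (HF := INR_fact_lt_0 n). assert (Hbn : 0 < bb ^ n) by (apply pow_lt; lra).
      set (A := poch mY n / (poch mX n * Gamma mX)).
      assert (HA : 0 < A) by (apply Rdiv_lt_0_compat; [|apply Rmult_lt_0_compat]; trivial).
      assert (Hpos : 0 <= A * bb ^ n / INR (fact n)).
      { left. apply Rdiv_lt_0_compat; [apply Rmult_lt_0_compat|]; trivial. }
      rewrite Rabs_pos_eq by (apply Rmult_le_pos; [trivial|apply Rmult_le_pos; lra]).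
      apply Rle_trans with (A * bb ^ n / INR (fact n) * (rgammaK (mX + INR n) x * exp (k * x + l))).
      { apply Rmult_le_compat_l; trivial. apply Rmult_le_compat_l; lra. }
      assert (E : bb ^ n / INR (fact n) * rgammaK (mX + INR n) x =
        (bb / rho) ^ n * ((rho * exp x) ^ n / INR (fact n)) * rgammaK mX x).
      { unfold rgammaK. replace ((mX + INR n) * x - exp x) with (INR n * x + (mX * x - exp x)) by ring.
        rewrite exp_plus. replace (exp (INR n * x)) with (exp x ^ n).
        - unfold Rdiv. rewrite !Rpow_mult_distr, pow_inv. field. split; [lra|apply pow_nonzero; lra].
        - rewrite <- Rpower_pow by apply exp_pos. unfold Rpower. rewrite ln_exp. reflexivity. }
      replace (A * bb ^ n / INR (fact n) * (rgammaK (mX + INR n) x * exp (k * x + l)))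
        with (A * (bb ^ n / INR (fact n) * rgammaK (mX + INR n) x) * exp (k * x + l)) by (field; lra).
      rewrite E.
      assert (Hp := pow_div_fact_le_exp (rho * exp x) n).
      assert (Hx := exp_pos x). specialize (Hp ltac:(apply Rmult_le_pos; lra)).
      apply Rle_trans with (A * ((bb / rho) ^ n * exp (rho * exp x) * rgammaK mX x) * exp (k * x + l)).
      { apply Rmult_le_compat_r; [left; apply exp_pos|]. apply Rmult_le_compat_l; [lra|].
        apply Rmult_le_compat_r; [left; apply exp_pos|]. apply Rmult_le_compat_l; lra. }
      replace (A * ((bb / rho) ^ n * exp (rho * exp x) * rgammaK mX x) * exp (k * x + l))
        with (A * (bb / rho) ^ n * exp l * exp ((mX + k) * x - (1 - rho) * exp x)).
      * replace (exp l * M0 / Gamma mX * (poch mY n / poch mX n * (bb / rho) ^ n) * exp (- (mX + k) * Rabs x))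
          with (A * (bb / rho) ^ n * exp l * (M0 * exp (- (mX + k) * Rabs x))) by (unfold A; field; lra).
        apply Rmult_le_compat_l; [|apply B].
        apply Rmult_le_pos; [apply Rmult_le_pos; lra|left; apply exp_pos].
      * unfold rgammaK.
        replace ((mX + k) * x - (1 - rho) * exp x) with (rho * exp x + (mX * x - exp x) + k * x) by ring.
        rewrite !exp_plus. ring.
Qed.

Lemma capacity_series mX mY bb k l : 0 < mX -> 0 < mY -> 0 < bb < 1 -> 0 < k ->
  (exists M d, expdec M d (capacity_sum mX mY bb k l)) /\
  is_series (fun n => Iline (capacity_term mX mY bb k l n)) (Iline (capacity_sum mX mY bb k l)).
Proof.
  intros HX HY Hb Hk.
  destruct (capacity_term_bound mX mY bb k l HX HY Hb Hk) as [M [d [Hd [HM HE]]]].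
  assert (HG := Gamma_pos mX HX).
  assert (S : forall x, is_series (fun n => capacity_term mX mY bb k l n x) (capacity_sum mX mY bb k l x)).
  { intros x.
    assert (X : ex_series (fun n => capacity_term mX mY bb k l n x)).
    { apply (ex_series_le (V := R_CompleteNormedModule) (fun n => capacity_term mX mY bb k l n x) (fun n => M n * exp (- d * Rabs x))).
      - intros n. apply HE.
      - apply (ex_series_scal_r (exp (- d * Rabs x)) M HM). }
    apply Series_correct in X.
    replace (capacity_sum mX mY bb k l x) with (Series (fun n => capacity_term mX mY bb k l n x)); [exact X|].
    unfold capacity_sum, hyp1F1. rewrite <- Series_scal_l. apply Series_ext. intros n.
    unfold capacity_term. rewrite Gamma_poch by trivial.
    assert (H1 := poch_pos mX n HX). assert (HF := INR_fact_lt_0 n).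
    replace (rgammaK (mX + INR n) x) with (rgammaK mX x * exp x ^ n).
    - rewrite Rpow_mult_distr. field. lra.
    - unfold rgammaK. replace ((mX + INR n) * x - exp x) with ((mX * x - exp x) + INR n * x) by ring.
      rewrite exp_plus. f_equal. rewrite <- Rpower_pow by apply exp_pos. unfold Rpower. rewrite ln_exp. reflexivity. }
  destruct (Iline_series _ M d _ Hd HE HM S) as [R1 R2].
  split; [eexists; eexists; exact R1|exact R2].
Qed.

Lemma betabar_bounds mX mY OX OY : 0 < mX -> 0 < mY -> 0 < OX -> 0 < OY ->
  0 < betabar mX mY OX OY < 1 /\ 1 - betabar mX mY OX OY = mY * OX / (mY * OX + mX * OY).
Proof.
  intros H1 H2 H3 H4. unfold betabar.
  assert (A : 0 < mX * OY) by (apply Rmult_lt_0_compat; trivial).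
  assert (B : 0 < mY * OX) by (apply Rmult_lt_0_compat; trivial).
  assert (E : 1 - mX * OY / (mY * OX + mX * OY) = mY * OX / (mY * OX + mX * OY)) by (field; lra).
  assert (0 < mX * OY / (mY * OX + mX * OY)) by (apply Rdiv_lt_0_compat; lra).
  assert (0 < mY * OX / (mY * OX + mX * OY)) by (apply Rdiv_lt_0_compat; lra).
  repeat split; lra.
Qed.

(** With [r = exp xi], the substitution [x = mX r^2 / OX] is the affine map [2 xi + ln (mX / OX)] of
    the logarithmic variable; its Jacobian [1/2] cancels the factor 2 of the density. *)
Lemma ergodic_capacity_Iline mX mY OX OY alpha gbar :
  0 < mX -> 0 < mY -> 0 < OX -> 0 < OY -> 0 < alpha -> 0 < gbar ->
  let bb := betabar mX mY OX OY in
  ergodic_capacity mX mY OX OY alpha gbar =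
  Rpower (1 - bb) mY / ln 2 *
  Iline (capacity_sum mX mY bb (2 / alpha) (ln gbar + 2 / alpha * ln (C_alpha mX mY OX OY alpha))).
Proof.
  intros HX HY HOX HOY Ha Hg bb.
  destruct (betabar_bounds mX mY OX OY HX HY HOX HOY) as [Hb Eb]. fold bb in Hb, Eb.
  set (Ca := C_alpha mX mY OX OY alpha).
  set (lA := ln gbar + 2 / alpha * ln Ca).
  assert (Hk : 0 < 2 / alpha) by (apply Rdiv_lt_0_compat; lra).
  destruct (capacity_series mX mY bb (2 / alpha) lA HX HY Hb Hk) as [[M [d HE]] _].
  set (g := capacity_sum mX mY bb (2 / alpha) lA) in *.
  assert (HG := Gamma_pos mX HX). assert (Hln2 : 0 < ln 2) by (rewrite <- ln_1; apply ln_increasing; lra).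
  assert (Hm : 0 < mX / OX) by (apply Rdiv_lt_0_compat; trivial).
  set (w := 2 * (Rpower (1 - bb) mY / ln 2)).
  set (sh := ln (mX / OX)).
  set (f := fun r => BX_density mX mY OX OY r * (ln (1 + snr mX mY OX OY alpha gbar r) / ln 2)).
  assert (HD : 0 < mY * OX + mX * OY) by (assert (0 < mX * OY) by nra; nra).
  assert (E : forall xi, exp xi * f (exp xi) = w * g (2 * xi + sh)).
  { intros xi. unfold f, BX_density, snr, g, capacity_sum. fold Ca. rewrite <- Eb.
    assert (E2 : exp (2 * xi + sh) = mX / OX * exp xi ^ 2).
    { unfold sh. rewrite exp_plus, exp_ln by trivial. simpl. rewrite Rmult_1_r, <- exp_plus.
      replace (xi + xi) with (2 * xi) by ring. ring. }
    replace (mX ^ 2 * OY * exp xi ^ 2 / (OX * (mY * OX + mX * OY))) with (bb * exp (2 * xi + sh))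
      by (rewrite E2; unfold bb, betabar; field; lra).
    replace (gbar * Rpower (Ca * mX * exp xi ^ 2 / OX) (2 / alpha)) with (exp (2 / alpha * (2 * xi + sh) + lA)).
    - change (ln (1 + exp (2 / alpha * (2 * xi + sh) + lA))) with (softplus (2 / alpha) lA (2 * xi + sh)).
      replace (- (mX / OX) * exp xi ^ 2) with (- exp (2 * xi + sh)) by (rewrite E2; ring).
      replace (rgammaK mX (2 * xi + sh)) with
        (exp xi * Rpower (exp xi) (2 * mX - 1) * Rpower (mX / OX) mX * exp (- exp (2 * xi + sh))).
      + unfold w. field. lra.
      + unfold rgammaK, Rpower. rewrite ln_exp. fold sh. rewrite <- !exp_plus. f_equal. ring.
    - replace (Ca * mX * exp xi ^ 2 / OX) with (Ca * exp (2 * xi + sh)) by (rewrite E2; field; lra).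
      unfold Rpower. rewrite ln_mult, ln_exp by (trivial; apply exp_pos).
      rewrite <- (exp_ln gbar) at 1 by trivial. rewrite <- exp_plus. f_equal. unfold lA. ring. }
  assert (HEa := expdec_affine _ _ _ 2 sh ltac:(lra) HE).
  unfold ergodic_capacity. fold f.
  rewrite (int0inf_Iline _ _ f _) with (2 := E) (3 := expdec_scal _ _ _ w HEa).
  - rewrite (Iline_scal _ _ _ _ HEa), (Iline_affine _ _ _ 2 sh ltac:(lra) HE). unfold w. field. lra.
  (* Continuity of the integrand on the half line, and with it that of [hyp1F1], is read back from
     the continuity of [g], which came out of the uniform convergence in [Iline_series]. *)
  - intros t Ht. apply (continuous_ext_loc (T := R_UniformSpace) (U := R_UniformSpace) f (fun t => w * g (2 * ln t + sh) * / t)).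
    + exists (mkposreal t Ht). intros y By. change (Rabs (y - t) < t) in By.
      apply Rabs_lt_between in By. rewrite <- E, exp_ln by lra. apply Rminus_diag_uniq. field. lra.
    + apply (continuous_Rmult (fun t => w * g (2 * ln t + sh))).
      * apply (continuous_comp ln (fun x => w * g (2 * x + sh))).
        -- apply (ex_derive_continuous ln). auto_derive. trivial.
        -- apply (expdec_scal _ _ _ w HEa).
      * der_cont. lra.
Qed.

Theorem theorem3 (mX mY OX OY gbar : R) (p q : nat) (c : R) :
  0 < mX -> 0 < mY -> 0 < OX -> 0 < OY -> 0 < gbar ->
  (0 < p)%nat -> (0 < q)%nat -> Nat.gcd p q = 1%nat ->
  (* c : abscissa of a vertical Mellin-Barnes contour separating the poles of
     the Gamma(b_j - s) (all >= 0) from those of Gamma(1 - a_j + s) (all <= -1/p) *)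
  - (1 / INR p) < c < 0 ->
  let alpha := 2 * INR p / INR q in
  let bb := betabar mX mY OX OY in
  let Ca := C_alpha mX mY OX OY alpha in
  exists S : C,
    is_series (fun k : nat =>
        Cmult (RtoC (poch mY k / Gamma (mX + INR k) * (INR q * bb) ^ k / INR (fact k)))
              (meijerG (q + p + 1)%nat p
                 (DeltaL p 0 ++ 1 :: nil)
                 (DeltaL p 0 ++ DeltaL q (mX + INR k) ++ 0 :: nil)
                 c
                 ((1 / (INR q * Ca * Rpower gbar (alpha / 2))) ^ q)))
      S /\
    RtoC (ergodic_capacity mX mY OX OY alpha gbar)
    = Cmult (RtoC (Rpower (INR q) (mX - 1 / 2) * Rpower (1 - bb) mY
                   / (Rpower (2 * PI) ((INR q - 3) / 2 + INR p) * ln 2)))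
            S.
Proof.
  intros HX HY HOX HOY Hg Hp Hq _ Hc alpha bb Ca.
  assert (Hp0 := lt_0_INR _ Hp). assert (Hq0 := lt_0_INR _ Hq).
  set (P := INR p) in *. set (Q := INR q) in *.
  assert (Ha : 0 < alpha) by (unfold alpha; apply Rdiv_lt_0_compat; lra).
  assert (Hb := proj1 (betabar_bounds mX mY OX OY HX HY HOX HOY)). fold bb in Hb.
  assert (HCa : 0 < Ca) by apply exp_pos.
  assert (HPc : -1 < P * c < 0).
  { split; [|nra]. replace (-1) with (P * - (1 / P)) by (field; lra). apply Rmult_lt_compat_l; lra. }
  set (lA := ln gbar + Q / P * ln Ca).
  assert (Ek : 2 / alpha = Q / P) by (unfold alpha; field; lra).
  assert (HQP : 0 < Q / P) by (apply Rdiv_lt_0_compat; trivial).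
  destruct (capacity_series mX mY bb (Q / P) lA HX HY Hb HQP) as [_ HS].
  (* The constant of [meijerG_eval] at [k = 0]. For general [k] it acquires the factor [Q^(-k)],
     which cancels the [q^k] in [(q bb)^k]. *)
  set (W := exp ((P - 1) * ln (2 * PI) + ((Q - 1) / 2 * ln (2 * PI) + (1 / 2 - mX) * ln Q))).
  exists (RtoC (W * Iline (capacity_sum mX mY bb (Q / P) lA))). split.
  - apply (is_series_ext (fun k => RtoC (W * Iline (capacity_term mX mY bb (Q / P) lA k)))).
    + intros k. assert (Hk := pos_INR k).
      assert (Hz : ln ((1 / (Q * Ca * Rpower gbar (alpha / 2))) ^ q) = - (Q * ln Q) - P * lA).
      { assert (Hpw : 0 < Rpower gbar (alpha / 2)) by apply exp_pos.
        assert (Hd : 0 < Q * Ca * Rpower gbar (alpha / 2)) by (repeat apply Rmult_lt_0_compat; trivial).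
        rewrite ln_pow by (apply Rdiv_lt_0_compat; lra). fold Q.
        unfold Rdiv at 1. rewrite Rmult_1_l, ln_Rinv, !ln_mult by (trivial; apply Rmult_lt_0_compat; trivial).
        unfold Rpower at 1. rewrite ln_exp. unfold lA, alpha. field. lra. }
      rewrite (meijerG_eval p q (mX + INR k) c lA) by (trivial; lra).
      rewrite <- RtoC_mult. f_equal. fold P Q.
      assert (EI : Iline (capacity_term mX mY bb (Q / P) lA k) =
        poch mY k / Gamma (mX + INR k) * bb ^ k / INR (fact k) *
        Iline (fun x => rgammaK (mX + INR k) x * softplus (Q / P) lA x)).
      { destruct (softplus_gamma_expdec (mX + INR k) (Q / P) lA ltac:(lra) HQP) as [M [d HE]].
        apply (Iline_scal _ _ _ _ HE). }
      rewrite EI.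
      replace ((P - 1) * ln (2 * PI) + ((Q - 1) / 2 * ln (2 * PI) + (1 / 2 - (mX + INR k)) * ln Q))
        with (((P - 1) * ln (2 * PI) + ((Q - 1) / 2 * ln (2 * PI) + (1 / 2 - mX) * ln Q)) + - (INR k * ln Q)) by ring.
      rewrite exp_plus. fold W. rewrite Rpow_mult_distr.
      replace (exp (- (INR k * ln Q))) with (/ Q ^ k).
      * assert (HF := INR_fact_lt_0 k). assert (HG := Gamma_pos (mX + INR k) ltac:(lra)).
        assert (HQk := pow_lt Q k Hq0). field. repeat split; lra.
      * rewrite exp_Ropp. f_equal. rewrite <- Rpower_pow by trivial. reflexivity.
    + apply is_series_RtoC. exact (is_series_scal_l W _ _ HS).
  - rewrite ergodic_capacity_Iline by trivial. fold bb Ca. rewrite Ek. fold lA.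
    rewrite <- RtoC_mult. f_equal.
    assert (Hln2 : 0 < ln 2) by (rewrite <- ln_1; apply ln_increasing; lra).
    (* The powers of [Q] cancel, and the exponents of [2 pi] add up:
       [(P - 1) + (Q - 1)/2 = (Q - 3)/2 + P]. *)
    assert (EW : Rpower Q (mX - 1 / 2) * W = Rpower (2 * PI) ((Q - 3) / 2 + P)).
    { unfold W, Rpower. rewrite <- exp_plus. f_equal. field. }
    assert (HR : 0 < Rpower (2 * PI) ((Q - 3) / 2 + P)) by apply exp_pos.
    set (I := Iline _).
    replace (Rpower Q (mX - 1 / 2) * Rpower (1 - bb) mY / (Rpower (2 * PI) ((Q - 3) / 2 + P) * ln 2) * (W * I))
      with ((Rpower Q (mX - 1 / 2) * W) * (Rpower (1 - bb) mY / (Rpower (2 * PI) ((Q - 3) / 2 + P) * ln 2) * I))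
      by (field; lra).
    rewrite EW. field. lra.
Qed.
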